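(* There exist continuum-many $6$-dimensional elliptic manifolds of distinct homotopy type, in fact with mutually non-isomorphic fundamental groups and vanishing higher homotopy. That is, there is a family $(S_i)_{i \in I}$ of $6$-dimensional elliptic manifolds, indexed by a set $I$ of cardinality $2^{\aleph_0}$, such that $\pi_n(S_i) = 0$ for all $i \in I$ and all $n > 1$, and such that for all $i \neq j$ in $I$ the groups $\pi_1(S_i)$ and $\pi_1(S_j)$ are not isomorphic (so that $S_i$ and $S_j$ are not homotopy equivalent).
   Context: Dimension means complex dimension, and manifolds whose homotopy groups are considered are understood to be connected. A complex manifold $M$ is elliptic if there exist a holomorphic vector bundle $E \to M$ and a holomorphic map $s : E \to M$ (called a dominating spray) such that, for all $x \in M$, $s(0_x) = x$ and the restriction $s|_{E_x} : E_x \to M$ to the fibre $E_x$ is a submersion at $0_x$, where $0_x$ is the zero vector of $E_x$. *)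

(* Defs.v *)
From HB Require Import structures.
From mathcomp Require Import all_boot all_order all_algebra complex lra.
From mathcomp Require Import generic_quotient.
From mathcomp Require Import boolp classical_sets functions cardinality set_interval.
From mathcomp Require Import reals topology normedtype derive.

Set Implicit Arguments.
Unset Strict Implicit.
Unset Printing Implicit Defensive.

Import Order.TTheory GRing.Theory Num.Theory numFieldNormedType.Exports.

Local Open Scope classical_set_scope.
Local Open Scope ring_scope.
Local Open Scope quotient_scope.

Section continuity_lemmas.
Context {T U X : topologicalType}.

Lemma continuous_pair (f : T -> U) (g : T -> X) :
  continuous f -> continuous g -> continuous (fun x => (f x, g x)).
Proof. by move=> cf cg x; apply: cvg_pair; [exact: cf|exact: cg]. Qed.

Lemma within_comp (A : set T) (B : set U) (f : T -> U) (g : U -> X) :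
  {within A, continuous f} -> {within B, continuous g} ->
  (forall x, A x -> B (f x)) -> {within A, continuous (g \o f)}.
Proof.
move=> /subspace_continuousP cf /subspace_continuousP cg AB.
apply/subspace_continuousP => x Ax.
move=> P /(cg _ (AB _ Ax)) gP.
have := cf _ Ax _ gP; rewrite /= !nbhs_simpl /within /=.
by apply: filterS => t H At; apply: (H At); exact: AB.
Qed.

Lemma within_if_le {R : realType} (A : set T) (c : T -> R) (k : R)
    (f g : T -> X) :
  closed A -> continuous c ->
  {within A `&` [set x | c x <= k], continuous f} ->
  {within A `&` [set x | k <= c x], continuous g} ->
  (forall x, A x -> c x = k -> f x = g x) ->
  {within A, continuous (fun x => if c x <= k then f x else g x)}.
Proof.
move=> clA cc cf cg fg.
have -> : A = (A `&` [set x | c x <= k]) `|` (A `&` [set x | k <= c x]).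
  rewrite -setIUr; apply/seteqP; split=> [x Ax|x []//].
  by split=> //=; case: (leP (c x) k) => [|/ltW]; [left|right].
apply: withinU_continuous.
- by apply: closedI => //; apply: closed_comp (@closed_le _ k) => x _; exact: cc.
- by apply: closedI => //; apply: closed_comp (@closed_ge _ k) => x _; exact: cc.
- apply: subspace_eq_continuous cf => x /set_mem[_ /= cx].
  by rewrite /from_subspace/= cx.
- apply: subspace_eq_continuous cg => x /set_mem[Ax /= kx].
  rewrite /from_subspace/=; case: ifPn => // ck; apply/esym/fg => //.
  by apply/eqP; rewrite eq_le ck.
Qed.

End continuity_lemmas.

Section real_continuity_lemmas.
Context {R : realType} {T : topologicalType}.
Implicit Types f g : T -> R.

Lemma continuous_add f g : continuous f -> continuous g ->
  continuous (fun y => f y + g y).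
Proof. by move=> cf cg y; apply: cvgD; [exact: cf|exact: cg]. Qed.

Lemma continuous_sub f g : continuous f -> continuous g ->
  continuous (fun y => f y - g y).
Proof. by move=> cf cg y; apply: cvgB; [exact: cf|exact: cg]. Qed.

Lemma continuous_mul f g : continuous f -> continuous g ->
  continuous (fun y => f y * g y).
Proof. by move=> cf cg y; apply: cvgM; [exact: cf|exact: cg]. Qed.

Lemma continuous_scale (k : R) f : continuous f -> continuous (fun y => k * f y).
Proof. exact/continuous_mul/cst_continuous. Qed.

Lemma continuous_affine (k b : R) f : continuous f ->
  continuous (fun y => k * f y + b).
Proof.
by move=> cf; apply: continuous_add; [exact: continuous_scale|exact: cst_continuous].
Qed.

Lemma continuous_one_sub f : continuous f -> continuous (fun y => 1 - f y).
Proof. exact/continuous_sub/cst_continuous. Qed.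

Lemma continuous_snd {U : topologicalType} : continuous (@snd T U).
Proof. by move=> y; exact: cvg_snd. Qed.

Lemma continuous_fst {U : topologicalType} : continuous (@fst T U).
Proof. by move=> y; exact: cvg_fst. Qed.

End real_continuity_lemmas.

Section homotopy.
Context (R : realType) {T X : topologicalType}.

(* The maps involved are only meant to be continuous on A; the homotopy is
   stationary on A `&` B. *)
Definition homotopic_rel (A B : set T) (f g : T -> X) : Prop :=
  exists H : R * T -> X,
    [/\ {within `[0, 1] `*` A, continuous H},
        forall t, A t -> H (0, t) = f t,
        forall t, A t -> H (1, t) = g t &
        forall u t, 0 <= u <= 1 -> A t -> B t -> H (u, t) = f t].

Lemma homotopic_rel_refl (A B : set T) (f : T -> X) :
  {within A, continuous f} -> homotopic_rel A B f f.
Proof.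
move=> cf; exists (f \o snd); split => //.
apply: (within_comp _ cf) => [|[u t] []//].
by apply: continuous_subspaceT => x; exact: cvg_snd.
Qed.

Lemma homotopic_rel_sym (A B : set T) (f g : T -> X) :
  homotopic_rel A B f g -> homotopic_rel A B g f.
Proof.
move=> [H [cH H0 H1 Hb]]; exists (fun p => H (1 - p.1, p.2)); split => /=.
- apply: (@within_comp _ _ _ _ _ (fun p : R * T => (1 - p.1, p.2)) H _ cH).
    apply: continuous_subspaceT; apply: continuous_pair; last exact: continuous_snd.
    exact/continuous_one_sub/continuous_fst.
  move=> [u t] [/= + At]; rewrite !in_itv /= => u01; split => //=.
  by rewrite ?in_itv /=; lra.
- by move=> t At; rewrite subr0 H1.
- by move=> t At; rewrite subrr H0.
- move=> u t u01 At Bt; rewrite Hb//; last by lra.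
  by rewrite -(Hb 1)// ?H1// ler01 lexx.
Qed.

Lemma homotopic_rel_trans (A B : set T) (f g h : T -> X) : closed A ->
  homotopic_rel A B f g -> homotopic_rel A B g h -> homotopic_rel A B f h.
Proof.
move=> clA [H [cH H0 H1 Hb]] [K [cK K0 K1 Kb]].
exists (fun p => if p.1 <= 2^-1 then H (2 * p.1, p.2) else K (2 * p.1 - 1, p.2)).
split => /=.
- apply: (@within_if_le _ _ _ _ (fun p : R * T => p.1) 2^-1
           (fun p => H (2 * p.1, p.2)) (fun p => K (2 * p.1 - 1, p.2))).
  + rewrite (_ : _ `*` _ = (fst @^-1` `[0, 1]) `&` (snd @^-1` A)) //.
    apply: closedI; apply: closed_comp => //.
    * by move=> x _; exact: cvg_fst.
    * exact: interval_closed.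
    * by move=> x _; exact: cvg_snd.
  + by move=> x; exact: cvg_fst.
  + apply: (@within_comp _ _ _ _ _ (fun p : R * T => (2 * p.1, p.2)) H _ cH).
      apply: continuous_subspaceT; apply: continuous_pair => p; last exact: cvg_snd.
      by apply: cvgM; [exact: cvg_cst|exact: cvg_fst].
    move=> [u t] [[/= + At] u2]; rewrite !in_itv /= => u01; split => //=.
    by rewrite ?in_itv /=; lra.
  + apply: (@within_comp _ _ _ _ _ (fun p : R * T => (2 * p.1 - 1, p.2)) K _ cK).
      apply: continuous_subspaceT; apply: continuous_pair => p; last exact: cvg_snd.
      by apply: cvgB; [apply: cvgM; [exact: cvg_cst|exact: cvg_fst]|exact: cvg_cst].
    move=> [u t] [[/= + At] u2]; rewrite !in_itv /= => u01; split => //=.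
    by rewrite ?in_itv /=; lra.
  + move=> [u t] [/= _ At] ->; rewrite divff ?pnatr_eq0// subrr.
    by rewrite H1 ?K0.
- by move=> t At; rewrite invr_ge0 ler0n mulr0 H0.
- move=> t At; rewrite ifF; first by rewrite (_ : 2 * 1 - 1 = 1) ?K1//; lra.
  by apply/negbTE; rewrite -ltNge; lra.
- move=> u t u01 At Bt; case: leP => u2; first by rewrite Hb//; lra.
  rewrite Kb//; last by lra.
  by rewrite -(Hb 1)// ?H1// ler01 lexx.
Qed.

End homotopy.

Definition homotopy_equivalent (R : realType) (X Y : topologicalType) : Prop :=
  exists (f : X -> Y) (g : Y -> X),
    [/\ continuous f, continuous g,
        homotopic_rel R setT set0 (g \o f) id &
        homotopic_rel R setT set0 (f \o g) id].

Section cube.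
Context (R : realType) (n : nat).

Definition cube : set 'rV[R]_n := [set t | forall i, 0 <= t ord0 i <= 1].

Definition cube_boundary : set 'rV[R]_n :=
  [set t | cube t /\ exists i, t ord0 i = 0 \/ t ord0 i = 1].

Lemma cube_boundary_cube t : cube_boundary t -> cube t.
Proof. by case. Qed.

Lemma closed_cube : closed cube.
Proof.
have -> : cube = \bigcap_(i in setT) ((fun t : 'rV[R]_n => t ord0 i) @^-1` `[0, 1]).
  apply/seteqP; split=> t /= H i; first by move=> _ /=; rewrite in_itv /=; exact: H.
  by have := H i I; rewrite /= in_itv.
apply: closed_bigI => i _; apply: closed_comp; last exact: interval_closed.
by move=> x _; exact: coord_continuous.
Qed.

End cube.

Arguments cube {R n}.
Arguments cube_boundary {R n}.

Section loops.
Context (R : realType) (X : topologicalType) (x : X) (n : nat).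

(* Values outside of the cube are irrelevant: they are forgotten when passing
   to homotopy classes. *)
Record cube_loop := CubeLoop {
  cube_loop_fun :> 'rV[R]_n -> X;
  cube_loop_continuous : {within cube, continuous cube_loop_fun};
  cube_loop_boundary : forall t, cube_boundary t -> cube_loop_fun t = x
}.

HB.instance Definition _ := gen_eqMixin cube_loop.
HB.instance Definition _ := gen_choiceMixin cube_loop.

Definition loop_homotopic (f g : cube_loop) : Prop :=
  homotopic_rel R cube cube_boundary f g.

Lemma loop_homotopic_refl f : loop_homotopic f f.
Proof. exact/homotopic_rel_refl/cube_loop_continuous. Qed.

Lemma loop_homotopic_sym f g : loop_homotopic f g -> loop_homotopic g f.
Proof. exact: homotopic_rel_sym. Qed.

Lemma loop_homotopic_trans f g h :
  loop_homotopic f g -> loop_homotopic g h -> loop_homotopic f h.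
Proof. exact/homotopic_rel_trans/closed_cube. Qed.

Let hrel (f g : cube_loop) := `[< loop_homotopic f g >].

Let hrel_refl : reflexive hrel.
Proof. by move=> f; apply/asboolP/loop_homotopic_refl. Qed.

Let hrel_sym : symmetric hrel.
Proof. by move=> f g; apply/asbool_equiv_eq; split; exact: loop_homotopic_sym. Qed.

Let hrel_trans : transitive hrel.
Proof.
move=> g f h /asboolP fg /asboolP gh; apply/asboolP.
exact: loop_homotopic_trans gh.
Qed.

Definition loop_equiv : equiv_rel cube_loop :=
  EquivRel hrel hrel_refl hrel_sym hrel_trans.

Definition homotopy_group : Type := {eq_quot loop_equiv}.

HB.instance Definition _ := Choice.on homotopy_group.

Definition homotopy_class (f : cube_loop) : homotopy_group :=
  \pi_{eq_quot loop_equiv} f.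

Definition class_repr (a : homotopy_group) : cube_loop :=
  repr (a : {eq_quot loop_equiv}).

Lemma homotopy_classP f g :
  homotopy_class f = homotopy_class g <-> loop_homotopic f g.
Proof. by split=> [/eqmodP/asboolP//|fg]; apply/eqmodP/asboolP. Qed.

Lemma class_reprK a : homotopy_class (class_repr a) = a.
Proof. exact: reprK. Qed.

Lemma class_repr_homotopic f :
  loop_homotopic (class_repr (homotopy_class f)) f.
Proof. by apply/homotopy_classP; rewrite class_reprK. Qed.

End loops.

Section group_structure.
Context (R : realType) (X : topologicalType) (x : X) (n : nat).
Implicit Types (f g h : cube_loop R x n.+1) (t : 'rV[R]_n.+1).

Definition set_first t (a : R) : 'rV[R]_n.+1 :=
  \row_j (if j == ord0 then a else t ord0 j).

Let first_continuous : continuous (fun t => t ord0 ord0).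
Proof. by move=> t; exact: coord_continuous. Qed.

Let snd_first_continuous :
  continuous (fun y : R * 'rV[R]_n.+1 => y.2 ord0 ord0).
Proof.
move=> y; apply: (@continuous_comp _ _ _ snd (fun t => t ord0 ord0)).
  exact: continuous_snd.
exact: first_continuous.
Qed.

Lemma set_first0 t a : set_first t a ord0 ord0 = a.
Proof. by rewrite mxE eqxx. Qed.

Lemma set_first_id t : set_first t (t ord0 ord0) = t.
Proof. by apply/rowP => j; rewrite mxE; case: eqP => [->|]. Qed.

Lemma set_first_set t a b : set_first (set_first t a) b = set_first t b.
Proof. by apply/rowP => j; rewrite !mxE; case: eqP. Qed.

Lemma set_first_continuous {T : topologicalType}
    (p : T -> 'rV[R]_n.+1) (a : T -> R) :
  continuous p -> continuous a -> continuous (fun y => set_first (p y) (a y)).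
Proof.
move=> cp ca.
rewrite (_ : (fun y => _) =
    (fun y => p y + (a y - p y ord0 ord0) *: delta_mx ord0 ord0)); last first.
  apply/funext => y; apply/rowP => j; rewrite !mxE eqxx /=.
  by case: eqP => [->|_] /=; [rewrite mulr1 addrC subrK|rewrite mulr0 addr0].
move=> y; apply: cvgD; first exact: cp.
apply: cvgZ; last exact: cvg_cst.
apply: cvgB; first exact: ca.
by apply: (@cvg_comp _ _ _ p (fun t => t ord0 ord0) _ _ _ (cp y));
  exact: coord_continuous.
Qed.

Lemma set_first_cube t a : cube t -> 0 <= a <= 1 -> cube (set_first t a).
Proof. by move=> ct a01 i; rewrite mxE; case: ifP. Qed.

Lemma set_first_boundary t a : cube t -> a = 0 \/ a = 1 ->
  cube_boundary (set_first t a).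
Proof.
move=> ct a01; split; last by exists ord0; rewrite set_first0.
by apply: set_first_cube => //; case: a01 => ->; rewrite lexx ler01.
Qed.

Lemma set_first_side t a : cube_boundary t -> 0 <= a <= 1 ->
  t ord0 ord0 != 0 -> t ord0 ord0 != 1 -> cube_boundary (set_first t a).
Proof.
move=> [ct [i ti]] a01 t0 t1; split; first exact: set_first_cube.
exists i; rewrite mxE; case: eqP => // i0; move: ti t0 t1; rewrite i0.
by case=> ->; rewrite eqxx.
Qed.

Lemma loop_comp_within {T : topologicalType} (A : set T) f
    (p : T -> 'rV[R]_n.+1) : continuous p -> (forall y, A y -> cube (p y)) ->
  {within A, continuous (fun y => f (p y))}.
Proof.
move=> cp Ap; apply: (within_comp _ (@cube_loop_continuous _ _ _ _ f) Ap).
exact: continuous_subspaceT.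
Qed.

Definition first_reparam (phi : R -> R) : Prop :=
  [/\ continuous phi, forall a, 0 <= a <= 1 -> 0 <= phi a <= 1,
      phi 0 = 0 \/ phi 0 = 1 & phi 1 = 0 \/ phi 1 = 1].

Lemma first_reparam_boundary phi t : first_reparam phi ->
  cube_boundary t -> cube_boundary (set_first t (phi (t ord0 ord0))).
Proof.
move=> [_ phi01 phi0 phi1] bt; have [ct _] := bt.
have [->|t0] := eqVneq (t ord0 ord0) 0; first exact: set_first_boundary.
have [->|t1] := eqVneq (t ord0 ord0) 1; first exact: set_first_boundary.
by apply: set_first_side => //; exact/phi01/ct.
Qed.

Lemma reparam_homotopic f (p q : 'rV[R]_n.+1 -> X) (phi psi : R -> R) :
  first_reparam phi -> first_reparam psi -> phi 0 = psi 0 -> phi 1 = psi 1 ->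
  (forall t, cube t -> p t = f (set_first t (phi (t ord0 ord0)))) ->
  (forall t, cube t -> q t = f (set_first t (psi (t ord0 ord0)))) ->
  homotopic_rel R cube cube_boundary p q.
Proof.
move=> rphi rpsi e0 e1 pE qE.
pose c u a := (1 - u) * phi a + u * psi a.
have rc u : 0 <= u <= 1 -> first_reparam (c u).
  case: rphi rpsi => [cphi phi01 phi0 phi1] [cpsi psi01 psi0 psi1] u01.
  split; rewrite /c -?e0 -?e1.
  - move=> a; apply: cvgD; apply: cvgM; [exact: cvg_cst|exact: cphi|
      exact: cvg_cst|exact: cpsi].
  - move=> a a01; have := phi01 _ a01; have := psi01 _ a01; nra.
  - by case: phi0 => ->; [left|right]; lra.
  - by case: phi1 => ->; [left|right]; lra.
exists (fun y => f (set_first y.2 (c y.1 (y.2 ord0 ord0)))); split => /=.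
- apply: loop_comp_within.
    apply: set_first_continuous; first by move=> y; exact: cvg_snd.
    case: rphi rpsi => [cphi _ _ _] [cpsi _ _ _].
    apply: continuous_add; apply: continuous_mul.
    + exact/continuous_one_sub/continuous_fst.
    + move=> y; apply: (@continuous_comp _ _ _ _ phi) (cphi _).
      exact: snd_first_continuous.
    + exact: continuous_fst.
    + move=> y; apply: (@continuous_comp _ _ _ _ psi) (cpsi _).
      exact: snd_first_continuous.
  move=> [u t] [/=]; rewrite in_itv /= => u01 ct.
  by apply: set_first_cube => //; case: (rc _ u01) => _ + _ _; apply; exact: ct.
- by move=> t ct; rewrite pE// /c subr0 mul1r mul0r addr0.
- by move=> t ct; rewrite qE// /c subrr mul0r mul1r add0r.
- move=> u t u01 ct bt; rewrite pE// !cube_loop_boundary//.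
    exact: first_reparam_boundary.
  exact/first_reparam_boundary/bt/rc.
Qed.

Definition concat_fun f g t : X :=
  let a := t ord0 ord0 in
  if a <= 2^-1 then f (set_first t (2 * a)) else g (set_first t (2 * a - 1)).

Definition reverse_fun f t : X := f (set_first t (1 - t ord0 ord0)).

Lemma concat_continuous f g : {within cube, continuous (concat_fun f g)}.
Proof.
apply: (@within_if_le _ _ _ _ (fun t => t ord0 ord0) 2^-1
  (fun t => f (set_first t (2 * t ord0 ord0)))
  (fun t => g (set_first t (2 * t ord0 ord0 - 1)))).
- exact: closed_cube.
- exact: first_continuous.
- apply: loop_comp_within.
    apply: set_first_continuous; first by move=> t; exact: cvg_id.
    exact/continuous_scale/first_continuous.
  move=> t [ct /= t2]; apply: set_first_cube => //.
  by have := ct ord0; lra.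
- apply: loop_comp_within.
    apply: set_first_continuous; first by move=> t; exact: cvg_id.
    exact/continuous_affine/first_continuous.
  move=> t [ct /= t2]; apply: set_first_cube => //.
  by have := ct ord0; lra.
- move=> t ct ->; rewrite divff ?pnatr_eq0// subrr.
  by rewrite !cube_loop_boundary//; apply: set_first_boundary => //; [left|right].
Qed.

Lemma concat_boundary f g t : cube_boundary t -> concat_fun f g t = x.
Proof.
move=> bt; have [ct _] := bt; have := ct ord0 => t01; rewrite /concat_fun.
have [t0|t0] := eqVneq (t ord0 ord0) 0.
  rewrite t0 invr_ge0 ler0n cube_loop_boundary//.
  by apply: set_first_boundary => //; left; rewrite mulr0.
have [t1|t1] := eqVneq (t ord0 ord0) 1.
  rewrite t1 ifF; last by apply/negbTE; rewrite -ltNge; lra.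
  rewrite cube_loop_boundary//.
  by apply: set_first_boundary => //; right; lra.
by case: leP => t2; rewrite cube_loop_boundary//; apply: set_first_side => //; lra.
Qed.

Definition concat f g : cube_loop R x n.+1 :=
  CubeLoop (concat_continuous (f:=f) (g:=g)) (@concat_boundary f g).

Lemma reverse_continuous f : {within cube, continuous (reverse_fun f)}.
Proof.
apply: loop_comp_within.
  apply: set_first_continuous; first by move=> t; exact: cvg_id.
  exact/continuous_one_sub/first_continuous.
by move=> t ct; apply: set_first_cube => //; have := ct ord0; lra.
Qed.

Lemma one_sub_reparam : first_reparam (fun a => 1 - a).
Proof.
split; [|by move=> a; lra|by right; lra|by left; lra].
by move=> a; apply: cvgB; [exact: cvg_cst|exact: cvg_id].
Qed.

Lemma reverse_boundary f t : cube_boundary t -> reverse_fun f t = x.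
Proof.
move=> bt; rewrite /reverse_fun cube_loop_boundary//.
exact: (first_reparam_boundary one_sub_reparam).
Qed.

Definition reverse f : cube_loop R x n.+1 :=
  CubeLoop (reverse_continuous (f:=f)) (@reverse_boundary f).

Definition cst_loop : cube_loop R x n.+1 :=
  @CubeLoop R X x n.+1 (fun=> x) (continuous_subspaceT (@cst_continuous _ _ x))
    (fun _ _ => erefl).

Lemma reverse_homotopic f f' : loop_homotopic f f' ->
  loop_homotopic (reverse f) (reverse f').
Proof.
move=> [H [cH H0 H1 Hb]].
have s01 t : cube t -> cube (set_first t (1 - t ord0 ord0)).
  by move=> ct; apply: set_first_cube => //; have := ct ord0; lra.
exists (fun y => H (y.1, set_first y.2 (1 - y.2 ord0 ord0))); split => /=.
- apply: (@within_comp _ _ _ _ _ (fun y : R * 'rV[R]_n.+1 =>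
    (y.1, set_first y.2 (1 - y.2 ord0 ord0))) H _ cH).
    apply: continuous_subspaceT; apply: continuous_pair; first exact: continuous_fst.
    apply: set_first_continuous; first exact: continuous_snd.
    exact/continuous_one_sub/snd_first_continuous.
  by move=> [u t] [/= u01 ct]; split => //=; exact: s01.
- by move=> t ct; rewrite H0//; exact: s01.
- by move=> t ct; rewrite H1//; exact: s01.
- move=> u t u01 ct bt; rewrite Hb//; first exact: s01.
  exact: (first_reparam_boundary one_sub_reparam).
Qed.

Lemma concat_homotopic f f' g g' : loop_homotopic f f' -> loop_homotopic g g' ->
  loop_homotopic (concat f g) (concat f' g').
Proof.
move=> [H [cH H0 H1 Hb]] [K [cK K0 K1 Kb]].
have s1 t : cube t -> t ord0 ord0 <= 2^-1 -> cube (set_first t (2 * t ord0 ord0)).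
  by move=> ct t2; apply: set_first_cube => //; have := ct ord0; lra.
have s2 t : cube t -> 2^-1 <= t ord0 ord0 ->
    cube (set_first t (2 * t ord0 ord0 - 1)).
  by move=> ct t2; apply: set_first_cube => //; have := ct ord0; lra.
have c0 := snd_first_continuous.
exists (fun y : R * 'rV[R]_n.+1 => if y.2 ord0 ord0 <= 2^-1
  then H (y.1, set_first y.2 (2 * y.2 ord0 ord0))
  else K (y.1, set_first y.2 (2 * y.2 ord0 ord0 - 1))); split => /=.
- apply: (@within_if_le _ _ _ _ (fun y : R * 'rV[R]_n.+1 => y.2 ord0 ord0) 2^-1
    (fun y => H (y.1, set_first y.2 (2 * y.2 ord0 ord0)))
    (fun y => K (y.1, set_first y.2 (2 * y.2 ord0 ord0 - 1)))) => //.
  + rewrite (_ : _ `*` _ = (fst @^-1` `[0, 1]) `&` (snd @^-1` cube)) //.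
    apply: closedI; apply: closed_comp => //.
    * by move=> y _; exact: cvg_fst.
    * exact: interval_closed.
    * by move=> y _; exact: cvg_snd.
    * exact: closed_cube.
  + apply: (@within_comp _ _ _ _ _ (fun y : R * 'rV[R]_n.+1 =>
      (y.1, set_first y.2 (2 * y.2 ord0 ord0))) H _ cH).
      apply: continuous_subspaceT; apply: continuous_pair; first exact: continuous_fst.
      apply: set_first_continuous; first exact: continuous_snd.
      exact/continuous_scale/c0.
    by move=> [u t] [[/= u01 ct] t2]; split => //=; exact: s1.
  + apply: (@within_comp _ _ _ _ _ (fun y : R * 'rV[R]_n.+1 =>
      (y.1, set_first y.2 (2 * y.2 ord0 ord0 - 1))) K _ cK).
      apply: continuous_subspaceT; apply: continuous_pair; first exact: continuous_fst.
      apply: set_first_continuous; first exact: continuous_snd.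
      exact/continuous_affine/c0.
    by move=> [u t] [[/= u01 ct] t2]; split => //=; exact: s2.
  + move=> [u t] [/= + ct] t2; rewrite in_itv /= => u01.
    have b0 : cube_boundary (set_first t (2 * t ord0 ord0)).
      by apply: set_first_boundary => //; right; lra.
    have b1 : cube_boundary (set_first t (2 * t ord0 ord0 - 1)).
      by apply: set_first_boundary => //; left; lra.
    by rewrite Hb ?Kb ?cube_loop_boundary//; exact: cube_boundary_cube.
- move=> t ct; rewrite /concat_fun; case: leP => t2.
    by rewrite H0//; exact: s1.
  by rewrite K0//; exact/s2/ltW.
- move=> t ct; rewrite /concat_fun; case: leP => t2.
    by rewrite H1//; exact: s1.
  by rewrite K1//; exact/s2/ltW.
- move=> u t u01 ct bt; rewrite (concat_boundary f g bt); have := ct ord0 => t01.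
  have b1 a : 0 <= a <= 1 -> (t ord0 ord0 = 0 -> a = 0 \/ a = 1) ->
      (t ord0 ord0 = 1 -> a = 0 \/ a = 1) -> cube_boundary (set_first t a).
    move=> a01 a0 a1.
    have [/a0|?] := eqVneq (t ord0 ord0) 0; first exact: set_first_boundary.
    have [/a1|?] := eqVneq (t ord0 ord0) 1; first exact: set_first_boundary.
    exact: set_first_side.
  case: leP => t2.
    have b : cube_boundary (set_first t (2 * t ord0 ord0)).
      by apply: b1 => [|->|t1]; [lra|left; lra|exfalso; lra].
    by rewrite Hb ?cube_loop_boundary//; exact: cube_boundary_cube.
  have b : cube_boundary (set_first t (2 * t ord0 ord0 - 1)).
    by apply: b1 => [|t0|->]; [lra|exfalso; lra|right; lra].
  by rewrite Kb ?cube_loop_boundary//; exact: cube_boundary_cube.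
Qed.

Lemma min_reparam (phi psi : R -> R) : continuous phi -> continuous psi ->
  continuous (fun a => Num.min (phi a) (psi a)).
Proof. by move=> cphi cpsi a; apply: continuous_min; [exact: cphi|exact: cpsi]. Qed.

Lemma max_reparam (phi psi : R -> R) : continuous phi -> continuous psi ->
  continuous (fun a => Num.max (phi a) (psi a)).
Proof. by move=> cphi cpsi a; apply: continuous_max; [exact: cphi|exact: cpsi]. Qed.

Lemma affine_continuous (k b : R) : continuous (fun a : R => k * a + b).
Proof. by apply: continuous_affine => a; exact: cvg_id. Qed.

Lemma id_reparam : first_reparam id.
Proof. by split; [move=> a; exact: cvg_id| |left|right]. Qed.

Lemma cst_reparam (b : R) : b = 0 \/ b = 1 -> first_reparam (fun=> b).
Proof.
move=> b01; split=> //; first exact: cst_continuous.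
by move=> a _; case: b01 => ->; rewrite lexx ler01.
Qed.

Local Ltac minmax :=
  repeat match goal with
  | |- context [Order.max ?a ?b] => case: (leP a b) => ?
  | |- context [Order.min ?a ?b] =>
      lazymatch b with
      | context [Order.min _ _] => fail
      | _ => case: (leP a b) => ?
      end
  end; lra.

Lemma concat_cst_l f : loop_homotopic (concat cst_loop f) f.
Proof.
apply: (@reparam_homotopic f _ _ (fun a => Num.max (2 * a + - 1) 0) id) => //=.
- split; first by apply: max_reparam; [exact: affine_continuous|exact: cst_continuous].
  + by move=> a a01; minmax.
  + by left; minmax.
  + by right; minmax.
- exact: id_reparam.
- by minmax.
- by minmax.
- move=> t ct; rewrite /concat_fun /= maxEle; case: leP => t2; case: leP => t1 //; (try by exfalso; lra).
  by rewrite cube_loop_boundary//; apply: set_first_boundary => //; left.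
- by move=> t ct; rewrite set_first_id.
Qed.

Lemma concat_cst_r f : loop_homotopic (concat f cst_loop) f.
Proof.
apply: (@reparam_homotopic f _ _ (fun a => Num.min (2 * a + 0) 1) id) => //=.
- split; first by apply: min_reparam; [exact: affine_continuous|exact: cst_continuous].
  + by move=> a a01; minmax.
  + by left; minmax.
  + by right; minmax.
- exact: id_reparam.
- by minmax.
- by minmax.
- move=> t ct; rewrite /concat_fun /= addr0 minEle; case: leP => t2; case: leP => t1 //; (try by exfalso; lra).
  by rewrite cube_loop_boundary//; apply: set_first_boundary => //; right.
- by move=> t ct; rewrite set_first_id.
Qed.

Lemma concat_assoc f g h :
  loop_homotopic (concat f (concat g h)) (concat (concat f g) h).
Proof.
pose psi (a : R) :=
  Num.min (2 * a + 0) (Num.min (1 * a + 4^-1) (2^-1 * a + 2^-1)).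
apply: (@reparam_homotopic (concat f (concat g h)) _ _ id psi) => //.
- exact: id_reparam.
- split; rewrite /psi.
  + apply: min_reparam; first exact: affine_continuous.
    by apply: min_reparam; exact: affine_continuous.
  + by move=> a a01; minmax.
  + by left; minmax.
  + by right; minmax.
- by rewrite /psi; minmax.
- by rewrite /psi; minmax.
- by move=> t _; rewrite set_first_id.
- move=> t /(_ ord0); rewrite /= /concat_fun /= /concat_fun !set_first_set !set_first0.
  set a := t ord0 ord0 => a01.
  case: (leP a 2^-1) => a2; last first.
    have -> : psi a = 2^-1 * a + 2^-1 by rewrite /psi; minmax.
    rewrite ifF; last by apply/negbTE; rewrite -ltNge; lra.
    rewrite ifF; last by apply/negbTE; rewrite -ltNge; lra.
    by congr (h (set_first t _)); lra.
  case: (leP (2 * a) 2^-1) => a4.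
    have -> : psi a = 2 * a by rewrite /psi; minmax.
    by rewrite ifT; last lra.
  have -> : psi a = a + 4^-1 by rewrite /psi; minmax.
  rewrite ifF; last by apply/negbTE; rewrite -ltNge; lra.
  rewrite ifT; last by lra.
  by congr (g (set_first t _)); lra.
Qed.

Lemma concat_reverse_r f : loop_homotopic (concat f (reverse f)) cst_loop.
Proof.
apply: (@reparam_homotopic f _ _
  (fun a => Num.min (2 * a + 0) (- 2 * a + 2)) (fun=> 0)) => //=.
- split; first by apply: min_reparam; exact: affine_continuous.
  + by move=> a a01; minmax.
  + by left; minmax.
  + by left; minmax.
- by apply: cst_reparam; left.
- by minmax.
- by minmax.
- move=> t ct; rewrite /concat_fun /= /reverse_fun set_first0 set_first_set.
  case: leP => t2; congr (f (set_first t _)); minmax.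
- move=> t ct; rewrite cube_loop_boundary//.
  by apply: set_first_boundary => //; left.
Qed.

Lemma concat_reverse_l f : loop_homotopic (concat (reverse f) f) cst_loop.
Proof.
apply: (@reparam_homotopic f _ _
  (fun a => Num.max (- 2 * a + 1) (2 * a + - 1)) (fun=> 1)) => //=.
- split; first by apply: max_reparam; exact: affine_continuous.
  + by move=> a a01; minmax.
  + by right; minmax.
  + by right; minmax.
- by apply: cst_reparam; right.
- by minmax.
- by minmax.
- move=> t ct; rewrite /concat_fun /= /reverse_fun set_first0 set_first_set.
  case: leP => t2; congr (f (set_first t _)); minmax.
- move=> t ct; rewrite cube_loop_boundary//.
  by apply: set_first_boundary => //; right.
Qed.

Let G := homotopy_group R x n.+1.

Definition homotopy_one : G := homotopy_class cst_loop.

Definition homotopy_mul (a b : G) : G :=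
  homotopy_class (concat (class_repr a) (class_repr b)).

Definition homotopy_inv (a : G) : G := homotopy_class (reverse (class_repr a)).

Lemma homotopy_mulE f g : homotopy_mul (homotopy_class f) (homotopy_class g) =
  homotopy_class (concat f g).
Proof. by apply/homotopy_classP/concat_homotopic; exact: class_repr_homotopic. Qed.

Lemma homotopy_invE f :
  homotopy_inv (homotopy_class f) = homotopy_class (reverse f).
Proof. by apply/homotopy_classP/reverse_homotopic; exact: class_repr_homotopic. Qed.

Let mulA : associative homotopy_mul.
Proof.
move=> a b c; rewrite -(class_reprK a) -(class_reprK b) -(class_reprK c).
by rewrite !homotopy_mulE; apply/homotopy_classP/concat_assoc.
Qed.

Let mul1 : left_id homotopy_one homotopy_mul.
Proof.
move=> a; rewrite -(class_reprK a) homotopy_mulE.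
exact/homotopy_classP/concat_cst_l.
Qed.

Let mulr1 : right_id homotopy_one homotopy_mul.
Proof.
move=> a; rewrite -(class_reprK a) homotopy_mulE.
exact/homotopy_classP/concat_cst_r.
Qed.

Let mulV : left_inverse homotopy_one homotopy_inv homotopy_mul.
Proof.
move=> a; rewrite -(class_reprK a) homotopy_invE homotopy_mulE.
exact/homotopy_classP/concat_reverse_l.
Qed.

Let mulrV : right_inverse homotopy_one homotopy_inv homotopy_mul.
Proof.
move=> a; rewrite -(class_reprK a) homotopy_invE homotopy_mulE.
exact/homotopy_classP/concat_reverse_r.
Qed.

HB.instance Definition _ := isGroup.Build (homotopy_group R x n.+1)
  mulA mul1 mulr1 mulV mulrV.

End group_structure.

Definition group_isomorphic (G H : groupType) : Prop :=
  exists phi : {multiplicative G -> H}, bijective phi.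

Definition complex_numbers (R : realType) : numFieldType := complex R.

Section charts.
Context {R : realType}.
Local Notation C := (complex_numbers R).

(* chart_map and chart_inv are only meaningful on chart_dom and on its image. *)
Record chart (T : Type) (n : nat) := Chart {
  chart_dom : set T;
  chart_map :> T -> 'rV[C]_n;
  chart_inv : 'rV[C]_n -> T
}.

Definition chart_image T n (c : chart T n) : set 'rV[C]_n := c @` chart_dom c.

Definition is_chart (T : topologicalType) n (c : chart T n) : Prop :=
  [/\ open (chart_dom c), open (chart_image c),
      forall x, chart_dom c x -> chart_inv c (c x) = x,
      {within chart_dom c, continuous c} &
      {within chart_image c, continuous (chart_inv c)}].

(* Every set on which complex differentiability is required below is open, so
   this is holomorphy. *)
Definition holomorphic_compatible T n (c d : chart T n) : Prop :=
  forall x, chart_dom c x -> chart_dom d x ->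
    differentiable (d \o chart_inv c) (c x).

Definition is_atlas (T : topologicalType) n (A : set (chart T n)) : Prop :=
  [/\ forall c, A c -> is_chart c,
      forall x, exists2 c, A c & chart_dom c x &
      forall c d, A c -> A d -> holomorphic_compatible c d].

Definition holomorphic_on (T S : topologicalType) n m
    (A : set (chart T n)) (B : set (chart S m)) (W : set T) (f : T -> S) : Prop :=
  {within W, continuous f} /\
  forall c d x, A c -> B d -> W x -> chart_dom c x -> chart_dom d (f x) ->
    differentiable (d \o f \o chart_inv c) (c x).

Definition submersion_at (T S : Type) n m
    (A : set (chart T n)) (B : set (chart S m)) (f : T -> S) (x : T) : Prop :=
  forall c d, A c -> B d -> chart_dom c x -> chart_dom d (f x) ->
    let F := d \o f \o chart_inv c in
    differentiable F (c x) /\ forall w, exists v, 'd F (c x) v = w.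

Definition id_atlas (n : nat) : set (chart 'rV[C]_n n) := [set Chart setT id id].

Definition prod_chart T S n m (c : chart T n) (d : chart S m) :
    chart (T * S) (n + m) :=
  Chart (chart_dom c `*` chart_dom d)
    (fun p => row_mx (c p.1) (d p.2))
    (fun z => (chart_inv c (lsubmx z), chart_inv d (rsubmx z))).

Definition prod_atlas T S n m (A : set (chart T n)) (B : set (chart S m)) :
    set (chart (T * S) (n + m)) :=
  [set prod_chart c d | c in A & d in B].

(* The canonical holomorphic structure of a vector space of dimension n. *)
Definition linear_atlas (V : lmodType C) n : set (chart V n) :=
  [set c | [/\ chart_dom c = setT, linear c, cancel c (chart_inv c) &
               cancel (chart_inv c) c]].

Record complex_manifold (n : nat) := ComplexManifold {
  manifold_space :> topologicalType;
  atlas : set (chart manifold_space n);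
  manifold_hausdorff : hausdorff_space manifold_space;
  manifold_second_countable : @second_countable manifold_space;
  manifold_atlas : is_atlas atlas
}.

Arguments atlas {n} M : rename.

(* (p, Phi) is a biholomorphism p^-1(U) -> U x C^r, linear on the fibres. *)
Definition local_trivialization m r (M : complex_manifold m)
    (E : complex_manifold (m + r)) (p : E -> M) (fiber : M -> lmodType C)
    (incl : forall x, fiber x -> E) (U : set M) (Phi : E -> 'rV[C]_r) : Prop :=
  let prod := prod_atlas (atlas M) (@id_atlas r) in
  [/\ open U,
      forall x, U x -> linear (Phi \o incl x),
      holomorphic_on (atlas E) prod (p @^-1` U) (fun e => (p e, Phi e)) &
      exists Psi : M * 'rV[C]_r -> E,
        [/\ holomorphic_on prod (atlas E) (U `*` setT) Psi,
            forall e, U (p e) -> Psi (p e, Phi e) = e &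
            forall x v, U x -> p (Psi (x, v)) = x /\ Phi (Psi (x, v)) = v]].

(* The fibre over x is a vector space fiber x identified with the preimage of
   x under the projection by the injection fiber_incl x. *)
Record holomorphic_bundle m (M : complex_manifold m) (r : nat) :=
    HolomorphicBundle {
  total_space :> complex_manifold (m + r);
  bundle_proj : total_space -> M;
  bundle_proj_holomorphic :
    holomorphic_on (atlas total_space) (atlas M) setT bundle_proj;
  fiber : M -> lmodType C;
  fiber_incl : forall x, fiber x -> total_space;
  fiber_incl_inj : forall x, injective (@fiber_incl x);
  fiber_incl_range : forall x,
    range (@fiber_incl x) = [set e | bundle_proj e = x];
  bundle_locally_trivial : forall x : M, exists U Phi,
    U x /\ local_trivialization bundle_proj fiber_incl U Phi
}.

Arguments fiber {m M r} E x : rename.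
Arguments fiber_incl {m M r} E {x} v : rename.

Definition dominating_spray m (M : complex_manifold m) r
    (E : holomorphic_bundle M r) (s : E -> M) : Prop :=
  holomorphic_on (atlas E) (atlas M) setT s /\
  forall x : M, s (fiber_incl E (0 : fiber E x)) = x /\
    submersion_at (@linear_atlas (fiber E x) r) (atlas M)
      (s \o @fiber_incl _ _ _ E x) 0.

Definition elliptic m (M : complex_manifold m) : Prop :=
  exists r (E : holomorphic_bundle M r) (s : E -> M), dominating_spray s.

End charts.

Arguments complex_manifold : clear implicits.

(* Main.v *)
From HB Require Import structures.
Require Import Defs.
From mathcomp Require Import all_boot all_order all_algebra complex ring lra.
From mathcomp Require Import generic_quotient.
From mathcomp Require Import boolp classical_sets functions cardinality.
From mathcomp Require Import interval_inference reals topology normedtype derive.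
From mathcomp Require Import landau sequences exp trigo.

(** Let $S$ be a set of natural numbers, $p_i$ the $i$-th prime, $q_k$ the product of
    the $p_i$ with $i \leq k$ and $i \in S$, and $N_n = \prod_{k < n} q_k$ ([level]).
    The group $\Gamma_S = \bigcup_n \frac{1}{N_n} \mathbb{Z}$ ([level_group]) is
    $p_i$-divisible if and only if $i \in S$ ([level_group_divisible]), so different
    sets $S$ give non-isomorphic groups. It is therefore enough to let $\Gamma_S$ act
    on $V = \mathbb{C}^6$ as the group of deck transformations of a covering
    $V \to M_S$ with an elliptic quotient $M_S$.

    The action is by shears $a \cdot x = x + a e_0 + f_a(x_0) e_1$ ([shear]), with the
    cocycle $f_a(z) = \sum_{j < n} A_j (\zeta_j(z + a) - \zeta_j(z))$, where
    $\zeta_j(z) = e^{2 \pi i N_j z}$ and $n$ is any index with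
    $a \in \frac{1}{N_n} \mathbb{Z}$; the terms with $j \geq n$ vanish. Translations
    alone would not do, since $\Gamma_S$ is not discrete. But if $a$ lies in
    $\frac{1}{N_{n+1}} \mathbb{Z}$ and not in $\frac{1}{N_n} \mathbb{Z}$, then
    $\zeta_n(a)$ is a root of unity of order dividing $q_n$ and different from $1$,
    so for $A_n$ large $f_a$ is large on the ball of radius $n$, and $a$ moves that
    ball off itself ([step_separating]). Hence the action is free and properly
    discontinuous if $A_n$ grows fast enough ([shear_action]).

    As $V$ is contractible, covering theory gives $\pi_1(M_S) = \Gamma_S$
    ([winding_class_bij]) and the vanishing of the higher homotopy groups
    ([higher_homotopy_trivial]). Divisibility by $p$ is carried over by isomorphisms
    of fundamental groups ([isomorphic_divisible]) and directly by homotopy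
    equivalences, without a comparison of base points
    ([homotopy_equivalent_divisible]).

    For ellipticity take the trivial bundle $M_S \times V$. A map
    $s(x, v) = x + v + (k(x, v) - k(x, 0)) e_1$ on $V \times V$ descends to a spray on
    it as soon as $k(a \cdot x, v) = k(x, v) + f_a(x_0 + v_0)$
    ([orbit_manifold_elliptic]), and it is dominating if $k(x, v)$ depends on $x$ and
    $v_0$ only. For the subgroup $\frac{1}{N_n} \mathbb{Z}$ such a function is
    $\sum_{j < n} A_j \zeta_j(x_0) \zeta_j(v_0)$, but these sums do not converge. They
    may be corrected by any function of $v_0$ and of the invariants $\zeta_n(x_0)$ and
    $W_n(x) = x_1 - \sum_{j < n} A_j \zeta_j(x_0)$ of that subgroup ([potential]).
    The correction has to make the step from $n$ to $n + 1$ small, and for that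
    $\zeta_n$ must be approximated by a function of $\zeta_n^{q_n}$ and
    $W_{n+1} = W_n - A_n \zeta_n$. Now $- W_{n+1} / A_n$ differs from $\zeta_n$ by
    $O(1 / A_n)$, and one step of Newton's method for $x^{-q_n} = \zeta_n^{-q_n}$
    improves this to $O(1 / A_n^2)$ ([newtonE]). So the step from $n$ to $n + 1$ is
    $O(1 / A_n)$ on the ball of radius $n$ ([step_small]); for $A_n$ growing fast
    enough the corrected functions converge to a holomorphic $k$ ([jet_limit]).

    Holomorphy of limits is obtained without integral formulas: a [jet] bound controls
    a function together with the remainder of its first-order expansion, and such
    bounds pass to pointwise limits. *)

Set Implicit Arguments.
Unset Strict Implicit.
Unset Printing Implicit Defensive.

Import Order.TTheory GRing.Theory Num.Theory numFieldNormedType.Exports.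

Local Open Scope classical_set_scope.
Local Open Scope ring_scope.
Local Open Scope quotient_scope.

(** * Orbit spaces *)

Lemma within_continuousP {T U : topologicalType} (A : set T) (f : T -> U) :
  {within A, continuous f} <->
  forall x, A x -> forall P, nbhs (f x) P -> nbhs x [set y | A y -> P (f y)].
Proof. by rewrite subspace_continuousP; split=> cf x Ax P fP; exact: (cf x Ax P fP). Qed.

(** A free and properly discontinuous action: the wandering neighbourhoods make the
    projection to the orbit space a covering, and the last field makes that space
    Hausdorff. The group is abelian, so that the element relating the two ends of the
    lift of a loop does not depend on the lift. *)
Record deck_action (G : zmodType) (V : topologicalType) := DeckAction {
  deck :> G -> V -> V;
  deck0 : forall x, deck 0 x = x;
  deckD : forall a b x, deck (a + b) x = deck a (deck b x);
  deck_continuous : forall a, continuous (deck a);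
  deck_wandering : forall x, exists U : set V,
    [/\ open U, U x & forall a y, U y -> U (deck a y) -> a = 0];
  deck_separated : forall x y, (forall a, deck a x <> y) ->
    exists U W : set V, [/\ open U, U x, open W, W y &
      forall a z, U z -> ~ W (deck a z)]
}.

Section orbit_space.
Context {G : zmodType} {V : topologicalType} (act : deck_action G V).

Lemma deckNK a : cancel (act a) (act (- a)).
Proof. by move=> x; rewrite -deckD addNr deck0. Qed.

Lemma deckKN a : cancel (act (- a)) (act a).
Proof. by move=> x; rewrite -deckD addrN deck0. Qed.

Lemma deckC a b x : act a (act b x) = act b (act a x).
Proof. by rewrite -!deckD addrC. Qed.

Lemma deck_free a b x : act a x = act b x -> a = b.
Proof.
move=> ab; have [U [_ Ux wU]] := deck_wandering act x.
apply/eqP; rewrite -subr_eq0; apply/eqP; apply: (wU _ x) => //.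
by rewrite addrC deckD ab deckNK.
Qed.

Let orbit_rel (x y : V) := `[< exists a, act a x = y >].

Let orbit_refl : reflexive orbit_rel.
Proof. by move=> x; apply/asboolP; exists 0; rewrite deck0. Qed.

Let orbit_sym : symmetric orbit_rel.
Proof.
move=> x y; apply/asbool_equiv_eq; split=> -[a <-]; exists (- a); exact: deckNK.
Qed.

Let orbit_trans : transitive orbit_rel.
Proof.
move=> y x z /asboolP[a <-] /asboolP[b <-]; apply/asboolP.
by exists (b + a); rewrite deckD.
Qed.

Definition orbit_equiv : equiv_rel V :=
  EquivRel orbit_rel orbit_refl orbit_sym orbit_trans.

Definition orbit_space : topologicalType :=
  quotient_topology {eq_quot orbit_equiv}.

Definition orbit_proj (x : V) : orbit_space := \pi_{eq_quot orbit_equiv} x.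

Definition orbit_repr (m : orbit_space) : V :=
  repr (m : {eq_quot orbit_equiv}).

Lemma orbit_reprK m : orbit_proj (orbit_repr m) = m.
Proof. exact: reprK. Qed.

Lemma orbit_projP x y : orbit_proj x = orbit_proj y <-> exists a, act a x = y.
Proof. by split=> [/eqmodP/asboolP//|xy]; apply/eqmodP/asboolP. Qed.

Lemma orbit_proj_deck a x : orbit_proj (act a x) = orbit_proj x.
Proof. by apply/esym/orbit_projP; exists a. Qed.

Lemma orbit_proj_continuous : continuous orbit_proj.
Proof. exact: (@pi_continuous V {eq_quot orbit_equiv}). Qed.

Lemma open_deck_image a (U : set V) : open U -> open (act a @` U).
Proof.
move=> oU; rewrite (_ : _ @` _ = act (- a) @^-1` U).
  by apply: open_comp => // x _; exact: deck_continuous.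
apply/seteqP; split=> x /=; first by move=> [y Uy <-]; rewrite deckNK.
by move=> Ux; exists (act (- a) x) => //; rewrite deckKN.
Qed.

Lemma orbit_proj_open (U : set V) : open U -> open (orbit_proj @` U).
Proof.
move=> oU; rewrite /open /= /quotient_open.
rewrite (_ : _ @^-1` _ = \bigcup_a (act a @` U)).
  by apply: bigcup_open => a _; exact: open_deck_image.
apply/seteqP; split=> [x /= [y Uy /orbit_projP[a <-]]|x [a _ [y Uy <-]]].
  by exists a => //; exists y.
by exists y => //; apply/orbit_projP; exists a.
Qed.

Lemma orbit_space_hausdorff : hausdorff_space orbit_space.
Proof.
rewrite open_hausdorff => m n mn.
have [a|U [W [oU Ux oW Wy UW]]] :=
    @deck_separated _ _ act (orbit_repr m) (orbit_repr n).
  move=> mna; move/eqP: mn; apply; rewrite -(orbit_reprK m) -(orbit_reprK n).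
  by apply/orbit_projP; exists a.
exists (orbit_proj @` U, orbit_proj @` W); split => /=.
- by rewrite inE; exists (orbit_repr m) => //; exact: orbit_reprK.
- by rewrite inE; exists (orbit_repr n) => //; exact: orbit_reprK.
- exact: orbit_proj_open.
- exact: orbit_proj_open.
- apply/eqP/seteqP; split=> // p [[x Ux' <-] [y Wy' /esym/orbit_projP[a ax]]].
  by apply: (UW a x) => //; rewrite ax.
Qed.

Lemma orbit_space_second_countable :
  @second_countable V -> @second_countable orbit_space.
Proof.
move=> [B cB [oB bB]]; exists [set orbit_proj @` U | U in B].
  exact: sub_countable (card_image_le _ _) cB.
split=> [_ [U BU <-]|m O mO]; first exact/orbit_proj_open/oB.
have : nbhs (orbit_proj (orbit_repr m)) O by rewrite orbit_reprK.
move=> /orbit_proj_continuous/bB[U [BU Ux] UO].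
exists (orbit_proj @` U).
  by split; [exists U|exists (orbit_repr m) => //; exact: orbit_reprK].
by move=> _ [x Ux' <-]; exact: UO.
Qed.

(** Over the image of a sheet the covering is trivial; the sections over these images
    are the charts of the orbit space. *)
Definition sheet (U : set V) := open U /\ forall a y, U y -> U (act a y) -> a = 0.

Lemma sheet_inj U x y : sheet U -> U x -> U y -> orbit_proj x = orbit_proj y -> x = y.
Proof.
by move=> [_ wU] Ux Uy /orbit_projP[a xy]; rewrite -xy (wU a x) ?deck0// xy.
Qed.

Lemma sheet_ex x : exists2 U, sheet U & U x.
Proof. by have [U [oU Ux wU]] := deck_wandering act x; exists U. Qed.

Definition sheet_section (U : set V) (m : orbit_space) : V :=
  xget (orbit_repr m) [set x | U x /\ orbit_proj x = m].

Lemma sheet_sectionP U m : (orbit_proj @` U) m ->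
  U (sheet_section U m) /\ orbit_proj (sheet_section U m) = m.
Proof.
move=> [x Ux xm].
have := @xgetPex V (orbit_repr m) [set x | U x /\ orbit_proj x = m].
by apply; exists x.
Qed.

Lemma sheet_sectionK U x : sheet U -> U x -> sheet_section U (orbit_proj x) = x.
Proof.
move=> sU Ux; have [|Uy] := @sheet_sectionP U (orbit_proj x); first by exists x.
exact: (sheet_inj sU Uy Ux).
Qed.

Lemma sheet_section_continuous U : sheet U ->
  {within orbit_proj @` U, continuous (sheet_section U)}.
Proof.
move=> sU; apply/within_continuousP => _ [x Ux <-] W.
rewrite sheet_sectionK // nbhsE => -[P [oP Px] PW].
rewrite nbhsE; exists (orbit_proj @` (P `&` U)).
  split; last by exists x.
  by apply: orbit_proj_open; apply: openI => //; case: sU.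
by move=> _ [y [Py Uy] <-] _ /=; apply: PW; rewrite sheet_sectionK.
Qed.

Lemma orbit_space_connected : connected [set: V] -> connected [set: orbit_space].
Proof.
move=> cV; rewrite (_ : setT = orbit_proj @` setT).
  apply: connected_continuous_connected => //.
  exact/continuous_subspaceT/orbit_proj_continuous.
by apply/seteqP; split=> // m _; exists (orbit_repr m) => //; exact: orbit_reprK.
Qed.

End orbit_space.

(** * Lifting maps defined on cubes *)

Lemma continuous_mx {T U : topologicalType} m n (f : T -> 'M[U]_(m, n)) :
  (forall i j, continuous (fun t => f t i j)) -> continuous f.
Proof.
move=> cf t A [P ftP PA]; apply: (filterS (P := [set s | forall i j, P i j (f s i j)])).
  by move=> s Ps; exact: PA.
apply: filter_forall => i; apply: filter_forall => j.
exact: (cf i j t _ (ftP i j)).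
Qed.

Lemma connected_locally_constant {T : topologicalType} {Y : Type} (A : set T) (g : T -> Y) :
  connected A -> (forall t, A t -> nbhs t [set s | A s -> g s = g t]) ->
  forall s t, A s -> A t -> g s = g t.
Proof.
move=> cA lg s t As At; pose B := [set r | A r /\ g r = g t].
suff AB : B = A by have [] : B s by rewrite AB.
apply: cA; first by exists t.
- exists ([set r | A r -> g r = g t]°); first exact: open_interior.
  apply/seteqP; split=> [r [Ar rt]|r [Ar /interior_subset/= rt]]; split=> //.
    by rewrite /interior /= -rt; exact: lg.
  exact: rt.
- exists (closure B); first exact: closed_closure.
  apply/seteqP; split=> [r Br|r [Ar clBr]]; first by split; [case: Br|exact: subset_closure].
  split=> //; have [q [[Aq qt] /(_ Aq) qr]] := clBr _ (lg _ Ar).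
  by rewrite -qr.
Qed.

Lemma path_connected {R : realType} {T : topologicalType} (A : set T) :
  (forall x y, A x -> A y -> exists p : R -> T,
    [/\ continuous p, p 0 = x, p 1 = y & forall u, 0 <= u <= 1 -> A (p u)]) ->
  connected A.
Proof.
move=> pA; have [[x Ax]|A0] := pselect (A !=set0); last first.
  have -> : A = set0 by apply/seteqP; split=> // y Ay; case: A0; exists y.
  exact: connected0.
rewrite (_ : A = \bigcup_(C in [set C | [/\ C x, C `<=` A & connected C]]) C).
  by apply: bigcup_connected => [|C []//]; exists x => C [].
apply/seteqP; split=> [y Ay|y [C [_ CA _] /CA//]].
have [p [cp p0 p1 pp]] := pA _ _ Ax Ay.
exists (p @` `[0, 1]); last first.
  by exists 1; rewrite //= in_itv /= lexx ler01.
split.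
- by exists 0; rewrite //= in_itv /= lexx ler01.
- by move=> _ [u /= + <-]; rewrite in_itv /=; exact: pp.
- apply: connected_continuous_connected; first exact: segment_connected.
  exact: continuous_subspaceT.
Qed.

Definition convex_region {R : realType} m (A : set 'rV[R]_m) :=
  forall x y u, A x -> A y -> 0 <= u <= 1 -> A (x + u *: (y - x)).

Lemma convex_connected {R : realType} m (A : set 'rV[R]_m) :
  convex_region A -> connected A.
Proof.
move=> cA; apply: (@path_connected R) => x y Ax Ay.
exists (fun u => x + u *: (y - x)); split.
- move=> u; apply: cvgD; first exact: cvg_cst.
  by apply: cvgZr_tmp; exact: cvg_id.
- by rewrite scale0r addr0.
- by rewrite scale1r addrC subrK.
- by move=> u u01; exact: cA.
Qed.

Section lifting.
Context {G : zmodType} {V : topologicalType} (act : deck_action G V).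
Local Notation M := (orbit_space act).
Local Notation proj := (@orbit_proj G V act).

(** The element relating the two lifts at a point is locally constant, because only the
    neutral element returns a wandering neighbourhood to itself. *)
Lemma lift_unique {T : topologicalType} (A : set T) (F F' : T -> V) :
  connected A -> {within A, continuous F} -> {within A, continuous F'} ->
  (forall t, A t -> proj (F t) = proj (F' t)) ->
  exists a, forall t, A t -> F' t = act a (F t).
Proof.
move=> cA /within_continuousP cF /within_continuousP cF' FF'.
have [[t0 At0]|A0] := pselect (A !=set0); last first.
  by exists 0 => t At; case: A0; exists t.
have /choice[g gP] : forall t, exists a, A t -> act a (F t) = F' t.
  move=> t; have [At|nAt] := pselect (A t); last by exists 0.
  by have /orbit_projP[a] := FF' t At; exists a.
exists (g t0) => t At; rewrite -(gP _ At); congr (act _ _).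
apply: (connected_locally_constant cA) => // {t At} t At.
have [U [oU Ut wU]] := deck_wandering act (F' t).
have nU : nbhs (F' t) U by exact: open_nbhs_nbhs.
have {}nU' : nbhs (F t) (act (g t) @^-1` U).
  by apply: deck_continuous; rewrite gP.
apply: filterS2 (cF _ At _ nU') (cF' _ At _ nU) => s /= FU F'U As.
apply/eqP; rewrite -subr_eq0; apply/eqP; apply: (wU _ (act (g t) (F s))).
  exact: FU.
by rewrite -deckD subrK gP//; exact: F'U.
Qed.

Definition is_lift {T : topologicalType} (A : set T) (f : T -> M) (F : T -> V) :=
  {within A, continuous F} /\ forall t, A t -> proj (F t) = f t.

Definition liftable {T : topologicalType} (A : set T) (f : T -> M) :=
  exists F, is_lift A f F.

Lemma sub_liftable {T : topologicalType} (A B : set T) (f : T -> M) :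
  A `<=` B -> liftable B f -> liftable A f.
Proof.
move=> AB [F [cF Ff]]; exists F; split; first exact: continuous_subspaceW cF.
by move=> t /AB; exact: Ff.
Qed.

Lemma liftable_near {T : topologicalType} (A : set T) (f : T -> M) t : A t ->
  {within A, continuous f} -> exists2 N, nbhs t N & liftable (A `&` N) f.
Proof.
move=> At cf; have [U sU Ut] := sheet_ex act (orbit_repr (f t)).
have oU : open (proj @` U) by apply: orbit_proj_open; case: sU.
exists [set s | A s -> (proj @` U) (f s)].
  move/within_continuousP : cf; apply=> //; apply: open_nbhs_nbhs; split=> //.
  by exists (orbit_repr (f t)) => //; exact: orbit_reprK.
exists (sheet_section U \o f); split.
  apply: (within_comp _ (sheet_section_continuous sU)).
    by apply: continuous_subspaceW cf => s [].
  by move=> s [As /(_ As)].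
by move=> s [As /(_ As)/sheet_sectionP[]].
Qed.

(** The two lifts differ by one element on the connected slice where they meet, and
    after moving one of them by this element they agree there. *)
Lemma liftable_glue {R : realType} {T : topologicalType} (A : set T)
    (f : T -> M) (h : T -> R) (c : R) : closed A -> continuous h ->
  connected (A `&` [set t | h t = c]) ->
  liftable (A `&` [set t | h t <= c]) f -> liftable (A `&` [set t | c <= h t]) f ->
  liftable A f.
Proof.
move=> clA ch cA [F [cF Ff]] [F' [cF' F'f]].
have [|||a aF] := @lift_unique _ _ F' F cA.
- by apply: continuous_subspaceW cF' => t [At /= ->]; split => //=.
- by apply: continuous_subspaceW cF => t [At /= ->]; split => //=.
- by move=> t [At /= tc]; rewrite Ff ?F'f//; split=> //=; rewrite tc.
exists (fun t => if h t <= c then F t else act a (F' t)); split.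
  apply: within_if_le => //; last by move=> t At tc; exact: aF.
  apply: (@within_comp _ _ _ _ setT) cF' _ _ => //.
  exact/continuous_subspaceT/deck_continuous.
move=> t At; case: ifPn => tc; first by rewrite Ff.
by rewrite orbit_proj_deck F'f//; split=> //=; apply/ltW; rewrite ltNge.
Qed.

Section cube_lifting.
Context {R : realType} {m : nat}.
Implicit Types a b t : 'rV[R]_m.

Definition box a b : set 'rV[R]_m :=
  [set t | forall i, a ord0 i <= t ord0 i <= b ord0 i].

Lemma box_convex a b : convex_region (box a b).
Proof. by move=> x y u xab yab u01 i; rewrite !mxE; have := xab i; have := yab i; nra. Qed.

Lemma cube_convex : convex_region (@cube R m).
Proof. by move=> x y u xab yab u01 i; rewrite !mxE; have := xab i; have := yab i; nra. Qed.

Lemma slice_convex (i : 'I_m) (c : R) : convex_region [set t | t ord0 i = c].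
Proof. by move=> x y u /= xc yc _; rewrite !mxE xc yc subrr mulr0 addr0. Qed.

Lemma convexI (A B : set 'rV[R]_m) :
  convex_region A -> convex_region B -> convex_region (A `&` B).
Proof. by move=> cA cB x y u [? ?] [? ?] u01; split; [exact: cA|exact: cB]. Qed.

Lemma closed_box a b : closed (box a b).
Proof.
have -> : box a b =
    \bigcap_(i in setT) ((fun t => t ord0 i) @^-1` `[a ord0 i, b ord0 i]).
  apply/seteqP; split=> t /= H i; first by move=> _ /=; rewrite in_itv /=; exact: H.
  by have := H i I; rewrite /= in_itv.
apply: closed_bigI => i _; apply: closed_comp; last exact: interval_closed.
by move=> x _; exact: coord_continuous.
Qed.

Let small_liftable f d := forall a b,
  (forall i, b ord0 i - a ord0 i <= d) -> liftable (cube `&` box a b) f.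

(** The sides are doubled one coordinate after the other: a box that is too long in one
    direction is cut by the hyperplane through its middle, and the lifts of the two
    halves are glued along a convex slice. *)
Lemma small_liftable_double f d : small_liftable f d -> small_liftable f (2 * d).
Proof.
move=> sf; have [d0|d0] := ltP d 0.
  by move=> a b ab; apply: sf => i; rewrite (le_trans (ab i))//; lra.
suff H k : forall a b, (forall i : 'I_m, b ord0 i - a ord0 i <=
    if (i < k)%N then 2 * d else d) -> liftable (cube `&` box a b) f.
  by move=> a b ab; apply: (H m) => i; rewrite ltn_ord.
elim: k => [|k IH] a b ab; first by apply: sf => i; exact: ab.
have [mk|km] := leqP m k.
  apply: IH => i; have := ab i.
  by rewrite (leq_trans (ltn_ord i) mk) (leq_trans (ltn_ord i) (leqW mk)).
pose i := Ordinal km; pose c := (a ord0 i + b ord0 i) / 2.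
have ik (j : 'I_m) : j != i -> (j < k.+1)%N = (j < k)%N.
  by move=> ji; rewrite ltnS leq_eqVlt; move: ji; rewrite -val_eqE /= => /negbTE ->.
have abi := ab i; rewrite /= ltnSn in abi.
apply: (@liftable_glue R _ _ f (fun t => t ord0 i) c).
- by apply: closedI; [exact: closed_cube|exact: closed_box].
- by move=> t; exact: coord_continuous.
- apply: convex_connected; apply: convexI; last exact: slice_convex.
  by apply: convexI; [exact: cube_convex|exact: box_convex].
- apply: (@sub_liftable _ _ (cube `&` box a (\row_j if j == i then c else b ord0 j))).
    move=> t [[ct bt] tc]; split=> // j; rewrite mxE; have := bt j.
    by case: eqP => // -> /andP[-> _].
  apply: IH => j; rewrite mxE; have := ab j; case: eqVneq => [-> _|/ik -> //].
  by rewrite ltnn /c; lra.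
- apply: (@sub_liftable _ _ (cube `&` box (\row_j if j == i then c else a ord0 j) b)).
    move=> t [[ct bt] tc]; split=> // j; rewrite mxE; have := bt j.
    by case: eqP => // -> /andP[_ ->]; rewrite andbT.
  apply: IH => j; rewrite mxE; have := ab j; case: eqVneq => [-> _|/ik -> //].
  by rewrite ltnn /c; lra.
Qed.

Lemma cube_compact : compact (@cube R m).
Proof.
apply: bounded_closed_compact; last exact: closed_cube.
exists 1; split; first exact: num_real.
move=> M M1 t ct; change (mx_norm t <= M); rewrite mx_normrE; apply/bigmax_leP.
split=> [|[i j] _ /=]; first by lra.
by rewrite ord1; have := ct j; rewrite ler_norml; lra.
Qed.

(** By compactness all boxes of a small enough size lift, and after finitely many
    doublings that size exceeds the side of the cube. *)
Lemma cube_liftable (f : 'rV[R]_m -> M) : {within cube, continuous f} -> liftable (@cube R m) f.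
Proof.
move=> cf.
have [d d0 sd] : exists2 d : R, 0 < d & small_liftable f d.
  have := cube_compact; rewrite compact_near_coveringP.
  move=> /(_ R (0^'+) (fun d t => liftable
    (cube `&` [set s | forall i, `|s ord0 i - t ord0 i| <= d]) f) _) H.
  have {}H : \forall d \near 0^'+, forall t, cube t ->
      liftable (cube `&` [set s | forall i, `|s ord0 i - t ord0 i| <= d]) f.
    apply: H => t ct.
    have [N /nbhs_ballP[e /= e0 eN] lN] := liftable_near ct cf.
    exists (ball t (e / 2), [set d | d < e / 2]).
      split; first by apply: nbhsx_ballx; rewrite divr_gt0.
      by apply: nbhs_right_lt; rewrite divr_gt0.
    move=> [s d] [/= [_ ts] de]; apply: sub_liftable lN => r [cr /= rs].
    split=> //; apply: eN; split=> // i j; rewrite ord1.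
    have := ts ord0 j; have := rs j; rewrite /ball /=.
    rewrite !(ltr_norml, ler_norml); lra.
  have [d [Hd d0]] : exists d : R, (forall t, cube t ->
      liftable (cube `&` [set s | forall i, `|s ord0 i - t ord0 i| <= d]) f) /\ 0 < d.
    near (0 : R)^'+ => d; exists d; split; first by near: d.
    by near: d; exact: nbhs_right_gt.
  exists d => // a b ab.
  have [[t [ct bt]]|n0] := pselect ((cube `&` box a b) !=set0).
    apply: sub_liftable (Hd t ct) => s [cs bs]; split=> // i /=.
    by have := bs i; have := bt i; have := ab i; rewrite ler_norml; lra.
  exists (fun=> orbit_repr (f 0)); split; last by move=> t bt; case: n0; exists t.
  by apply/continuous_subspaceT; exact: cst_continuous.
have {sd} sd k : small_liftable f (2 ^+ k * d).
  by elim: k => [|k IH]; rewrite ?mul1r// exprS -mulrA; exact: small_liftable_double.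
pose k := Num.bound d^-1.
apply: (sub_liftable _ (sd k 0 (const_mx 1) _)) => [t ct|i].
  by split=> // i; rewrite !mxE; exact: ct.
rewrite !mxE subr0; have : d^-1 < 2 ^+ k.
  apply: lt_trans (archi_boundP _) _; first by rewrite invr_ge0 ltW.
  by rewrite -natrX ltr_nat ltn_expl.
by rewrite -(ltr_pM2r d0) mulVf ?gt_eqF// => /ltW.
Unshelve. all: by end_near.
Qed.

End cube_lifting.
End lifting.

(** * Homotopy groups of an orbit space *)

(** The form in which the contractibility of the covering space is used: it turns
    two lifts with the same ends into a homotopy, with an explicit formula. *)
Definition equiconnecting {R : realType} {V : topologicalType}
    (seg : R -> V -> V -> V) :=
  [/\ continuous (fun p : R * (V * V) => seg p.1 p.2.1 p.2.2),
      forall x y, seg 0 x y = x, forall x y, seg 1 x y = y &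
      forall u x, seg u x x = x].

Section interval_as_cube.
Context {R : realType}.
Implicit Types t : 'rV[R]_1.

Definition end0 : 'rV[R]_1 := const_mx 0.
Definition end1 : 'rV[R]_1 := const_mx 1.

Lemma cube_const (a : R) : 0 <= a <= 1 -> cube (const_mx a : 'rV[R]_1).
Proof. by move=> a01 i; rewrite mxE. Qed.

Lemma cube_end0 : cube end0.
Proof. by apply: cube_const; rewrite lexx ler01. Qed.

Lemma cube_end1 : cube end1.
Proof. by apply: cube_const; rewrite lexx ler01. Qed.

Lemma const_mxE t : const_mx (t ord0 ord0) = t.
Proof. by apply/rowP => i; rewrite mxE (ord1 i). Qed.

Lemma cube_boundary1 t : cube_boundary t <-> t = end0 \/ t = end1.
Proof.
split=> [[ct [i ti]] | [-> | ->]].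
- by move: ti; rewrite (ord1 i) => -[t0|t1]; [left|right]; rewrite -(const_mxE t) ?t0 ?t1.
- by split; [exact: cube_end0|exists ord0; left; rewrite mxE].
- by split; [exact: cube_end1|exists ord0; right; rewrite mxE].
Qed.

Lemma set_first1 t a : set_first t a = const_mx a.
Proof. by apply/rowP => i; rewrite !mxE ord1. Qed.

Lemma continuous_const_mx {T : topologicalType} (a : T -> R) :
  continuous a -> continuous (fun y => const_mx (a y) : 'rV[R]_1).
Proof.
move=> ca; apply: continuous_mx => i j.
by rewrite (_ : (fun t : T => _) = a) //; apply/funext => t; rewrite mxE.
Qed.

End interval_as_cube.

Section homotopy_of_orbit_space.
Context {R : realType} {G : zmodType} {V : topologicalType}.
Context (act : deck_action G V).
Local Notation M := (orbit_space act).
Local Notation proj := (@orbit_proj G V act).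
Local Notation prism n := ((`[0, 1]%classic : set R) `*` (@cube R n)).

(** The prism is a cube of one more dimension. *)
Lemma liftable_prism n (H : R * 'rV[R]_n -> M) :
  {within prism n, continuous H} -> liftable (prism n) H.
Proof.
move=> cH.
pose h (t : 'rV[R]_(1 + n)) := (t ord0 (lshift n ord0), rsubmx t).
pose k (p : R * 'rV[R]_n) : 'rV[R]_(1 + n) := row_mx (const_mx p.1) p.2.
have ch : continuous h.
  apply: continuous_pair; first by move=> t; exact: coord_continuous.
  apply: continuous_mx => i j.
  rewrite (_ : (fun t => _) = (fun t : 'rV[R]_(1 + n) => t i (rshift 1 j))).
    by move=> t; exact: coord_continuous.
  by apply/funext => t; rewrite mxE.
have ck : continuous k.
  apply: continuous_mx => i j; rewrite /k; case: (split_ordP j) => l ->.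
    rewrite (_ : (fun t => _) = fst); first exact: continuous_fst.
    by apply/funext => t; rewrite row_mxEl mxE.
  rewrite (_ : (fun t => _) = (fun t : R * 'rV[R]_n => t.2 i l)); last first.
    by apply/funext => t; rewrite row_mxEr.
  move=> t; apply: (@continuous_comp _ _ _ snd (fun s : 'rV[R]_n => s i l)).
    exact: cvg_snd.
  exact: coord_continuous.
have hk p : h (k p) = p.
  by case: p => u t; rewrite /h /k row_mxKr row_mxEl mxE.
have [|F [cF Ff]] := @cube_liftable _ _ act R (1 + n) (H \o h).
  apply: within_comp cH _; first exact: continuous_subspaceT.
  move=> t ct; split=> /=; first by rewrite in_itv /=; exact: ct.
  by move=> i; rewrite mxE; exact: ct.
have kc p : prism n p -> cube (k p).
  move=> [/= + cp] i; rewrite in_itv /= /k => p01.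
  by case: (split_ordP i) => j ->; rewrite ?row_mxEl ?row_mxEr ?mxE.
exists (F \o k); split; last by move=> p pp /=; rewrite Ff /= ?hk//; exact: kc.
by apply: (within_comp _ cF) => //; exact: continuous_subspaceT.
Qed.

Implicit Types f g : 'rV[R]_1 -> M.

(** The class of a loop in the deck group. As this group is abelian, neither a base
    point nor a lift has to be chosen, and free homotopies can be used throughout. *)
Definition winding f : G :=
  xget 0 [set a | forall F, is_lift cube f F -> F end1 = act a (F end0)].

Lemma winding_lift f F : is_lift cube f F -> f end0 = f end1 ->
  F end1 = act (winding f) (F end0).
Proof.
move=> lF f01.
have [a aF] : exists a, act a (F end0) = F end1.
  by apply/(orbit_projP act); rewrite lF.2 ?lF.2//; [exact: cube_end1|exact: cube_end0].
have := @xgetPex G 0 [set a | forall F, is_lift cube f F -> F end1 = act a (F end0)].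
apply => //; exists a => F' lF'.
have [||||b FF'] := @lift_unique _ _ act _ (@cube R 1) F F'.
- exact/convex_connected/cube_convex.
- exact: lF.1.
- exact: lF'.1.
- by move=> t ct; rewrite lF.2 ?lF'.2.
rewrite (FF' _ (@cube_end0 R)) (FF' _ (@cube_end1 R)) -aF.
exact: deckC.
Qed.

Lemma winding_eq f F a : is_lift cube f F -> F end1 = act a (F end0) ->
  winding f = a.
Proof.
move=> lF Fa; apply: (@deck_free _ _ act _ _ (F end0)); rewrite -Fa.
apply/esym/winding_lift => //.
rewrite -!lF.2 ?Fa ?orbit_proj_deck//; [exact: cube_end1|exact: cube_end0].
Qed.

Lemma winding_ext f g : {within cube, continuous f} -> f end0 = f end1 ->
  (forall t, cube t -> f t = g t) -> winding f = winding g.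
Proof.
move=> cf f01 fg; have [F lF] := @cube_liftable _ _ act _ _ f cf.
apply/esym; apply: (@winding_eq _ F); last exact: winding_lift.
by split; [exact: lF.1|move=> t ct; rewrite lF.2 ?fg].
Qed.

(** Lift the homotopy: the two ends of the lifted loops trace two lifts of one path,
    hence differ by a constant element. *)
Lemma winding_homotopy (H : R * 'rV[R]_1 -> M) :
  {within prism 1, continuous H} ->
  (forall u, 0 <= u <= 1 -> H (u, end0) = H (u, end1)) ->
  winding (fun t => H (0, t)) = winding (fun t => H (1, t)).
Proof.
move=> cH H01; have [F [cF FH]] := liftable_prism cH.
have cu (t : 'rV[R]_1) : cube t ->
      {within (`[0, 1]%classic : set R), continuous (fun u : R => F (u, t))}.
  move=> ct; apply: (within_comp (f := fun u => (u, t)) _ cF) => //.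
  apply: continuous_subspaceT; apply: continuous_pair; last exact: cst_continuous.
  by move=> u; exact: cvg_id.
have ct (u : R) : 0 <= u <= 1 -> {within cube, continuous (fun t => F (u, t))}.
  move=> u01; apply: (within_comp (f := fun t => (u, t)) _ cF) => //.
  apply: continuous_subspaceT; apply: continuous_pair; first exact: cst_continuous.
  by move=> t; exact: cvg_id.
have [||||a Fa] := @lift_unique _ _ act _ (`[0, 1]%classic : set R)
    (fun u => F (u, end0)) (fun u => F (u, end1)).
- exact: segment_connected.
- exact/cu/cube_end0.
- exact/cu/cube_end1.
- move=> u u01 /=; rewrite !FH ?H01//; first by split=> //; exact: cube_end1.
  by split=> //; exact: cube_end0.
have i01 (u : R) : 0 <= u <= 1 -> is_lift cube (fun t => H (u, t)) (fun t => F (u, t)).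
  by move=> u01; split; [exact: ct|move=> t ct'; rewrite FH].
rewrite (@winding_eq _ (fun t => F (0, t)) a).
- rewrite (@winding_eq _ (fun t => F (1, t)) a) //.
    by apply: i01; rewrite lexx ler01.
  by apply: Fa; rewrite /= in_itv /= lexx ler01.
- by apply: i01; rewrite lexx ler01.
- by apply: Fa; rewrite /= in_itv /= lexx ler01.
Qed.

Lemma loop_ends (x : M) (f : cube_loop R x 1) : (f end0 = x) * (f end1 = x).
Proof.
by split; apply: cube_loop_boundary; apply/cube_boundary1; [left|right].
Qed.

Lemma loop_winding_lift (x : M) (f : cube_loop R x 1) F : is_lift cube f F ->
  F end1 = act (winding f) (F end0).
Proof. by move=> lF; apply: winding_lift => //; rewrite !loop_ends. Qed.

(** A lift of the concatenation restricts to a lift of each loop, and the second one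
    starts where the first one ends. *)
Lemma winding_concat (x : M) (f g : cube_loop R x 1) :
  winding (concat f g) = winding f + winding g.
Proof.
have [L lL] := @cube_liftable _ _ act _ _ _ (@cube_loop_continuous _ _ _ _ (concat f g)).
have mk (p : R -> R) (h : 'rV[R]_1 -> M) : continuous p ->
    (forall t : 'rV[R]_1, cube t -> 0 <= p (t ord0 ord0) <= 1 /\
       concat f g (const_mx (p (t ord0 ord0))) = h t) ->
    is_lift cube h (fun t => L (const_mx (p (t ord0 ord0)))).
  move=> cp ph; split=> [|t ct].
    apply: (within_comp (f := fun t : 'rV[R]_1 => const_mx (p (t ord0 ord0))) _ lL.1).
      apply/continuous_subspaceT/continuous_const_mx => t.
      apply: (@continuous_comp _ _ _ (fun t : 'rV[R]_1 => t ord0 ord0) p) (cp _).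
      exact: coord_continuous.
    by move=> t ct; apply: cube_const; have [] := ph t ct.
  have [? <-] := ph t ct; rewrite lL.2//; exact: cube_const.
have lf : is_lift cube f (fun t => L (const_mx (2^-1 * t ord0 ord0))).
  apply: (mk (fun a => 2^-1 * a)).
    by apply: continuous_scale => a; exact: cvg_id.
  move=> t ct; have := ct ord0 => t01; split; first by lra.
  rewrite /= /concat_fun set_first1 mxE ifT; last by lra.
  by rewrite mulrA divff ?pnatr_eq0// mul1r const_mxE.
have lg : is_lift cube g (fun t => L (const_mx (2^-1 * t ord0 ord0 + 2^-1))).
  apply: (mk (fun a => 2^-1 * a + 2^-1)).
    by apply: continuous_affine => a; exact: cvg_id.
  move=> t ct; have := ct ord0 => t01; split; first by lra.
  rewrite /= /concat_fun !set_first1 mxE; case: ifPn => t2.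
    have t0 : t ord0 ord0 = 0 by lra.
    rewrite -[in RHS](const_mxE t) t0 mulr0 add0r divff ?pnatr_eq0//.
    by rewrite !loop_ends.
  rewrite mulrDr mulrA divff ?pnatr_eq0// mul1r.
  by rewrite addrK const_mxE.
apply: (winding_eq lL); have := loop_winding_lift lg; have := loop_winding_lift lf.
rewrite !mxE !mulr0 !mulr1 add0r (_ : 2^-1 + 2^-1 = 1); last by lra.
by move=> -> ->; rewrite -deckD addrC.
Qed.

Context (seg : R -> V -> V -> V).
Hypothesis seg_eq : equiconnecting seg.

Lemma within_seg {T : topologicalType} (A : set T) (u : T -> R) (F F' : T -> V) :
  {within A, continuous u} -> {within A, continuous F} ->
  {within A, continuous F'} ->
  {within A, continuous (fun t => proj (seg (u t) (F t) (F' t)))}.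
Proof.
move=> cu cF cF'; case: seg_eq => cs _ _ _.
have cp : {within A, continuous (fun t => (u t, (F t, F' t)))}.
  apply: (@continuous_pair (subspace A)) => //.
  exact: (@continuous_pair (subspace A)).
apply: (@within_comp _ _ _ A setT _ (fun p => proj (seg p.1 p.2.1 p.2.2)) cp) => //.
apply: continuous_subspaceT => p.
apply: (@continuous_comp _ _ _ (fun p => seg p.1 p.2.1 p.2.2)); first exact: cs.
exact: orbit_proj_continuous.
Qed.

(** Move one lift to the other along [seg] and project; on the boundary nothing moves. *)
Lemma lifts_homotopic n (x : M) (f g : cube_loop R x n) F F' :
  is_lift cube f F -> is_lift cube g F' ->
  (forall t, cube_boundary t -> F t = F' t) -> loop_homotopic f g.
Proof.
move=> lF lF' FF'; case: (seg_eq) => _ s0 s1 sx.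
exists (fun p => proj (seg p.1 (F p.2) (F' p.2))); split => /=.
- apply: within_seg.
  + exact/continuous_subspaceT/continuous_fst.
  + apply: (within_comp _ lF.1) => [|p []//].
    exact/continuous_subspaceT/continuous_snd.
  + apply: (within_comp _ lF'.1) => [|p []//].
    exact/continuous_subspaceT/continuous_snd.
- by move=> t ct; rewrite s0 lF.2.
- by move=> t ct; rewrite s1 lF'.2.
- by move=> u t u01 ct bt; rewrite -FF'// sx lF.2.
Qed.

Lemma winding_inj (x : M) (f g : cube_loop R x 1) :
  winding f = winding g <-> loop_homotopic f g.
Proof.
split=> [fg|[H [cH H0 H1 Hb]]]; last first.
  have [c0 c1] := (@cube_end0 R, @cube_end1 R).
  have <- : winding (fun t => H (0, t)) = winding f.
    apply/esym/winding_ext; [exact: cube_loop_continuous| |by move=> t ?; rewrite H0].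
    by rewrite !loop_ends.
  have <- : winding (fun t => H (1, t)) = winding g.
    apply/esym/winding_ext; [exact: cube_loop_continuous| |by move=> t ?; rewrite H1].
    by rewrite !loop_ends.
  apply: winding_homotopy => // u u01.
  rewrite !Hb ?loop_ends//; apply/cube_boundary1; [by right|by left].
have [F lF] := @cube_liftable _ _ act _ _ _ (@cube_loop_continuous _ _ _ _ f).
have [F' lF'] := @cube_liftable _ _ act _ _ _ (@cube_loop_continuous _ _ _ _ g).
have [a aF] : exists a, act a (F' end0) = F end0.
  apply/(orbit_projP act).
  by rewrite lF.2 ?lF'.2 ?loop_ends//; exact: cube_end0.
apply: (@lifts_homotopic _ _ _ _ F (act a \o F') lF).
  split; last by move=> t ct; rewrite /= orbit_proj_deck lF'.2.
  apply: (@within_comp _ _ _ _ setT) lF'.1 _ _ => //.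
  exact/continuous_subspaceT/deck_continuous.
move=> t /cube_boundary1[->|->] /=; first by rewrite aF.
rewrite (loop_winding_lift lF) (loop_winding_lift lF') -fg deckC aF//.
Qed.

(** The path from a point to its translate by [a] projects to a loop. *)
Lemma winding_surj (x : M) a : exists f : cube_loop R x 1, winding f = a.
Proof.
case: (seg_eq) => _ s0 s1 _.
pose y := orbit_repr x; pose p (t : 'rV[R]_1) := seg (t ord0 ord0) y (act a y).
have cu : continuous (fun t : 'rV[R]_1 => t ord0 ord0).
  by move=> t; exact: coord_continuous.
have cp : {within cube, continuous (proj \o p)}.
  apply: within_seg; apply: continuous_subspaceT => //.
    exact: cst_continuous.
  exact: cst_continuous.
have bp t : cube_boundary t -> (proj \o p) t = x.
  move=> /cube_boundary1[->|->]; rewrite /= /p mxE ?s0 ?s1 ?orbit_proj_deck orbit_reprK//.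
exists (CubeLoop cp bp); apply: (@winding_eq _ p); last by rewrite /p !mxE s0 s1.
split=> //; apply: continuous_subspaceT => t.
case: (seg_eq) => cs _ _ _.
apply: (@continuous_comp _ _ _ (fun t : 'rV[R]_1 => (t ord0 ord0, (y, act a y)))
  (fun p => seg p.1 p.2.1 p.2.2)); last exact: cs.
by apply: continuous_pair => //; exact: cst_continuous.
Qed.

Lemma constant_lift_eq n (x : M) (A : set 'rV[R]_n) (F : 'rV[R]_n -> V) :
  convex_region A -> {within A, continuous F} ->
  (forall t, A t -> proj (F t) = x) -> forall s t, A s -> A t -> F s = F t.
Proof.
move=> cA cF Fx s t As At.
have [||||a aF] := @lift_unique _ _ act _ A (fun=> F s) F.
- exact: convex_connected.
- exact/continuous_subspaceT/cst_continuous.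
- exact: cF.
- by move=> r Ar; rewrite !Fx.
by rewrite (aF _ At) [LHS](aF _ As) -(aF _ As).
Qed.

(** On each face the lift of a loop is constant, since it lies over the base point. In
    dimension at least two the faces are linked to each other, so the lift is constant
    on the whole boundary, and it can be contracted in the covering space. *)
Lemma higher_homotopy_trivial n (x : M) (c : homotopy_group R x n.+2) : c = 1%g.
Proof.
rewrite -(class_reprK c); set f := class_repr c; apply/homotopy_classP.
have [F lF] := @cube_liftable _ _ act _ _ _ (@cube_loop_continuous _ _ _ _ f).
pose face (i : 'I_n.+2) (b : R) := (@cube R n.+2) `&` [set t | t ord0 i = b].
have faceF i b : b = 0 \/ b = 1 -> forall s t, face i b s -> face i b t -> F s = F t.
  move=> b01; apply: (@constant_lift_eq _ x).
  - by apply: convexI; [exact: cube_convex|exact: slice_convex].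
  - by apply: continuous_subspaceW lF.1 => t [].
  - move=> t [ct tb]; rewrite lF.2// cube_loop_boundary//; split=> //.
    by exists i; rewrite tb.
pose o : 'rV[R]_n.+2 := const_mx 0.
have co : cube o by move=> i; rewrite mxE lexx ler01.
have oF i : face i 0 o by split => //=; rewrite mxE.
have bF t : cube_boundary t -> F t = F o.
  move=> [ct [i [ti|ti]]]; first by apply: (faceF i 0) => //; left.
  (* The face $t_i = 1$ contains the unit vector $e_i$, which also lies on a face
     through the origin. *)
  pose j : 'I_n.+2 := if i == ord0 then ord_max else ord0.
  have ij : j != i.
    by rewrite /j; case: (eqVneq i ord0) => [-> //|]; rewrite eq_sym.
  pose e : 'rV[R]_n.+2 := \row_k (k == i)%:R.
  have ce : cube e by move=> k; rewrite mxE; case: (k == i); rewrite /= ?lexx ler01.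
  rewrite (faceF i 1 _ t e) //; [|by right|by split=> //=; rewrite mxE eqxx].
  by apply: (faceF j 0) => //; [left|split=> //=; rewrite mxE (negbTE ij)].
apply: (@lifts_homotopic _ _ _ _ F (fun=> F o) lF) => //.
split; first exact/continuous_subspaceT/cst_continuous.
move=> t ct /=; rewrite lF.2// cube_loop_boundary//.
by split=> //; exists ord0; left; rewrite mxE.
Qed.

Definition winding_class (x : M) (c : homotopy_group R x 1) : G :=
  winding (class_repr c).

Lemma winding_classE (x : M) (f : cube_loop R x 1) :
  winding_class (homotopy_class f) = winding f.
Proof. exact/winding_inj/class_repr_homotopic. Qed.

Lemma winding_class_mul (x : M) (c d : homotopy_group R x 1) :
  winding_class (c * d)%g = winding_class c + winding_class d.
Proof.
rewrite -(class_reprK c) -(class_reprK d) [(_ * _)%g]homotopy_mulE.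
by rewrite !winding_classE winding_concat.
Qed.

Lemma winding_classX (x : M) (c : homotopy_group R x 1) k :
  winding_class (c ^+ k)%g = winding_class c *+ k.
Proof.
elim: k => [|k IH]; last by rewrite expgS winding_class_mul IH mulrS.
apply: (addrI (winding_class (1%g : homotopy_group R x 1))).
by rewrite expg0 -winding_class_mul mulg1 mulr0n addr0.
Qed.

Lemma winding_class_bij (x : M) : bijective (@winding_class x).
Proof.
have inj : injective (@winding_class x).
  move=> c d; rewrite -(class_reprK c) -(class_reprK d) !winding_classE.
  by move=> /winding_inj/homotopy_classP.
have /choice[h hK] a : exists c, @winding_class x c = a.
  have [f fa] := winding_surj x a.
  by exists (homotopy_class f); rewrite winding_classE.
by exists h => // c; apply: inj; rewrite hK.
Qed.

End homotopy_of_orbit_space.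

(** * Divisibility is a homotopy invariant *)

Definition divisible (p : nat) (A : zmodType) :=
  forall a : A, exists b, b *+ p = a.

Lemma group_isomorphic_sym (H K : groupType) :
  group_isomorphic H K -> group_isomorphic K H.
Proof.
move=> [phi [psi phiK psiK]].
have psiM : {morph psi : x y / (x * y)%g}.
  by move=> x y; rewrite -{1}(psiK x) -{1}(psiK y) -gmulfM phiK.
pose PsiM := isMultiplicative.Build K H psi psiM.
pose Psi : {multiplicative K -> H} := HB.pack psi PsiM.
by exists Psi; exists phi.
Qed.

Lemma multiplicativeX (H K : groupType) (phi : {multiplicative H -> K}) c k :
  phi (c ^+ k)%g = (phi c ^+ k)%g.
Proof.
elim: k => [|k IH]; last by rewrite !expgS gmulfM IH.
by apply: (mulgI (phi 1%g)); rewrite -gmulfM !expg0 !mulg1.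
Qed.

Section divisibility.
Context {R : realType} {G1 G2 : zmodType} {V1 V2 : topologicalType}.
Context (act1 : deck_action G1 V1) (act2 : deck_action G2 V2).
Context (seg1 : R -> V1 -> V1 -> V1) (seg2 : R -> V2 -> V2 -> V2).
Hypothesis seg1_eq : equiconnecting seg1.
Hypothesis seg2_eq : equiconnecting seg2.
Local Notation M1 := (orbit_space act1).
Local Notation M2 := (orbit_space act2).

Lemma isomorphic_divisible p (x : M1) (y : M2) :
  group_isomorphic (homotopy_group R x 1) (homotopy_group R y 1) ->
  divisible p G2 -> divisible p G1.
Proof.
move=> [phi phi_bij] dG2 a.
have [w1 w1K w1V] := winding_class_bij seg1_eq x.
have [w2 w2K w2V] := winding_class_bij seg2_eq y.
have [psi phiK psiK] := phi_bij.
have [b pb] := dG2 (winding_class (phi (w1 a))).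
exists (winding_class (psi (w2 b))).
rewrite -(winding_classX seg1_eq) -[RHS]w1V; congr winding_class.
apply: (can_inj phiK); rewrite multiplicativeX psiK; apply: (can_inj w2K).
by rewrite (winding_classX seg2_eq) w2V.
Qed.

End divisibility.

Section pushforward.
Context {R : realType} {G1 G2 : zmodType} {V1 V2 : topologicalType}.
Context (act1 : deck_action G1 V1) (act2 : deck_action G2 V2).
Local Notation M1 := (orbit_space act1).
Local Notation M2 := (orbit_space act2).

Lemma within_push {X Y : topologicalType} (x : X) (f : X -> Y) n (l : cube_loop R x n) :
  continuous f -> {within cube, continuous (f \o l)}.
Proof.
move=> cf; apply: (@within_comp _ _ _ _ setT) (@cube_loop_continuous _ _ _ _ l) _ _ => //.
exact: continuous_subspaceT.
Qed.

Definition push {X Y : topologicalType} (x : X) (f : X -> Y) (cf : continuous f) n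
    (l : cube_loop R x n) : cube_loop R (f x) n :=
  CubeLoop (@within_push _ _ x f n l cf)
    (fun t bt => congr1 f (@cube_loop_boundary _ _ _ _ l t bt)).

Lemma winding_same (x : M1) (f g : cube_loop R x 1) :
  f =1 g -> winding f = winding g.
Proof.
by move=> fg; apply: winding_ext => //;
  [exact: cube_loop_continuous|rewrite !loop_ends].
Qed.

Lemma homotopic_winding (f g : M1 -> M1) (x : M1) (l : cube_loop R x 1) :
  continuous f -> continuous g ->
  homotopic_rel R setT set0 f g -> winding (f \o l) = winding (g \o l).
Proof.
move=> cf cg [H [cH H0 H1 _]].
have e0 : winding (fun t => H (0, l t)) = winding (f \o l).
  apply/esym/winding_ext; [exact: within_push|by rewrite /= !loop_ends|].
  by move=> t ct; rewrite H0.
have e1 : winding (fun t => H (1, l t)) = winding (g \o l).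
  apply/esym/winding_ext; [exact: within_push|by rewrite /= !loop_ends|].
  by move=> t ct; rewrite H1.
rewrite -e0 -e1; apply: (@winding_homotopy R _ _ act1 (fun p => H (p.1, l p.2))).
  pose A := (`[0, 1]%classic : set R) `*` (@cube R 1).
  have cp : {within A, continuous (fun p : R * 'rV[R]_1 => (p.1, l p.2))}.
    apply: (@continuous_pair (subspace A)).
      exact/continuous_subspaceT/continuous_fst.
    apply: (within_comp _ (@cube_loop_continuous _ _ _ _ l)) => [|p []//].
    exact/continuous_subspaceT/continuous_snd.
  by apply: (within_comp cp cH) => p [].
by move=> u _; rewrite /= !loop_ends.
Qed.

(** Pushing forward commutes with concatenation, so a loop homotopic to a [k]-th power
    has a pushforward whose class is divisible by [k]. *)
Lemma winding_push_iter (x : M2) (f : M2 -> M1) (cf : continuous f)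
    (l : cube_loop R x 1) k :
  winding (f \o iter k (concat l) (@cst_loop R _ x 0)) =
  winding (f \o l) *+ k.
Proof.
elim: k => [|k IH].
  apply: (@winding_eq _ _ _ act1 _ (fun=> orbit_repr (f x))); last by rewrite deck0.
  split; first exact/continuous_subspaceT/cst_continuous.
  by move=> t _; exact: orbit_reprK.
rewrite mulrS -IH -[LHS]/(winding (push cf (concat l _))).
rewrite -[RHS]/(winding (push cf l) + winding (push cf _)).
rewrite -winding_concat; apply: winding_same => t /=.
by rewrite /concat_fun /=; case: ifP.
Qed.

End pushforward.

Lemma homotopy_equivalent_sym (R : realType) (X Y : topologicalType) :
  homotopy_equivalent R X Y -> homotopy_equivalent R Y X.
Proof. by move=> [f [g [cf cg gf fg]]]; exists g, f. Qed.

(** Let [a] be the class of a loop $l$. The class of $f \circ l$ is $p b$, so this loop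
    is homotopic to the $p$-th power of a loop $m$ of class $b$. Hence the class of $g
    \circ f \circ l$ is $p$ times that of $g \circ m$; and it is [a], because the loop
    is freely homotopic to $l$. *)
Lemma homotopy_equivalent_divisible (R : realType) (G1 G2 : zmodType)
    (V1 V2 : topologicalType) (act1 : deck_action G1 V1) (act2 : deck_action G2 V2)
    (seg1 : R -> V1 -> V1 -> V1) (seg2 : R -> V2 -> V2 -> V2) (v : V1) p :
  equiconnecting seg1 -> equiconnecting seg2 ->
  homotopy_equivalent R (orbit_space act1) (orbit_space act2) ->
  divisible p G2 -> divisible p G1.
Proof.
move=> s1 s2 [f [g [cf cg gf _]]] dG2 a.
have [l <-] := winding_surj s1 (orbit_proj act1 v) a.
have [b pb] := dG2 (winding (push cf l)).
have [m mb] := winding_surj s2 (f (orbit_proj act1 v)) b.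
exists (winding (g \o m)); rewrite -winding_push_iter //.
have /(winding_inj s2)[H [cH H0 H1 Hb]] :
    winding (iter p (concat m) (@cst_loop R _ (f (orbit_proj act1 v)) 0)) = winding (push cf l).
  rewrite -pb -mb -[LHS]/(winding (id \o _)) winding_push_iter //.
  by move=> x; exact: cvg_id.
have -> : winding (g \o iter p (concat m) (@cst_loop R _ (f (orbit_proj act1 v)) 0)) =
    winding (g \o (f \o l)).
  rewrite -[LHS]/(winding (push cg _)).
  rewrite -[RHS]/(winding (push cg (push cf l))).
  apply/(winding_inj s1); exists (g \o H); split.
  - apply: (@within_comp _ _ _ _ setT) cH _ _ => //.
    exact: continuous_subspaceT.
  - by move=> t ct /=; rewrite H0.
  - by move=> t ct /=; rewrite H1.
  - by move=> u t u01 ct bt /=; rewrite Hb.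
apply: (@homotopic_winding _ _ _ act1 (g \o f) id) => //.
- by move=> x; apply: continuous_comp; [exact: cf|exact: cg].
- by move=> x; exact: cvg_id.
Qed.

(** * Differentials and complex vectors *)

Section differentials.
Context {K : numFieldType} {V W : normedModType K}.

Lemma is_diffI (f : V -> W) (L : {linear V -> W}) (x : V) : continuous L ->
  (forall e : K, 0 < e -> nbhs (0 : V) [set h | `|f (h + x) - (f x + L h)| <= e * `|h|]) ->
  is_diff x f L.
Proof.
move=> cL fL.
have dE : f \o shift x = cst (f x) + L +o_ (0 : V) id.
  by apply/eqaddoP => e e0; exact: fL.
have dL : 'd f x = L :> (V -> W) by exact: diff_unique.
by apply: DiffDef => //; apply/diff_locallyP; rewrite dL.
Qed.

Lemma diff_approx (f : V -> W) (x : V) (e : K) : differentiable f x -> 0 < e ->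
  nbhs (0 : V) [set h | `|f (h + x) - (f x + 'd f x h)| <= e * `|h|].
Proof. by move=> /diff_locally/eqaddoP df e0; exact: df. Qed.

Lemma near_eq_is_diff (f g : V -> W) (x : V) : nbhs x [set y | f y = g y] ->
  differentiable f x -> is_diff x g ('d f x).
Proof.
move=> fg df; apply: is_diffI => [|e e0]; first exact: diff_continuous.
have fgx := nbhs_singleton fg.
have {}fg : nbhs (0 : V) [set h | f (h + x) = g (h + x)].
  have : (fun h : V => h + x) @ (0 : V) --> x.
    by rewrite -[X in _ --> X]add0r; apply: cvgD; [exact: cvg_id|exact: cvg_cst].
  by move=> /(_ _ fg).
apply: filterS2 fg (diff_approx df e0) => h /= <-.
by rewrite -fgx.
Qed.

Lemma near_eq_differentiable (f g : V -> W) (x : V) :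
  nbhs x [set y | f y = g y] -> differentiable f x -> differentiable g x.
Proof. by move=> fg /(near_eq_is_diff fg)[]. Qed.

Lemma linear_rV_continuous n (L : {linear 'rV[K]_n -> W}) : continuous L.
Proof.
have -> : (L : _ -> _) = fun x => \sum_i x ord0 i *: L (delta_mx ord0 i).
  apply/funext => x; rewrite {1}[x]row_sum_delta linear_sum.
  by apply: eq_bigr => i _; rewrite linearZ.
have cL i : continuous (fun x : 'rV[K]_n => x ord0 i *: L (delta_mx ord0 i)).
  by move=> x; apply: (@cvgZ _ _ _ (nbhs x)); [exact: coord_continuous|exact: cvg_cst].
by apply: continuous_big => [|i _]; [exact: add_continuous|exact: cL].
Qed.

End differentials.

Section complex_vectors.
Context {R : realType}.
Local Notation C := (complex_numbers R).

Definition toC (u : R) : C := u%:C%C.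

Lemma norm_toC (u : R) : `|toC u| = toC `|u|.
Proof. by rewrite /toC normc_def /= expr0n addr0 sqrtr_sqr. Qed.

Lemma toC_ltr (u v : R) : (toC u < toC v) = (u < v).
Proof. by rewrite /toC ltcE /= eqxx. Qed.

Lemma toC_ler (u v : R) : (toC u <= toC v) = (u <= v).
Proof. by rewrite /toC lecE /= eqxx. Qed.

Lemma real_toC (e : C) : e \is Num.real -> e = toC (complex.Re e).
Proof. by move=> er; rewrite /toC RRe_real. Qed.

Lemma toCB (u v : R) : toC (u - v) = toC u - toC v.
Proof. exact: (rmorphB (real_complex R)). Qed.

Lemma toCD (u v : R) : toC (u + v) = toC u + toC v.
Proof. exact: (rmorphD (real_complex R)). Qed.

Lemma toCM (u v : R) : toC (u * v) = toC u * toC v.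
Proof. exact: (rmorphM (real_complex R)). Qed.

Lemma toC_continuous : continuous toC.
Proof.
move=> u A /nbhs_ballP[e /= e0 eA]; apply/nbhs_ballP.
have er := real_toC (gtr0_real e0).
exists (complex.Re e) => /=; first by move: e0; rewrite er toC_ltr.
move=> v uv; apply: eA; rewrite /ball /= er -toCB.
by rewrite norm_toC toC_ltr.
Qed.

Definition segment n (u : R) (x y : 'rV[C]_n) := x + toC u *: (y - x).

Lemma segment_equiconnecting n : equiconnecting (@segment n).
Proof.
split.
- move=> p; apply: cvgD.
    apply: (@continuous_comp _ _ _ snd fst); first exact: cvg_snd.
    exact: cvg_fst.
  apply: cvgZ.
    apply: (@continuous_comp _ _ _ fst toC); first exact: cvg_fst.
    exact: toC_continuous.
  apply: cvgB; apply: (@continuous_comp _ _ _ snd);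
    [exact: cvg_snd|exact: cvg_snd|exact: cvg_snd|exact: cvg_fst].
- by move=> x y; rewrite /segment /toC scale0r addr0.
- by move=> x y; rewrite /segment /toC scale1r addrC subrK.
- by move=> u x; rewrite /segment subrr scaler0 addr0.
Qed.

Lemma rV_connected n : connected [set: 'rV[C]_n].
Proof.
apply: (@path_connected R) => x y _ _; have [cs s0 s1 _] := segment_equiconnecting n.
exists (fun u => segment u x y); split => //.
move=> u; apply: (@continuous_comp _ _ _ (fun u => (u, (x, y)))
  (fun p => segment p.1 p.2.1 p.2.2)); last exact: cs.
by apply: continuous_pair; [move=> v; exact: cvg_id|exact: cst_continuous].
Qed.

End complex_vectors.

(** * Orbit manifolds *)

Section second_countability.
Context {R : realType}.
Local Notation C := (complex_numbers R).

Definition rational_vector n (q : {ffun 'I_n -> rat * rat}) : 'rV[C]_n :=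
  \row_i (ratr (q i).1 +i* ratr (q i).2)%C.

Lemma rational_vector_dense n (x : 'rV[C]_n) (e : R) : 0 < e ->
  exists q, forall i, `|x ord0 i - rational_vector q ord0 i| < toC e.
Proof.
move=> e0.
have /choice[q qP] : forall i, exists q : rat * rat,
    `|x ord0 i - (ratr q.1 +i* ratr q.2)%C| < toC e.
  move=> i; case: (x ord0 i) => a b.
  have near_rat (c : R) : exists r : rat, `|c - ratr r| < e / 2.
    have [|r] := @rat_in_itvoo R (c - e / 2) (c + e / 2); first by lra.
    by rewrite in_itv /= => cr; exists r; rewrite ltr_norml; lra.
  have [[r ar] [s bs]] := (near_rat a, near_rat b).
  exists (r, s).
  rewrite (_ : _ - _ = toC (a - ratr r) + 'i%C * toC (b - ratr s)); last first.
    by apply/eqP; rewrite eq_complex /=; apply/andP; split; apply/eqP; ring.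
  apply: (le_lt_trans (ler_normD _ _)); rewrite normrM !norm_toC.
  rewrite (_ : `|'i%C| = 1 :> C); last first.
    by rewrite normc_def /= expr0n /= expr1n add0r sqrtr1.
  by rewrite mul1r -toCD toC_ltr; lra.
by exists [ffun i => q i] => i; rewrite mxE ffunE.
Qed.

Lemma rV_second_countable n : @second_countable 'rV[C]_n.
Proof.
pose f (p : {ffun 'I_n -> rat * rat} * nat) : set 'rV[C]_n :=
  (ball (rational_vector p.1) (toC p.2.+1%:R^-1)).
exists (range f); first exact: sub_countable (card_image_le _ _) (countableP _).
split=> [_ [p _ <-]|x A /nbhs_ballP[e /= e0 eA]]; first exact: ball_open.
have er := real_toC (gtr0_real e0).
have {}e0 : 0 < complex.Re e by move: e0; rewrite {1}er (toC_ltr 0).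
set r := complex.Re e in er e0.
pose k := Num.bound (2 / r).
have kr : k.+1%:R^-1 < r / 2.
  rewrite -[r / 2]invrK ltf_pV2 ?posrE ?invr_gt0 ?divr_gt0//.
  rewrite invf_div (lt_trans (archi_boundP _))// ?ltr_nat//.
  by rewrite divr_ge0// ltW.
have k0 : (0 : R) < k.+1%:R^-1 by rewrite invr_gt0.
have [q xq] := rational_vector_dense x k0.
have qx : ball (rational_vector q) (toC k.+1%:R^-1) x.
  split; first by rewrite (toC_ltr 0).
  by move=> i j; rewrite (ord1 i) /ball /= distrC; exact: xq.
exists (f (q, k)).
  by split; [exists (q, k)|exact: qx].
apply: subset_trans eA => y qy.
have -> : e = toC k.+1%:R^-1 + toC (r - k.+1%:R^-1).
  by rewrite toCB addrC subrK.
apply: (ball_triangle (ball_sym qx)).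
by apply: le_ball qy; rewrite toC_ler; move: kr; set c := k.+1%:R^-1; lra.
Qed.

End second_countability.

Section orbit_manifold.
Context {R : realType} {G : zmodType} {n : nat}.
Local Notation C := (complex_numbers R).
Local Notation V := 'rV[C]_n.
Context (act : deck_action G V).
Hypothesis act_holomorphic : forall a x, differentiable (act a) x.
Local Notation M := (orbit_space act).
Local Notation proj := (@orbit_proj G V act).

Definition sheet_chart (U : set V) : chart M n :=
  Chart (proj @` U) (sheet_section U) proj.

Definition orbit_atlas : set (chart M n) := [set sheet_chart U | U in sheet act].

Lemma sheet_chart_image U : sheet act U -> chart_image (sheet_chart U) = U.
Proof.
move=> sU; apply/seteqP; split=> [_ [m /sheet_sectionP[Um _] <-] //|x Ux].
by exists (proj x); [exists x|rewrite /= sheet_sectionK].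
Qed.

(** Locally, a change of sheets is the action of one group element, so the transition
    maps are holomorphic. *)
Lemma section_proj_near U x : sheet act U -> (proj @` U) (proj x) ->
  exists a, nbhs x [set y | act a y = sheet_section U (proj y)].
Proof.
move=> sU /[dup] Ux /sheet_sectionP[sx /esym/orbit_projP[a ax]].
have nU : nbhs (act a x) U by apply: open_nbhs_nbhs; split; [case: sU|rewrite ax].
have {}nU : nbhs x (act a @^-1` U) by exact: (@deck_continuous _ _ act a x _ nU).
exists a; apply: filterS nU => y /= Uy.
by rewrite -(sheet_sectionK sU Uy) orbit_proj_deck.
Qed.

Lemma section_proj_differentiable U x : sheet act U -> (proj @` U) (proj x) ->
  differentiable (fun y => sheet_section U (proj y)) x.
Proof.
move=> sU Ux; have [a ax] := section_proj_near sU Ux.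
exact: near_eq_differentiable (act_holomorphic a x).
Qed.

Lemma orbit_atlasP : is_atlas orbit_atlas.
Proof.
split.
- move=> _ [U sU <-]; split.
  + by apply: orbit_proj_open; case: sU.
  + by rewrite sheet_chart_image//; case: sU.
  + by move=> m /sheet_sectionP[].
  + exact: sheet_section_continuous.
  + exact/continuous_subspaceT/orbit_proj_continuous.
- move=> m; have [U sU Um] := sheet_ex act (orbit_repr m).
  exists (sheet_chart U); first by exists U.
  by exists (orbit_repr m) => //; exact: orbit_reprK.
- move=> _ _ [U sU <-] [W sW <-] m Um Wm.
  have [_ sm] := sheet_sectionP Um.
  by apply: section_proj_differentiable => //=; rewrite sm.
Qed.

Definition orbit_manifold : complex_manifold R n :=
  @ComplexManifold R n M orbit_atlas (orbit_space_hausdorff (act := act))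
    (orbit_space_second_countable act (@rV_second_countable R n)) orbit_atlasP.

End orbit_manifold.

(** * Trivial bundles *)

Arguments atlas {R n} M : rename.
Arguments fiber {R m M r} E x : rename.
Arguments fiber_incl {R m M r} E {x} v : rename.

Section product_manifold.
Context {R : realType} {m r : nat} (M : complex_manifold R m).
Local Notation C := (complex_numbers R).
Local Notation V := 'rV[C]_r.

Lemma open_prod {T U : topologicalType} (A : set T) (B : set U) :
  open A -> open B -> open (A `*` B).
Proof.
move=> oA oB.
rewrite (_ : A `*` B = (fst @^-1` A) `&` (snd @^-1` B)) //; apply: openI.
  by apply: open_comp => // x _; exact: cvg_fst.
by apply: open_comp => // x _; exact: cvg_snd.
Qed.

Lemma second_countable_prod {T U : topologicalType} :
  @second_countable T -> @second_countable U -> @second_countable (T * U)%type.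
Proof.
move=> [A cA [oA bA]] [B cB [oB bB]].
exists [set p.1 `*` p.2 | p in A `*` B].
  exact: sub_countable (card_image_le _ _) (countableX cA cB).
split=> [_ [[P Q] [/= /oA oP /oB oQ] <-]|[x y] W [[P Q] /= [Px Qy] PQW]].
  exact: open_prod.
have [P' [AP' P'x] P'P] := bA _ _ Px; have [Q' [BQ' Q'y] Q'Q] := bB _ _ Qy.
exists (P' `*` Q'); first by split => //; exists (P', Q').
by move=> [s t] [/= /P'P Ps /Q'Q Qt]; exact: PQW.
Qed.

Lemma hausdorff_prod_space {T U : topologicalType} :
  hausdorff_space T -> hausdorff_space U -> hausdorff_space (T * U)%type.
Proof.
move=> hT hU [x y] [x' y'] cl; congr pair.
  apply: hT => A B xA yB.
  have [||[s t] [As Bs]] := cl (fst @^-1` A) (fst @^-1` B).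
  - exact: cvg_fst.
  - exact: cvg_fst.
  by exists s.
apply: hU => A B xA yB.
have [||[s t] [As Bs]] := cl (snd @^-1` A) (snd @^-1` B).
- exact: cvg_snd.
- exact: cvg_snd.
by exists t.
Qed.

Lemma continuous_row_mx {T : topologicalType} {K : numFieldType} p q
    (f : T -> 'rV[K]_p) (g : T -> 'rV[K]_q) :
  continuous f -> continuous g -> continuous (fun t => row_mx (f t) (g t)).
Proof.
move=> cf cg; apply: continuous_mx => i j; case: (split_ordP j) => k ->.
  rewrite (_ : (fun t => _) = (fun t => f t i k)).
    by move=> t; apply: (@continuous_comp _ _ _ f (fun s => s i k));
      [exact: cf|exact: coord_continuous].
  by apply/funext => t; rewrite row_mxEl.
rewrite (_ : (fun t => _) = (fun t => g t i k)).
  by move=> t; apply: (@continuous_comp _ _ _ g (fun s => s i k));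
    [exact: cg|exact: coord_continuous].
by apply/funext => t; rewrite row_mxEr.
Qed.

Lemma linear_rV_differentiable {K : numFieldType} {W : normedModType K} n
    (L : {linear 'rV[K]_n -> W}) x : differentiable L x.
Proof. exact/linear_differentiable/linear_rV_continuous. Qed.

Lemma differentiable_row_mx {K : numFieldType} {W : normedModType K} p q
    (f : W -> 'rV[K]_p) (g : W -> 'rV[K]_q) x :
  differentiable f x -> differentiable g x ->
  differentiable (fun w => row_mx (f w) (g w)) x.
Proof.
move=> df dg.
have linl : linear (fun u : 'rV[K]_p => row_mx u (0 : 'rV[K]_q)).
  by move=> a u v; rewrite scale_row_mx add_row_mx scaler0 addr0.
have linr : linear (fun u : 'rV[K]_q => row_mx (0 : 'rV[K]_p) u).
  by move=> a u v; rewrite scale_row_mx add_row_mx scaler0 addr0.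
pose Ll : {linear 'rV[K]_p -> 'rV[K]_(p + q)} :=
  HB.pack (fun u : 'rV[K]_p => row_mx u (0 : 'rV[K]_q))
    (GRing.isLinear.Build _ _ _ _ _ linl).
pose Lr : {linear 'rV[K]_q -> 'rV[K]_(p + q)} :=
  HB.pack (fun u : 'rV[K]_q => row_mx (0 : 'rV[K]_p) u)
    (GRing.isLinear.Build _ _ _ _ _ linr).
rewrite (_ : (fun w => _) = (Ll \o f) + (Lr \o g)).
  apply: differentiableD; apply: differentiable_comp => //;
    exact: linear_rV_differentiable.
by apply/funext => w; rewrite /= -[RHS]/(row_mx _ _ + row_mx _ _) add_row_mx addr0 add0r.
Qed.

Lemma prod_atlasP : @is_atlas R (M * V)%type (m + r) (prod_atlas (atlas M) (@id_atlas R r)).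
Proof.
have [Mc Mcov Mcomp] := manifold_atlas M.
split.
- move=> _ [c Ac [d -> <-]]; have [od oi cK cc ci] := Mc _ Ac; split => /=.
  + by apply: open_prod => //; exact: openT.
  + rewrite (_ : chart_image _ = lsubmx @^-1` (chart_image c)).
      by apply: open_comp => // z _; exact: continuous_lsubmx.
    apply/seteqP; split=> [_ [[x v] [/= cx _] <-]|z [x cx cxz]].
      by rewrite /= row_mxKl; exists x.
    by exists (x, rsubmx z); rewrite //= cxz hsubmxK.
  + by move=> [x v] [/= cx _]; rewrite row_mxKl row_mxKr cK.
  + apply: (@continuous_row_mx (subspace (chart_dom c `*` [set: V])) C m r
      (fun p : M * V => c p.1) snd).
      apply: (within_comp (f := fst) _ cc) => [|[x v] []//].
      exact/continuous_subspaceT/continuous_fst.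
    exact/continuous_subspaceT/continuous_snd.
  + set A := chart_image _.
    apply: (@continuous_pair (subspace A) M V (chart_inv c \o lsubmx) rsubmx).
      apply: (within_comp (f := lsubmx) _ ci) => [|_ [[x v] [/= cx _] <-]].
        exact/continuous_subspaceT/continuous_lsubmx.
      by rewrite row_mxKl; exists x.
    exact/continuous_subspaceT/continuous_rsubmx.
- move=> [x v]; have [c Ac cx] := Mcov x.
  exists (prod_chart c (Chart setT id id)); last by [].
  by exists c => //; exists (Chart setT id id).
- move=> _ _ [c Ac [_ -> <-]] [d Ad [_ -> <-]] [x v] [/= cx _] [/= dx _].
  apply: differentiable_row_mx; last exact: differentiable_rsubmx.
  apply: (@differentiable_comp _ _ _ _ lsubmx (d \o chart_inv c)).
    exact: differentiable_lsubmx.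
  by rewrite row_mxKl; exact: Mcomp.
Qed.

Definition product_manifold : complex_manifold R (m + r) :=
  @ComplexManifold R (m + r) (M * V)%type (prod_atlas (atlas M) (@id_atlas R r))
    (hausdorff_prod_space (@manifold_hausdorff R m M) (@norm_hausdorff _ V))
    (second_countable_prod (@manifold_second_countable R m M) (@rV_second_countable R r))
    prod_atlasP.

Lemma product_fst_holomorphic :
  holomorphic_on (atlas product_manifold) (atlas M) setT fst.
Proof.
have [_ _ Mcomp] := manifold_atlas M.
split; first exact/continuous_subspaceT/continuous_fst.
move=> _ d [x v] [c Ac [_ -> <-]] Ad _ [/= cx _] dx.
apply: (@differentiable_comp _ _ _ _ lsubmx (d \o chart_inv c)).
  exact: differentiable_lsubmx.
by rewrite row_mxKl; exact: Mcomp.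
Qed.

Lemma product_trivialization (x : M) : exists U Phi, U x /\
  local_trivialization (E := product_manifold) fst (fiber := fun _ => V)
    (fun x v => (x, v)) U Phi.
Proof.
have [_ _ Mcomp] := prod_atlasP.
have hid (W : set (M * V)) : @holomorphic_on R (M * V)%type (M * V)%type (m + r) (m + r)
    (prod_atlas (atlas M) (@id_atlas R r)) (prod_atlas (atlas M) (@id_atlas R r)) W id.
  split; first by apply: continuous_subspaceT => y; exact: cvg_id.
  by move=> c d y Ac Ad _ cy dy; exact: Mcomp.
exists setT, snd; split => //; split => //.
- exact: openT.
- rewrite (_ : (fun e : product_manifold => (e.1, e.2)) = id).
    exact: hid.
  by apply/funext => -[].
- by exists id; split => //; [exact: hid|case].
Qed.

Lemma pair_range (x : M) : range (fun v : V => (x, v)) = [set e : M * V | e.1 = x].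
Proof. by apply/seteqP; split=> [_ [v _ <-]//|[y v] /= <-]; exists v. Qed.

Definition trivial_bundle : holomorphic_bundle M r :=
  @HolomorphicBundle R m M r product_manifold fst product_fst_holomorphic
    (fun _ => V) (fun x v => (x, v)) (fun x u v uv => congr1 snd uv) pair_range
    product_trivialization.

End product_manifold.

(** * Sprays on orbit manifolds *)

Section ellipticity.
Context {R : realType} {G : zmodType} {n : nat}.
Local Notation C := (complex_numbers R).
Local Notation V := 'rV[C]_n.
Context (act : deck_action G V).
Hypothesis act_holomorphic : forall a x, differentiable (act a) x.
Local Notation M := (orbit_manifold act_holomorphic).
Local Notation proj := (@orbit_proj G V act).

Context (sp : V -> V -> V).
Hypothesis sp0 : forall x, sp x 0 = x.
Hypothesis sp_equivariant : forall a x v, sp (act a x) v = act a (sp x v).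
Hypothesis sp_holomorphic : forall z : 'rV[C]_(n + n),
  differentiable (fun z => sp (lsubmx z) (rsubmx z)) z.
Hypothesis sp_dominating : forall x w, exists v, 'd (sp x) 0 v = w.

Let spray (p : M * V) : M := proj (sp (orbit_repr p.1) p.2).

Let sprayE x v : spray (proj x, v) = proj (sp x v).
Proof.
rewrite /spray /=; have /esym/orbit_projP[a <-] := orbit_reprK (proj x).
by rewrite sp_equivariant orbit_proj_deck.
Qed.

Let sp_continuous : continuous (fun p : V * V => sp p.1 p.2).
Proof.
rewrite (_ : (fun p => _) =
    (fun z : 'rV[C]_(n + n) => sp (lsubmx z) (rsubmx z)) \o (fun p : V * V => row_mx p.1 p.2)).
  move=> p; apply: continuous_comp.
    by apply: continuous_row_mx; [exact: continuous_fst|exact: continuous_snd].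
  exact/differentiable_continuous/sp_holomorphic.
by apply/funext => -[x v] /=; rewrite row_mxKl row_mxKr.
Qed.

Let spray_continuous : continuous (spray : (M * V)%type -> M).
Proof.
move=> [m v] A mA.
have [U sU Um] := sheet_ex act (orbit_repr m).
have oU : open (proj @` U) by apply: orbit_proj_open; case: sU.
have Um' : (proj @` U) m by exists (orbit_repr m) => //; exact: orbit_reprK.
have ext y w : (proj @` U) y -> proj (sp (sheet_section U y) w) = spray (y, w).
  by move=> /sheet_sectionP[_ e]; rewrite -{2}e sprayE.
have cs : {within [set p : M * V | (proj @` U) p.1],
    continuous (fun p : M * V => proj (sp (sheet_section U p.1) p.2))}.
  have cp : {within [set p : M * V | (proj @` U) p.1],
      continuous (fun p : M * V => (sheet_section U p.1, p.2))}.
    apply: (@continuous_pair (subspace [set p : M * V | (proj @` U) p.1]) V V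
      (fun p => sheet_section U p.1) snd).
      apply: (within_comp (f := fst) _ (sheet_section_continuous sU)) => //.
      exact/continuous_subspaceT/continuous_fst.
    exact/continuous_subspaceT/continuous_snd.
  apply: (@within_comp _ _ _ _ setT _ (fun p : V * V => proj (sp p.1 p.2)) cp) => //.
  apply: continuous_subspaceT => p.
  apply: (@continuous_comp _ _ _ (fun p : V * V => sp p.1 p.2)); first exact: sp_continuous.
  exact: orbit_proj_continuous.
have nU : nbhs (m, v) [set p : M * V | (proj @` U) p.1].
  apply: open_nbhs_nbhs; split=> //.
  by apply: (@open_comp _ _ (fst : M * V -> M)) => // x _; exact: cvg_fst.
move/within_continuousP : cs => /(_ (m, v) Um' A); rewrite /= ext// => /(_ mA) nA.
apply: filterS2 nU nA => -[y w] /= Uy /(_ Uy).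
by rewrite ext.
Qed.

(** The group acts on $V \times V$ by $(x, v) \mapsto (a \cdot x, v)$, with quotient the
    trivial bundle $M \times V$, and equivariance lets [sp] descend. In the charts given
    by sheets the spray is [sp] up to the action of one element, so holomorphy and
    domination are those of [sp]. *)
Theorem orbit_manifold_elliptic : elliptic M.
Proof.
exists n, (@trivial_bundle R n n M), spray; split.
  split; first exact/continuous_subspaceT/spray_continuous.
  move=> _ _ [m v] [_ [U sU <-] [_ -> <-]] [W sW <-] _ [/= Um _] Wm.
  pose f (z : 'rV[C]_(n + n)) := sp (lsubmx z) (rsubmx z).
  rewrite (_ : _ \o _ = (fun y => sheet_section W (proj y)) \o f); last first.
    by apply/funext => z; rewrite /= sprayE.
  apply: differentiable_comp; first exact: sp_holomorphic.
  apply: section_proj_differentiable => //; rewrite /f row_mxKl row_mxKr.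
  by have [_ um] := @sheet_sectionP _ _ act U m Um; rewrite -sprayE um.
move=> m; split; first by rewrite /spray /= sp0; exact: (orbit_reprK (act := act) m).
move=> c _ [/= cT lc cK Kc] [W sW <-] _.
rewrite /spray /= sp0 orbit_reprK => Wm.
have [Wy ym] := @sheet_sectionP _ _ act W m Wm; set y := sheet_section W m in Wy ym.
have li : linear (chart_inv c).
  by move=> a u v; apply: (can_inj cK); rewrite lc !Kc.
pose L : {linear V -> V} := HB.pack (chart_inv c : V -> V)
  (GRing.isLinear.Build _ _ _ _ _ li).
have c0 : (c : V -> V) 0 = 0.
  by have := lc (-1) 0 0; rewrite scaler0 add0r scaleN1r addNr.
have dsy : differentiable (sp y) 0.
  have linr : linear (fun u : V => row_mx (0 : V) u).
    by move=> a u v; rewrite scale_row_mx add_row_mx scaler0 addr0.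
  pose Lr : {linear V -> 'rV[C]_(n + n)} :=
    HB.pack (fun u : V => row_mx (0 : V) u) (GRing.isLinear.Build _ _ _ _ _ linr).
  pose f (z : 'rV[C]_(n + n)) := sp (lsubmx z) (rsubmx z).
  have -> : sp y = f \o (fun v => row_mx y 0 + Lr v).
    by apply/funext => v; rewrite /f /= add_row_mx addr0 add0r row_mxKl row_mxKr.
  apply: differentiable_comp; last exact: sp_holomorphic.
  exact: (differentiableD (differentiable_cst _ _) (linear_rV_differentiable Lr _)).
have L0 : L 0 = 0 by exact: linear0.
have dL : is_diff (0 : V) (sp y \o L) ('d (sp y) 0 \o L).
  apply: is_diff_comp; first by apply: DiffDef; [exact: linear_rV_differentiable|
    rewrite diff_lin//; exact: linear_rV_continuous].
  by rewrite L0; exact: differentiableP.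
(* The chart of the fibre at [m] is an arbitrary linear isomorphism with inverse [L];
   near $0$ the map in charts is [sp y \o L]. *)
have := @near_eq_is_diff _ _ _ (sp y \o L)
  (sheet_section W \o (spray \o (fun v => (m, v))) \o L) 0.
rewrite c0; case.
- have nW : nbhs ((sp y \o L) 0) W.
    by apply: open_nbhs_nbhs; split; [case: sW|rewrite /= [chart_inv c 0]L0 sp0].
  have cyL : {for 0, continuous (sp y \o L)}.
    by apply: differentiable_continuous; case: dL.
  have {}nW : nbhs (0 : V) ((sp y \o L) @^-1` W) by exact: (cyL _ nW).
  apply: filterS nW => v /= Wv.
  by rewrite -ym sprayE sheet_sectionK.
- by case: dL.
move=> dF dFE; split; first exact: dF.
move=> w; have [v vw] := sp_dominating y w; exists (c v).
rewrite -vw; have [_ dLE] := dL.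
transitivity ('d (sp y \o L) 0 (c v)).
  exact: (congr1 (fun g : V -> V => g (c v)) dFE).
transitivity (('d (sp y) 0 \o L) (c v)).
  exact: (congr1 (fun g : V -> V => g (c v)) dLE).
by congr ('d (sp y) 0 _); exact: cK.
Qed.

End ellipticity.

(** * The complex exponential *)

Section real_estimates.
Context {R : realType}.
Implicit Types x b : R.

Lemma mean_value0 (f f' : R -> R) x : (forall y : R, is_derive y 1 f (f' y)) ->
  exists2 c, `|c| <= `|x| & f x - f 0 = f' c * x.
Proof.
move=> df.
have cf a b : {within `[a, b], continuous f}.
  apply: continuous_subspaceT => y; apply: differentiable_continuous.
  by apply/derivable1_diffP; case: (df y).
have [x0|x0|->] := ltgtP x 0; last by exists 0; rewrite // subrr mulr0.
  have [c] := MVT x0 (fun y _ => df y) (cf _ _); rewrite in_itv /= => /andP[xc c0] e.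
  exists c; first by rewrite !ltr0_norm//; lra.
  by apply: oppr_inj; rewrite opprB e; ring.
have [c] := MVT x0 (fun y _ => df y) (cf _ _); rewrite in_itv /= => /andP[xc c0] e.
exists c; first by rewrite !gtr0_norm//; lra.
by rewrite e subr0.
Qed.

Lemma norm_sin_le x : `|sin x| <= `|x|.
Proof.
have [c _] := mean_value0 x (@is_derive_sin R); rewrite sin0 subr0 => ->.
by rewrite normrM ler_piMl// cos_max.
Qed.

Lemma norm_cos_sub1_le x : `|cos x - 1| <= `|x| ^+ 2.
Proof.
have [c cx] := mean_value0 x (@is_derive_cos R); rewrite cos0 => ->.
rewrite normrM normrN expr2 ler_wpM2r//; exact: le_trans (norm_sin_le c) cx.
Qed.

Lemma norm_sin_sub_le x b : `|x| <= b -> `|sin x - x| <= b * `|x| ^+ 2.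
Proof.
move=> xb.
have [c cx] : exists2 c, `|c| <= `|x| & (sin x - x) - (sin 0 - 0) = (cos c - 1) * x.
  by apply: (@mean_value0 (fun y => sin y - y) (fun y => cos y - 1)) => y; apply: is_deriveB.
rewrite sin0 !subr0 => ->; rewrite normrM.
have c2 := norm_cos_sub1_le c.
have : `|c| ^+ 2 <= `|x| ^+ 2 by rewrite lerXn2r ?nnegrE.
have := normr_ge0 x; have := sqr_ge0 `|x|; have := normr_ge0 (cos c - 1); nra.
Qed.

Lemma norm_expR_sub1_le x b : `|x| <= b -> `|expR x - 1| <= expR b * `|x|.
Proof.
move=> xb; have [c cx] := mean_value0 x (@is_derive_expR R); rewrite expR0 => ->.
rewrite normrM ler_wpM2r// ger0_norm ?expR_ge0// ler_expR.
by rewrite (le_trans (ler_norm _))// (le_trans cx).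
Qed.

Lemma norm_expR_sub_le x b : `|x| <= b -> `|expR x - 1 - x| <= expR b * `|x| ^+ 2.
Proof.
move=> xb.
have [c cx] : exists2 c, `|c| <= `|x| & (expR x - x) - (expR 0 - 0) = (expR c - 1) * x.
  by apply: (@mean_value0 (fun y => expR y - y) (fun y => expR y - 1)) => y; apply: is_deriveB.
rewrite expR0 subr0 => e; rewrite (_ : _ - _ - _ = (expR c - 1) * x); last first.
  by rewrite -e; ring.
rewrite normrM expr2 mulrA ler_wpM2r//.
apply: le_trans (norm_expR_sub1_le (le_trans cx xb)) _.
by rewrite ler_wpM2l// expR_ge0.
Qed.

End real_estimates.

Section complex_exponential.
Context {R : realType}.
Local Notation C := (complex_numbers R).
Implicit Types z w : C.

Definition cexp z : C :=
  toC (expR (complex.Re z)) * (cos (complex.Im z) +i* sin (complex.Im z))%C.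

Lemma cexp0 : cexp 0 = 1.
Proof.
rewrite /cexp /= expR0 cos0 sin0.
by apply/eqP; rewrite eq_complex /=; apply/andP; split; apply/eqP; ring.
Qed.

Lemma cexpD z w : cexp (z + w) = cexp z * cexp w.
Proof.
case: z => a b; case: w => c d; rewrite /cexp /= expRD sinD cosD.
by apply/eqP; rewrite eq_complex /=; apply/andP; split; apply/eqP; ring.
Qed.

Lemma norm_complex_le (a b : R) : `|(a +i* b)%C : C| <= toC (`|a| + `|b|).
Proof.
rewrite (_ : (a +i* b)%C = toC a + 'i%C * toC b); last first.
  by apply/eqP; rewrite eq_complex /=; apply/andP; split; apply/eqP; ring.
apply: (le_trans (ler_normD _ _)); rewrite normrM !norm_toC.
rewrite (_ : `|'i%C| = 1 :> C); last first.
  by rewrite normc_def /= expr0n /= expr1n add0r sqrtr1.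
by rewrite mul1r -toCD.
Qed.

Lemma norm_cis (t : R) : `|(cos t +i* sin t)%C : C| = 1.
Proof. by rewrite normc_def /= cos2Dsin2 sqrtr1. Qed.

Lemma norm_cexp z : `|cexp z| = toC (expR (complex.Re z)).
Proof.
by rewrite /cexp normrM norm_cis mulr1 norm_toC ger0_norm ?expR_ge0.
Qed.

Lemma cexp_neq0 z : cexp z != 0.
Proof.
by rewrite -normr_eq0 norm_cexp -[0]/(toC 0) /toC (inj_eq (@complexI _)) expR_eq0.
Qed.

Lemma cexpN z : cexp (- z) = (cexp z)^-1.
Proof.
by apply: (mulIf (cexp_neq0 z)); rewrite mulVf ?cexp_neq0// -cexpD addNr cexp0.
Qed.

Lemma norm_Re z : toC `|complex.Re z| <= `|z|.
Proof. by rewrite /toC; exact: normc_ge_Re. Qed.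

Lemma norm_Im z : toC `|complex.Im z| <= `|z|.
Proof.
rewrite (_ : complex.Im z = - complex.Re (z * 'i%C)); last first.
  by case: z => a b /=; ring.
rewrite normrN (le_trans (norm_Re _))// normrM.
rewrite (_ : `|'i%C| = 1 :> C) ?mulr1//.
by rewrite normc_def /= expr0n /= expr1n add0r sqrtr1.
Qed.

Lemma norm_toC_Re z : `|z| = toC (complex.Re `|z|).
Proof. by apply: real_toC; rewrite normr_real. Qed.

Lemma cexp_bound (b : R) z : `|z| <= toC b -> `|cexp z| <= toC (expR b).
Proof.
move=> zb; rewrite norm_cexp toC_ler ler_expR (le_trans (ler_norm _))//.
by rewrite -toC_ler (le_trans (norm_Re z)).
Qed.

(** The second-order Taylor estimates of the real exponential, sine and cosine, combined
    in real and imaginary parts. *)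
Lemma cexp_estimate (b : R) : exists B : R, forall z, `|z| <= toC b ->
  `|cexp z - 1 - z| <= toC B * `|z| ^+ 2.
Proof.
exists (expR b * (b + 3)) => z zb.
have zx := norm_Re z; have zy := norm_Im z.
rewrite norm_toC_Re in zb zx zy *.
set r := complex.Re `|z| in zb zx zy *.
rewrite !toC_ler in zb zx zy.
rewrite expr2 -!toCM; set x := complex.Re z in zx; set y := complex.Im z in zy.
have -> : cexp z - 1 - z = ((expR x - 1 - x + expR x * (cos y - 1)) +i*
     (expR x * (sin y - y) + (expR x - 1) * y))%C.
  rewrite /x /y; case: (z) => u v; rewrite /cexp /=.
  by apply/eqP; rewrite eq_complex /=; apply/andP; split; apply/eqP; ring.
apply: (le_trans (norm_complex_le _ _)); rewrite toC_ler.
have xb := le_trans zx zb; have yb := le_trans zy zb.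
have e1 := norm_expR_sub_le xb; have e2 := norm_expR_sub1_le xb.
have c1 := norm_cos_sub1_le y; have s1 := norm_sin_sub_le yb.
have ex : expR x <= expR b by rewrite ler_expR (le_trans (ler_norm _)).
have ex0 := expR_ge0 x.
have x0 := normr_ge0 x; have y0 := normr_ge0 y.
have x2 : `|x| ^+ 2 <= r * r by rewrite -expr2 lerXn2r ?nnegrE// (le_trans x0).
have y2 : `|y| ^+ 2 <= r * r by rewrite -expr2 lerXn2r ?nnegrE// (le_trans y0).
have xy : `|x| * `|y| <= r * r by apply: ler_pM.
have b0 : 0 <= b := le_trans y0 yb.
have t1 : `|expR x - 1 - x| <= expR b * (r * r).
  by rewrite (le_trans e1)// ler_wpM2l// expR_ge0.
have t2 : `|expR x * (cos y - 1)| <= expR b * (r * r).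
  by rewrite normrM (ger0_norm ex0) ler_pM// (le_trans c1).
have t3 : `|expR x * (sin y - y)| <= expR b * (b * (r * r)).
  rewrite normrM (ger0_norm ex0) ler_pM// (le_trans s1)//.
  by rewrite ler_wpM2l.
have t4 : `|(expR x - 1) * y| <= expR b * (r * r).
  rewrite normrM (le_trans (ler_wpM2r y0 e2))// -mulrA.
  by apply: ler_wpM2l; [exact: expR_ge0|exact: xy].
have := ler_normD (expR x - 1 - x) (expR x * (cos y - 1)).
have := ler_normD (expR x * (sin y - y)) ((expR x - 1) * y).
lra.
Qed.

Lemma cexp_natmul z n : cexp (z *+ n) = cexp z ^+ n.
Proof. by elim: n => [|n IH]; rewrite ?cexp0// mulrS exprS cexpD IH. Qed.

Definition itwopi : C := (0 +i* (pi *+ 2))%C.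

(** $e^{2 \pi i z}$, of period $1$. *)
Definition e z : C := cexp (itwopi * z).

Lemma eD z w : e (z + w) = e z * e w.
Proof. by rewrite /e mulrDr cexpD. Qed.

Lemma e_neq0 z : e z != 0.
Proof. exact: cexp_neq0. Qed.

Lemma e0 : e 0 = 1.
Proof. by rewrite /e mulr0 cexp0. Qed.

Lemma eN z : e (- z) = (e z)^-1.
Proof. by rewrite /e mulrN cexpN. Qed.

Lemma e_natmul z n : e (z *+ n) = e z ^+ n.
Proof. by rewrite /e mulrnAr cexp_natmul. Qed.

Lemma e1 : e 1 = 1.
Proof.
rewrite /e mulr1 /cexp /= expR0 cos2pi sin2pi.
by apply/eqP; rewrite eq_complex /=; apply/andP; split; apply/eqP; ring.
Qed.

Lemma e_int (k : int) : e (toC k%:~R) = 1.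
Proof.
have en n : e n%:R = 1 by rewrite e_natmul e1 expr1n.
case: k => n; first by rewrite -pmulrn [toC _](rmorph_nat (real_complex R)) en.
by rewrite NegzE -nmulrn [toC _](rmorphN (real_complex R)) eN
  (rmorph_nat (real_complex R)) en invr1.
Qed.

Lemma e_real (t : R) : e (toC t) = (cos (pi *+ 2 * t) +i* sin (pi *+ 2 * t))%C.
Proof.
rewrite /e (_ : itwopi * toC t = (0 +i* (pi *+ 2 * t))%C); last first.
  by apply/eqP; rewrite eq_complex /=; apply/andP; split; apply/eqP; ring.
rewrite /cexp /= expR0.
by apply/eqP; rewrite eq_complex /=; apply/andP; split; apply/eqP; ring.
Qed.

(** The modulus forces [z] to be real; subtracting the integral part leaves $t$ with $0
    \leq t < 1$ and $\cos(2 \pi t) = 1$, hence $\sin(\pi t) = 0$ and $t = 0$. *)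
Lemma e_eq1 z : e z = 1 -> exists k : int, z = toC k%:~R.
Proof.
move=> ez; have ez1 : `|e z| = 1 by rewrite ez normr1.
have z0 : complex.Im z = 0.
  move: ez1; rewrite norm_cexp -[1]/(toC 1) /toC => /complexI/eqP.
  rewrite -expR0 (inj_eq (@expR_inj R)).
  case: z {ez} => a b /=; rewrite mul0r sub0r oppr_eq0 mulf_eq0 => /orP[|/eqP//].
  by rewrite mulrn_eq0 /= gt_eqF ?pi_gt0.
pose x := complex.Re z; pose k := Num.floor x.
have zx : z = toC x by rewrite /x; case: z z0 {ez ez1 x k} => a b /= ->.
exists k; rewrite zx; congr toC; apply/eqP; rewrite -subr_eq0; apply/eqP.
pose t := x - k%:~R; rewrite -/t.
have t01 : 0 <= t < 1.
  by have := floor_itv x; rewrite -/k intrD /t; lra.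
have et : e (toC t) = 1 by rewrite /t toCB eD eN e_int invr1 mulr1 -zx.
have : cos (pi * t *+ 2) = 1.
  by move: et; rewrite e_real => /(congr1 (@complex.Re R)); rewrite -mulrnAl.
rewrite cos_mulr2n => c1.
have /eqP : sin (pi * t) ^+ 2 = 0 by rewrite sin2cos2; lra.
rewrite sqrf_eq0 => /eqP s0; apply/eqP; apply: contraT => tn0.
have : 0 < sin (pi * t); last by rewrite s0 ltxx.
apply: sin_gt0_pi; have pi0 := @pi_gt0 R.
have t0 : 0 < t by rewrite lt_neqAle eq_sym tn0; case/andP: t01.
by rewrite mulr_gt0//= -[X in _ < X]mulr1 ltr_pM2l//; case/andP: t01.
Qed.

Lemma norm_e_real (a : R) : `|e (toC a)| = 1.
Proof. by rewrite e_real norm_cis. Qed.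

Lemma e_bound (b : R) z : `|z| <= toC b -> `|e z| <= toC (expR (pi *+ 2 * b)).
Proof.
move=> zb; apply: cexp_bound; rewrite normrM toCM ler_pM//.
have p0 : (0 : R) <= pi *+ 2 by rewrite mulrn_wge0// pi_ge0.
by rewrite (le_trans (norm_complex_le _ _))// normr0 add0r ger0_norm.
Qed.

End complex_exponential.

(** * Quantitative differentiability *)

Section real_norm.
Context {R : realType}.
Local Notation C := (complex_numbers R).
Context {W : normedModType C}.
Implicit Types x y : W.

(** The norm of a complex normed space takes its values in the complex numbers;
    estimates are made with this real number, in a total order. *)
Definition rn x : R := complex.Re `|x|.

Lemma norm_rn x : `|x| = toC (rn x).
Proof. by apply: real_toC; rewrite normr_real. Qed.

Lemma rn_ge0 x : 0 <= rn x.
Proof. by rewrite -toC_ler -norm_rn; exact: normr_ge0. Qed.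

Lemma rnD x y : rn (x + y) <= rn x + rn y.
Proof. by rewrite -toC_ler toCD -!norm_rn ler_normD. Qed.

Lemma rnN x : rn (- x) = rn x.
Proof. by rewrite /rn normrN. Qed.

Lemma rnB x y : rn (x - y) <= rn x + rn y.
Proof. by rewrite (le_trans (rnD _ _))// rnN. Qed.

Lemma rn0 : rn 0 = 0.
Proof. by rewrite /rn normr0. Qed.

Lemma rn_sym x y : rn (x - y) = rn (y - x).
Proof. by rewrite -rnN opprB. Qed.

End real_norm.

Section real_norm_scalar.
Context {R : realType}.
Local Notation C := (complex_numbers R).

Lemma rnM (a b : C) : rn (a * b) = rn a * rn b.
Proof. by apply: (@complexI R); rewrite -[LHS]norm_rn normrM !norm_rn -toCM. Qed.

Lemma rn_toC (u : R) : rn (toC u) = `|u|.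
Proof. by rewrite /rn norm_toC. Qed.

Lemma rn_le (a : C) (b : R) : (`|a| <= toC b) = (rn a <= b).
Proof. by rewrite norm_rn toC_ler. Qed.

Lemma rn_le0 (a : C) : rn a <= 0 -> a = 0.
Proof.
move=> a0; apply/eqP; rewrite -normr_eq0 norm_rn.
by have -> : rn a = 0 by apply/eqP; rewrite eq_le a0 rn_ge0.
Qed.

Lemma nbhs_rn {W : normedModType C} (x : W) (A : set W) :
  nbhs x A <-> exists2 r : R, 0 < r & forall y, rn (y - x) < r -> A y.
Proof.
split=> [/nbhs_ballP[d /= d0 dA]|[r r0 rA]].
  have dr := real_toC (gtr0_real d0).
  exists (complex.Re d); first by move: d0; rewrite {1}dr (toC_ltr 0).
  move=> y yx; apply: dA; rewrite -ball_normE /= dr.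
  by rewrite norm_rn toC_ltr rn_sym.
apply/nbhs_ballP; exists (toC r) => /=; first by rewrite (toC_ltr 0).
by move=> y; rewrite -ball_normE /= norm_rn toC_ltr rn_sym; exact: rA.
Qed.

Lemma norm_cvg_le (u : nat -> C) (l : C) (b : R) N :
  u @ \oo --> l -> (forall n, (N <= n)%N -> rn (u n) <= b) -> rn l <= b.
Proof.
move=> ul ub; rewrite leNgt; apply/negP => bl.
have : nbhs l [set z | rn (z - l) < rn l - b].
  by apply/nbhs_rn; exists (rn l - b) => //; rewrite subr_gt0.
move=> /ul [M _ /(_ (maxn M N))] /=; rewrite leq_maxl => /(_ isT) uMN.
have := ub (maxn M N) (leq_maxr _ _).
have := rnB (u (maxn M N)) (u (maxn M N) - l).
by rewrite opprB addrCA subrr addr0; lra.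
Qed.

Lemma half_pow_gt0 n : 0 < (2^-1 : R) ^+ n.
Proof. by rewrite exprn_gt0// invr_gt0. Qed.

(** The intervals of centre $v_n$ and radius $2 B 2^{-n}$ are nested from rank [N] on. *)
Lemma geometric_limit_real (v : nat -> R) (B : R) N : 0 <= B ->
  (forall n, (N <= n)%N -> `|v n.+1 - v n| <= B * 2^-1 ^+ n) ->
  exists l, forall n, (N <= n)%N -> `|v n - l| <= B * 2 * 2^-1 ^+ n.
Proof.
move=> B0 vB; pose a n := v (n + N)%N - B * 2 * 2^-1 ^+ (n + N).
pose b n := v (n + N)%N + B * 2 * 2^-1 ^+ (n + N).
have step n : a n <= a n.+1 /\ b n.+1 <= b n.
  have := vB (n + N)%N (leq_addl _ _); rewrite /a /b !addSn exprS ler_norml.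
  set h := B * _; rewrite !mulrA -(mulrA B 2 2^-1) divff ?pnatr_eq0// mulr1.
  by rewrite -/h (mulrAC B 2) -/h; lra.
have a_nd : {homo a : m n / (m <= n)%N >-> m <= n}.
  by apply/nondecreasing_seqP => n; have [] := step n.
have b_ni : {homo b : m n / (m <= n)%N >-> n <= m}.
  by apply/nonincreasing_seqP => n; have [] := step n.
have ab m n : a m <= b n.
  apply: (le_trans (a_nd _ _ (leq_maxl m n))).
  apply: le_trans (b_ni _ _ (leq_maxr m n)).
  rewrite /a /b; have := half_pow_gt0 (maxn m n + N).
  by set p := _ ^+ _ => p0; nra.
have nea : range a !=set0 by exists (a 0%N); exists 0%N.
have uba n : ubound (range a) (b n) by move=> _ [m _ <-].
exists (sup (range a)) => n Nn.
have e : n = (n - N + N)%N by rewrite subnK.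
have le1 : a (n - N)%N <= sup (range a).
  by apply: ub_le_sup; [exists (b 0%N)|exists (n - N)%N].
have le2 : sup (range a) <= b (n - N)%N by apply: ge_sup.
by move: le1 le2; rewrite /a /b -e ler_norml; lra.
Qed.

Lemma geometric_limit (u : nat -> C) (B : R) N : 0 <= B ->
  (forall n, (N <= n)%N -> rn (u n.+1 - u n) <= B * 2^-1 ^+ n) ->
  exists l : C, u @ \oo --> l.
Proof.
move=> B0 uB.
have re (z : C) : `|complex.Re z| <= rn z by rewrite -toC_ler -norm_rn; exact: norm_Re.
have im (z : C) : `|complex.Im z| <= rn z by rewrite -toC_ler -norm_rn; exact: norm_Im.
have [|a al] := @geometric_limit_real (fun n => complex.Re (u n)) B N B0.
  move=> n Nn; apply: le_trans (uB n Nn); apply: le_trans (re _).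
  by case: (u n.+1) (u n) => p q [p' q'].
have [|b bl] := @geometric_limit_real (fun n => complex.Im (u n)) B N B0.
  move=> n Nn; apply: le_trans (uB n Nn); apply: le_trans (im _).
  by case: (u n.+1) (u n) => p q [p' q'].
pose l : C := (a +i* b)%C; exists l => A lA.
have [r r0 rA] := (nbhs_rn l A).1 lA.
have [M Mr] : exists M, B * 4 * 2^-1 ^+ M < r.
  pose M := Num.bound (B * 4 / r); exists M.
  have BM : B * 4 / r < 2 ^+ M.
    apply: lt_trans (archi_boundP _) _; first by rewrite divr_ge0 ?mulr_ge0// ltW.
    by rewrite -natrX ltr_nat ltn_expl.
  by rewrite exprVn ltr_pdivrMr ?exprn_gt0// [r * _]mulrC -ltr_pdivrMr.
exists (maxn M N) => // n /=; rewrite geq_max => /andP[Mn Nn]; apply: rA.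
have h : (2^-1 : R) ^+ n <= 2^-1 ^+ M.
  by rewrite ler_wiXn2l// ?invr_ge0// invf_le1// ler1n.
have := al n Nn; have := bl n Nn; have p0 := half_pow_gt0 n.
have : rn (u n - l) <= `|complex.Re (u n) - a| + `|complex.Im (u n) - b|.
  by case: (u n) => p q; rewrite -rn_le; exact: norm_complex_le.
move: Mr h p0; set p := 2^-1 ^+ n; set p' := 2^-1 ^+ M; nra.
Qed.

End real_norm_scalar.

Section jets.
Context {R : realType}.
Local Notation C := (complex_numbers R).
Context {W : normedModType C}.
Implicit Types (f g : W -> C) (r M : R).

(** Control on a ball of the values, of the increments, of the differential and of the
    remainder of the first-order expansion. The four bounds together are stable under
    sums, products and pointwise limits, and the last two force the limit to be
    differentiable; so they take the place of the Cauchy estimates. *)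
Definition jet r M f := [/\ 0 <= M, forall x, differentiable f x &
  forall x y, rn x <= r -> rn y <= r ->
  [/\ rn (f x) <= M, rn (f y - f x) <= M * rn (y - x),
      forall h, rn ('d f x h) <= M * rn h &
      rn (f y - f x - 'd f x (y - x)) <= M * rn (y - x) ^+ 2]].

Lemma jet_le r r' M M' f : r' <= r -> M <= M' -> jet r M f -> jet r' M' f.
Proof.
move=> rr MM [M0 df bf]; split=> //; first exact: le_trans MM.
move=> x y xr yr.
have [b0 b1 b2 b3] := bf x y (le_trans xr rr) (le_trans yr rr).
split; first exact: le_trans MM.
- by rewrite (le_trans b1)// ler_wpM2r// rn_ge0.
- by move=> h; rewrite (le_trans (b2 h))// ler_wpM2r// rn_ge0.
- by rewrite (le_trans b3)// ler_wpM2r// exprn_ge0// rn_ge0.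
Qed.

Lemma is_diff_quadratic f (L : {linear W -> C}) x r M : 0 < r ->
  (forall h, rn (L h) <= M * rn h) ->
  (forall h, rn h <= r -> rn (f (h + x) - f x - L h) <= M * rn h ^+ 2) ->
  is_diff x f L.
Proof.
move=> r0 LM fM.
pose M' := `|M| + 1; have M0 : 0 < M' by rewrite ltr_wpDl.
have MM : M <= M' by rewrite (le_trans (ler_norm _))// lerDl.
apply: is_diffI.
  apply: bounded_linear_continuous; apply/linear_boundedP.
  exists (toC M'); split; first by rewrite realE (toC_ler 0) ltW.
  move=> K MK x'; rewrite (le_trans (_ : _ <= toC M' * `|x'|))//.
    by rewrite !norm_rn -toCM toC_ler (le_trans (LM _))// ler_wpM2r// rn_ge0.
  by rewrite ler_wpM2r// ltW.
move=> eps eps0; have er := real_toC (gtr0_real eps0).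
have {}eps0 : 0 < complex.Re eps by move: eps0; rewrite {1}er (toC_ltr 0).
apply/nbhs_rn; exists (Num.min r (complex.Re eps / M')).
  by rewrite lt_min r0 divr_gt0.
move=> h; rewrite subr0 lt_min => /andP[hr he] /=.
rewrite er !norm_rn -toCM toC_ler opprD addrA.
apply: le_trans (fM _ (ltW hr)) _; rewrite expr2 mulrA ler_wpM2r ?rn_ge0//.
move: he; rewrite ltr_pdivlMr// => he; have := rn_ge0 h; nra.
Qed.

Lemma jet_cst r (c : C) : jet r (rn c) (fun=> c).
Proof.
have dc x : differentiable (fun=> c : C) x by exact: differentiable_cst.
split=> //; first exact: rn_ge0.
move=> x y _ _; have d0 h : 'd (fun=> c) x h = 0.
  by have := @diff_cst _ W _ c x => /(congr1 (fun k => k h)).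
split=> //; rewrite ?d0 ?subrr ?subr0 ?rn0 ?mulr_ge0 ?rn_ge0 ?exprn_ge0 ?rn_ge0//.
by move=> h; rewrite d0 rn0 mulr_ge0// rn_ge0.
Qed.

Let remainderD (a a' b b' p q : C) :
  (a' + b') - (a + b) - (p + q) = (a' - a - p) + (b' - b - q).
Proof. by ring. Qed.

Let remainderM (a a' b b' p q : C) :
  a' * b' - a * b - (a * q + b * p) =
  (b' - b - q) * a + (a' - a - p) * b + (a' - a) * (b' - b).
Proof. by ring. Qed.

Lemma jetD r M M' f g : jet r M f -> jet r M' g -> jet r (M + M') (fun x => f x + g x).
Proof.
move=> [M0 df bf] [M0' dg bg]; split; first exact: addr_ge0.
  by move=> x; apply: (@differentiableD _ _ _ f g).
move=> x y xr yr; have [a0 a1 a2 a3] := bf x y xr yr; have [b0 b1 b2 b3] := bg x y xr yr.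
have dfg h : 'd (fun x => f x + g x) x h = 'd f x h + 'd g x h.
  by have := diffD (df x) (dg x) => /(congr1 (fun k => k h)).
split.
- exact: le_trans (rnD _ _) (lerD a0 b0).
- rewrite (_ : _ - _ = (f y - f x) + (g y - g x)); last by ring.
  by rewrite mulrDl; exact: le_trans (rnD _ _) (lerD a1 b1).
- by move=> h; rewrite dfg mulrDl; exact: le_trans (rnD _ _) (lerD (a2 h) (b2 h)).
- rewrite dfg remainderD mulrDl.
  exact: le_trans (rnD _ _) (lerD a3 b3).
Qed.

Let le_triple1 (p : R) : 0 <= p -> p <= 3 * p.
Proof. by lra. Qed.

Let le_triple2 (p k X Y : R) : 0 <= p -> 0 <= k -> X <= p * k -> Y <= p * k ->
  X + Y <= 3 * p * k.
Proof. by nra. Qed.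

Let le_triple3 (p k X Y Z : R) : X <= p * k -> Y <= p * k -> Z <= p * k ->
  X + Y + Z <= 3 * p * k.
Proof. by lra. Qed.

(** Each bound for the product has at most three terms, of size at most $M M'$. *)
Lemma jetM r M M' f g : jet r M f -> jet r M' g ->
  jet r (3 * (M * M')) (fun x => f x * g x).
Proof.
move=> [M0 df bf] [M0' dg bg]; split; first by rewrite !mulr_ge0.
  by move=> x; apply: (@differentiableM _ _ f g).
move=> x y xr yr; have [a0 a1 a2 a3] := bf x y xr yr; have [b0 b1 b2 b3] := bg x y xr yr.
have [a0' _ _ _] := bf y x yr xr; have [b0' _ _ _] := bg y x yr xr.
have dfg h : 'd (fun x => f x * g x) x h = f x * 'd g x h + g x * 'd f x h.
  by have := diffM (df x) (dg x) => /(congr1 (fun k => k h)).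
have MM : 0 <= M * M' by exact: mulr_ge0.
have rM (a b : C) (p s k : R) : rn a <= p * k -> rn b <= s -> rn (a * b) <= p * s * k.
  by move=> ap bs; rewrite rnM mulrAC ler_pM// rn_ge0.
split.
- rewrite rnM; apply: le_trans (le_triple1 MM).
  by apply: ler_pM; rewrite ?rn_ge0.
- rewrite (_ : _ - _ = (f y - f x) * g y + (g y - g x) * f x); last by ring.
  apply: (le_trans (rnD _ _)); apply: le_triple2 => //; first exact: rn_ge0.
    exact: rM a1 b0'.
  by rewrite (mulrC M); exact: rM b1 a0.
- move=> h; rewrite dfg; apply: (le_trans (rnD _ _)).
  rewrite (mulrC (f x)) (mulrC (g x)); apply: le_triple2 => //; first exact: rn_ge0.
    by rewrite (mulrC M); exact: rM (b2 h) a0.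
  exact: rM (a2 h) b0.
- rewrite dfg remainderM.
  apply: (le_trans (rnD _ _)); apply: (le_trans (lerD (rnD _ _) (lexx _))).
  apply: le_triple3.
  + by rewrite (mulrC M); exact: rM b3 a0.
  + exact: rM a3 b0.
  + by rewrite rnM expr2 mulrACA ler_pM ?rn_ge0.
Qed.

Lemma jetN r M f : jet r M f -> jet r (3 * M) (fun x => - f x).
Proof.
have r1 : rn (- 1 : C) = 1 by rewrite rnN /rn normr1.
move=> jf; have := jetM (jet_cst r (-1)) jf; rewrite r1 mul1r.
by under [X in jet _ _ X]eq_fun do rewrite mulN1r.
Qed.

(** The functions from which the construction is built are all of this kind: they are
    entire, with bounds on every ball. *)
Definition jet_bounded f := forall r, 0 <= r -> exists M, jet r M f.

Lemma jet_bounded_linear (L : {linear W -> C}) :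
  (forall x : W, rn (L x) <= rn x) -> jet_bounded L.
Proof.
move=> L1 r r0; exists (r + 1).
have dL x : is_diff x L L.
  apply: (@is_diff_quadratic _ _ _ 1 1); first exact: ltr01.
    by move=> h; rewrite mul1r.
  by move=> h _; rewrite linearD addrK subrr rn0 mulr_ge0// exprn_ge0// rn_ge0.
split; [by lra|by move=> x; case: (dL x)|move=> x y xr yr].
have dLE h : 'd L x h = L h by have [_ /(congr1 (fun k => k h))] := dL x.
split.
- by rewrite (le_trans (L1 x))//; lra.
- by rewrite -linearB (le_trans (L1 _))// ler_peMl ?rn_ge0//; lra.
- by move=> h; rewrite dLE (le_trans (L1 _))// ler_peMl ?rn_ge0//; lra.
- by rewrite dLE -linearB subrr rn0 mulr_ge0 ?exprn_ge0 ?rn_ge0//; lra.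
Qed.

(** The value at $x + h$ is that at $x$ times $e^{c L h}$, so the expansion at any point
    reduces to that of the exponential at $0$. *)
Lemma jet_bounded_cexp (L : {linear W -> C}) (c : C) : (forall x : W, rn (L x) <= rn x) ->
  jet_bounded (fun x => cexp (c * L x)).
Proof.
move=> L1 r r0; pose f (x : W) : C := cexp (c * L x); rewrite -/f.
pose P := expR (rn c * r); have P0 : 0 <= P by exact: expR_ge0.
have fP x : rn x <= r -> rn (f x) <= P.
  move=> xr; rewrite -rn_le; apply: cexp_bound; rewrite rn_le rnM.
  by rewrite ler_wpM2l ?rn_ge0// (le_trans (L1 x)).
have linL x : linear (fun h => f x * (c * L h)).
  move=> a u v; rewrite linearP.
  change (f x * (c * (a * L u + L v)) = a * (f x * (c * L u)) + f x * (c * L v)).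
  by ring.
pose D x : {linear W -> C} := HB.pack (fun h : W => f x * (c * L h))
  (GRing.isLinear.Build _ _ _ _ _ (linL x)).
have Df x h : rn (D x h) <= rn (f x) * rn c * rn h.
  by rewrite /= !rnM mulrA ler_wpM2l ?mulr_ge0 ?rn_ge0.
have quad (s : R) : exists2 B : R, 0 <= B & forall x h, rn h <= s ->
    rn (f (h + x) - f x - D x h) <= rn (f x) * B * rn h ^+ 2.
  have [B Be] := @cexp_estimate R (rn c * s).
  exists (`|B| * rn c ^+ 2); first by rewrite mulr_ge0// exprn_ge0// rn_ge0.
  move=> x h hs.
  rewrite (_ : _ - _ = f x * (cexp (c * L h) - 1 - c * L h)); last first.
    by rewrite (_ : f (h + x) = cexp (c * L h) * f x) /=;
      [ring|rewrite /f linearD mulrDr cexpD].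
  rewrite rnM -mulrA ler_wpM2l ?rn_ge0//.
  have cLh : rn (c * L h) <= rn c * rn h.
    by rewrite rnM ler_wpM2l ?rn_ge0.
  have : rn (cexp (c * L h) - 1 - c * L h) <= B * rn (c * L h) ^+ 2.
    have := Be (c * L h); rewrite !norm_rn toC_ler.
    rewrite expr2 -!toCM toC_ler -expr2; apply.
    by rewrite (le_trans cLh)// ler_wpM2l ?rn_ge0.
  move=> H; apply: (le_trans H); rewrite -mulrA -exprMn.
  apply: (le_trans (ler_wpM2r _ (ler_norm B))); first by rewrite exprn_ge0// rn_ge0.
  by rewrite ler_wpM2l// lerXn2r// nnegrE ?mulr_ge0 ?rn_ge0.
have df x : is_diff x f (D x).
  have [B B0 Bf] := quad 1.
  apply: (@is_diff_quadratic _ _ _ 1 (rn (f x) * rn c + rn (f x) * B)) => //.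
    move=> h; rewrite (le_trans (Df x h))// ler_wpM2r ?rn_ge0//.
    by rewrite lerDl mulr_ge0 ?rn_ge0.
  move=> h h1; rewrite (le_trans (Bf x h h1))// ler_wpM2r ?exprn_ge0 ?rn_ge0//.
  by rewrite lerDr mulr_ge0 ?rn_ge0.
have [B B0 Bf] := quad (r + r).
have cP : 0 <= P * rn c by rewrite mulr_ge0 ?rn_ge0.
have BP : 0 <= P * B by rewrite mulr_ge0.
have BPr : 0 <= P * B * (r + r) by rewrite mulr_ge0 ?addr_ge0.
exists (P + P * rn c + P * B + P * B * (r + r)); split; first by lra.
  by move=> x; case: (df x).
move=> x y xr yr; have dE h : 'd f x h = D x h.
  by have [_ /(congr1 (fun k => k h))] := df x.
have yx0 := rn_ge0 (y - x).
have yxr : rn (y - x) <= r + r by rewrite (le_trans (rnB _ _))// lerD.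
have DP h : rn (D x h) <= P * rn c * rn h.
  by rewrite (le_trans (Df x h))// ler_wpM2r ?rn_ge0// ler_wpM2r ?rn_ge0// fP.
have rem : rn (f y - f x - D x (y - x)) <= P * B * rn (y - x) ^+ 2.
  have := Bf x (y - x) yxr; rewrite subrK => H; apply: (le_trans H).
  by rewrite ler_wpM2r ?exprn_ge0// ler_wpM2r// fP.
split.
- by rewrite (le_trans (fP x xr))//; lra.
- have -> : f y - f x = (f y - f x - D x (y - x)) + D x (y - x) by rewrite subrK.
  apply: (le_trans (rnD _ _)); have := DP (y - x).
  have : P * B * rn (y - x) ^+ 2 <= P * B * (r + r) * rn (y - x).
    by rewrite expr2 mulrA ler_wpM2r// ler_wpM2l.
  by move: rem (mulr_ge0 BP yx0) (mulr_ge0 P0 yx0); lra.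
- move=> h; rewrite dE (le_trans (DP h))// ler_wpM2r ?rn_ge0//; lra.
- rewrite dE (le_trans rem)// ler_wpM2r ?exprn_ge0//; lra.
Qed.

Lemma jet_bounded_cst c : jet_bounded (fun=> c).
Proof. by move=> r _; exists (rn c); exact: jet_cst. Qed.

Lemma jet_boundedD f g : jet_bounded f -> jet_bounded g -> jet_bounded (fun x => f x + g x).
Proof.
move=> nf ng r r0; have [M Mf] := nf r r0; have [M' Mg] := ng r r0.
by exists (M + M'); exact: jetD.
Qed.

Lemma jet_boundedM f g : jet_bounded f -> jet_bounded g -> jet_bounded (fun x => f x * g x).
Proof.
move=> nf ng r r0; have [M Mf] := nf r r0; have [M' Mg] := ng r r0.
by exists (3 * (M * M')); exact: jetM.
Qed.

Lemma jet_boundedN f : jet_bounded f -> jet_bounded (fun x => - f x).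
Proof. by move=> nf r r0; have [M Mf] := nf r r0; exists (3 * M); exact: jetN. Qed.

Lemma jet_boundedB f g : jet_bounded f -> jet_bounded g -> jet_bounded (fun x => f x - g x).
Proof. by move=> nf /jet_boundedN; exact: jet_boundedD. Qed.

Lemma jet_bounded_sum n (F : nat -> W -> C) : (forall j, (j < n)%N -> jet_bounded (F j)) ->
  jet_bounded (fun x => \sum_(j < n) F j x).
Proof.
elim: n => [|n IH] nF.
  rewrite (_ : (fun x => _) = fun=> 0); first exact: jet_bounded_cst.
  by apply/funext => x; rewrite big_ord0.
rewrite (_ : (fun x => _) = fun x => \sum_(j < n) F j x + F n x).
  by apply: jet_boundedD; [apply: IH => j jn; apply: nF; exact: ltnW|exact: nF].
by apply/funext => x; rewrite big_ord_recr.
Qed.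

End jets.

(** * Limits and perturbations *)

Section jet_limits.
Context {R : realType}.
Local Notation C := (complex_numbers R).
Context {W : normedModType C}.

(** On each ball the differences are summable in the sense of [jet], so the functions
    and their differentials converge and have common bounds on the ball; the quadratic
    bound on the remainder passes to the limit and shows that the limit of the
    differentials is the differential of the limit. *)
Lemma jet_limit (F : nat -> W -> C) : (forall n, jet_bounded (F n)) ->
  (forall n, jet n%:R (2^-1 ^+ n) (fun x => F n.+1 x - F n x)) ->
  exists2 f : W -> C, (forall x, (fun n => F n x) @ \oo --> f x) &
    forall x, differentiable f x.
Proof.
move=> nF jF.
have big x n : (Num.bound (rn x) <= n)%N -> rn x <= n%:R :> R.
  move=> xn; apply/ltW/(lt_le_trans (archi_boundP (rn_ge0 x))).
  by rewrite ler_nat.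
have dF n x : differentiable (F n) x by have [M []] := nF n 0 (lexx 0).
have /choice[f fl] : forall x, exists l : C, (fun n => F n x) @ \oo --> l.
  move=> x; apply: (@geometric_limit _ _ 1 (Num.bound (rn x))) => // n /big xn.
  by rewrite mul1r; have [_ _ /(_ x x xn xn)[]] := jF n.
have dB n x h : 'd (fun x => F n.+1 x - F n x) x h = 'd (F n.+1) x h - 'd (F n) x h.
  by have := diffB (dF n.+1 x) (dF n x) => /(congr1 (fun k => k h)).
have /choice[D' Dl'] : forall p : W * W, exists l : C,
    (fun n => ('d (F n) (fst p)) (snd p) : C) @ \oo --> l.
  move=> [x h]; apply: (@geometric_limit _ _ (rn h) (Num.bound (rn x))).
    exact: rn_ge0.
  move=> n /big xn; rewrite -dB mulrC.
  by have [_ _ /(_ x x xn xn)[]] := jF n.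
pose D x h : C := D' (x, h).
have Dl x h : (fun n => 'd (F n) x h : C) @ \oo --> D x h by exact: (Dl' (x, h)).
exists f; first exact: fl.
move=> x.
have linD : linear (D x).
  move=> a u v; apply: (@cvg_unique _ (@norm_hausdorff _ C) _ _ _ _ (Dl x (a *: u + v))).
  rewrite (_ : (fun n => _) = (fun n => a * 'd (F n) x u + 'd (F n) x v)).
    by apply: cvgD (Dl x v); apply: cvgM (Dl x u); exact: cvg_cst.
  by apply/funext => n; rewrite linearP.
pose L : {linear W -> C} := HB.pack (D x) (GRing.isLinear.Build _ _ _ _ _ linD).
pose N := Num.bound (rn x + 1).
have xN : rn x + 1 <= N%:R :> R.
  by apply/ltW/archi_boundP; rewrite addr_ge0 ?rn_ge0.
have [M jN] := nF N N%:R (ler0n _ _).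
have jk k : jet N%:R (M + (2 - 2 * 2^-1 ^+ k)) (F (N + k)%N).
  elim: k => [|k IH]; first by rewrite expr0 mulr1 subrr addr0 addn0.
  rewrite addnS; have -> : F (N + k).+1 =
      (fun x => F (N + k)%N x + (F (N + k).+1 x - F (N + k)%N x)).
    by apply/funext => y; rewrite addrC subrK.
  have -> : M + (2 - 2 * 2^-1 ^+ k.+1) = M + (2 - 2 * 2^-1 ^+ k) + 2^-1 ^+ k :> R.
    by rewrite exprS mulrA divff ?pnatr_eq0//; ring.
  apply: jetD; first exact: IH.
  apply: jet_le (jF (N + k)%N); first by rewrite ler_nat leq_addr.
  by rewrite ler_wiXn2l ?leq_addl ?invr_ge0// invf_le1// ler1n.
have jn n : (N <= n)%N -> jet N%:R (M + 2) (F n).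
  move=> Nn; have := jk (n - N)%N; rewrite subnKC//; apply: jet_le; first exact: lexx.
  by rewrite lerD2l gerBl mulr_ge0// exprn_ge0// invr_ge0.
suff [] : is_diff x f L by [].
apply: (@is_diff_quadratic _ _ _ _ _ 1 (M + 2)); first exact: ltr01.
  move=> h.
  apply: norm_cvg_le (Dl x h) _ => n Nn; have [_ _ /(_ x x)] := jn n Nn.
  by case => //; lra.
move=> h h1; apply: (@norm_cvg_le _ (fun n => F n (h + x) - F n x - 'd (F n) x h) _ _ N).
  by apply: cvgB (Dl x h); apply: cvgB; exact: fl.
move=> n Nn; have [_ _ /(_ x (h + x))] := jn n Nn.
case; [by lra|by rewrite (le_trans (rnD _ _))//; lra|].
by move=> _ _ _; rewrite addrK.
Qed.

(** The calculus behind the estimate of a step: with $a = 1 / \varepsilon$ every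
    quantity in it is a family of this kind, the class is stable under sums and
    products, and a family with limit $0$ is as small as required on a given ball
    once $\varepsilon$ is small ([eps_close_small]). *)
Definition eps_close (v : R -> W -> C) (v0 : W -> C) :=
  forall r, 0 <= r -> exists2 B, jet r B v0 & forall eps, 0 < eps <= 1 ->
    jet r B (v eps) /\ jet r (eps * B) (fun x => v eps x - v0 x).

Lemma jet_ext r M (f g : W -> C) : f =1 g -> jet r M f -> jet r M g.
Proof. by move=> /funext->. Qed.

Lemma jet_ge0 r M (f : W -> C) : jet r M f -> 0 <= M.
Proof. by case. Qed.

Lemma eps_close_jet_bounded f : jet_bounded f -> eps_close (fun=> f) f.
Proof.
move=> nf r r0; have [B jf] := nf r r0; exists B; first exact: jf.
move=> eps /andP[e0 e1]; split; first exact: jf.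
apply: jet_ext (_ : jet r _ (fun=> 0)); first by move=> x; rewrite subrr.
apply: jet_le (jet_cst r 0); first exact: lexx.
by rewrite rn0 mulr_ge0 ?(jet_ge0 jf)// ltW.
Qed.

Lemma eps_closeD v v0 w w0 : eps_close v v0 -> eps_close w w0 ->
  eps_close (fun eps x => v eps x + w eps x) (fun x => v0 x + w0 x).
Proof.
move=> cv cw r r0; have [B jv bv] := cv r r0; have [B' jw bw] := cw r r0.
exists (B + B'); first exact: jetD.
move=> eps e01; have [v1 v2] := bv _ e01; have [w1 w2] := bw _ e01.
split; first exact: jetD.
rewrite mulrDr; apply: jet_ext (jetD v2 w2) => x; ring.
Qed.

Lemma eps_closeM v v0 w w0 : eps_close v v0 -> eps_close w w0 ->
  eps_close (fun eps x => v eps x * w eps x) (fun x => v0 x * w0 x).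
Proof.
move=> cv cw r r0; have [B jv bv] := cv r r0; have [B' jw bw] := cw r r0.
have [B0 B0'] := (jet_ge0 jv, jet_ge0 jw).
have BB : 0 <= B * B' by exact: mulr_ge0.
exists (6 * (B * B')); first by apply: jet_le (jetM jv jw) => //; lra.
move=> eps /[dup] /andP[e0 e1] e01; have [v1 v2] := bv _ e01; have [w1 w2] := bw _ e01.
split; first by apply: jet_le (jetM v1 w1) => //; lra.
have -> : eps * (6 * (B * B')) = 3 * (eps * B * B') + 3 * (B * (eps * B')) by ring.
apply: jet_ext (jetD (jetM v2 w1) (jetM jv w2)) => x; ring.
Qed.

Lemma eps_close_cst c : eps_close (fun _ _ => c) (fun _ => c).
Proof. exact/eps_close_jet_bounded/jet_bounded_cst. Qed.

Lemma eps_close_ext v v0 w w0 : (forall eps, 0 < eps <= 1 -> v eps =1 w eps) ->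
  v0 =1 w0 -> eps_close v v0 -> eps_close w w0.
Proof.
move=> vw /funext vw0 cv r r0; have [B jv bv] := cv r r0.
rewrite vw0 in jv bv; exists B; first exact: jv.
move=> eps e01.
by have /funext <- := vw _ e01; exact: bv.
Qed.

Lemma eps_closeX v v0 n : eps_close v v0 ->
  eps_close (fun eps x => v eps x ^+ n) (fun x => v0 x ^+ n).
Proof.
move=> cv; elim: n => [|n IH].
  by apply: eps_close_ext (eps_close_cst 1) => [eps _ x|x]; rewrite expr0.
by apply: eps_close_ext (eps_closeM cv IH) => [eps _ x|x]; rewrite exprS.
Qed.

Lemma eps_closeB v v0 w w0 : eps_close v v0 -> eps_close w w0 ->
  eps_close (fun eps x => v eps x - w eps x) (fun x => v0 x - w0 x).
Proof.
move=> cv cw.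
apply: eps_close_ext (eps_closeD cv (eps_closeM (eps_close_cst (-1)) cw));
  by [move=> eps _ x; rewrite mulN1r|move=> x; rewrite mulN1r].
Qed.

Lemma eps_close_scale v v0 : eps_close v v0 ->
  eps_close (fun eps x => toC eps * v eps x) (fun=> 0).
Proof.
move=> cv r r0; have [B jv bv] := cv r r0; have B0 := jet_ge0 jv.
exists (3 * B); first by apply: jet_le (jet_cst r 0) => //; rewrite rn0; lra.
move=> eps /[dup] /andP[e0 e1] e01; have [v1 v2] := bv _ e01.
have je : jet r (eps * (3 * B)) (fun x => toC eps * v eps x).
  have := jetM (jet_cst r (toC eps)) v1.
  by rewrite rn_toC (gtr0_norm e0) mulrCA; exact.
split; first by apply: jet_le je => //; nra.
by apply: jet_ext je => x; rewrite subr0.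
Qed.

Lemma eps_close_sum n (V : nat -> R -> W -> C) (V0 : nat -> W -> C) :
  (forall j, eps_close (V j) (V0 j)) ->
  eps_close (fun eps x => \sum_(j < n) V j eps x) (fun x => \sum_(j < n) V0 j x).
Proof.
move=> cV; elim: n => [|n IH].
  apply: eps_close_ext (eps_close_cst 0) => [eps _ x|x]; by rewrite big_ord0.
by apply: eps_close_ext (eps_closeD IH (cV n)) => [eps _ x|x]; rewrite big_ord_recr.
Qed.

Lemma eps_close_small v r b : 0 <= r -> 0 < b -> eps_close v (fun=> 0) ->
  exists2 d, 0 < d <= 1 & forall eps, 0 < eps <= d -> jet r b (v eps).
Proof.
move=> r0 b0 cv; have [B jv bv] := cv r r0; have B0 := jet_ge0 jv.
exists (Num.min 1 (b / (B + 1))).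
  by rewrite lt_min ltr01 ge_min lexx divr_gt0//=; lra.
move=> eps; rewrite le_min => /and3P[e0 e1 eb].
have [|_ j] := bv eps; first by rewrite e0 e1.
apply: jet_ext (jet_le (lexx _) _ j) => [x|]; first by rewrite subr0.
by move: eb; rewrite ler_pdivlMr; [nra|lra].
Qed.

End jet_limits.

(** * Cocycles and potentials *)

Section construction.
Context {R : realType}.
Local Notation C := (complex_numbers R).
Context (q : nat -> nat) (q_gt0 : forall n, (0 < q n)%N).
Implicit Types (A : nat -> R) (z w t y : C) (a b : R).

Definition level n : nat := \prod_(k < n) q k.

Lemma levelS n : level n.+1 = (level n * q n)%N.
Proof. by rewrite /level big_ord_recr. Qed.

Lemma level_gt0 n : (0 < level n)%N.
Proof. by elim: n => [|n IH]; rewrite ?levelS ?muln_gt0 ?IH ?q_gt0// /level big_ord0. Qed.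

Lemma dvdn_level m n : (m <= n)%N -> (level m %| level n)%N.
Proof.
move=> /subnKC <-; elim: (n - m)%N => [|k IH]; first by rewrite addn0.
by rewrite addnS levelS dvdn_mulr.
Qed.

(** The subgroup $\frac{1}{N_n} \mathbb{Z}$, where $N_n$ is [level n]. *)
Definition in_level n b := exists k : int, b *+ level n = k%:~R.

Lemma in_level_le m n b : (m <= n)%N -> in_level m b -> in_level n b.
Proof.
move=> /dvdn_level/dvdnP[p np] [k bk]; exists (k *+ p).
by rewrite np mulnC mulrnA bk -rmorphMn.
Qed.

Lemma in_levelD n a b : in_level n a -> in_level n b -> in_level n (a + b).
Proof. by move=> [k ak] [l bl]; exists (k + l); rewrite mulrnDl ak bl rmorphD. Qed.

Lemma in_levelN n a : in_level n a -> in_level n (- a).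
Proof. by move=> [k ak]; exists (- k); rewrite mulNrn ak rmorphN. Qed.

Definition zeta n z : C := e (z *+ level n).

Lemma zetaD n z w : zeta n (z + w) = zeta n z * zeta n w.
Proof. by rewrite /zeta mulrnDl eD. Qed.

Lemma zeta_neq0 n z : zeta n z != 0.
Proof. exact: e_neq0. Qed.

Lemma zetaN n z : zeta n (- z) = (zeta n z)^-1.
Proof. by rewrite /zeta mulNrn eN. Qed.

Lemma zetaS n z : zeta n.+1 z = zeta n z ^+ q n.
Proof. by rewrite /zeta levelS mulrnA -e_natmul. Qed.

Lemma toC_natmul a n : toC a *+ n = toC (a *+ n).
Proof. by elim: n => [//|n IH]; rewrite !mulrS toCD IH. Qed.

Lemma zeta_in_level m n b : (n <= m)%N -> in_level n b -> zeta m (toC b) = 1.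
Proof.
by move=> nm /(in_level_le nm)[k bk]; rewrite /zeta toC_natmul bk e_int.
Qed.

(** The displacement of the second coordinate under the element [b] of level [n]. *)
Definition cocycle A n b z : C :=
  \sum_(j < n) toC (A j) * (zeta j (z + toC b) - zeta j z).

(** Together with [zeta n z] this is a complete set of invariants, in the two
    coordinates that move, of the action of the elements of level [n]. *)
Definition reduced A n z w : C := w - \sum_(j < n) toC (A j) * zeta j z.

(** One step of Newton's method for the equation $x^{-m} = y$, starting from $- w / a$.
    If $y = \zeta^{-m}$ and $w + a \zeta$ is bounded, the starting point approximates
    $\zeta$ up to $O(1 / a)$, and the result up to $O(1 / a^2)$. It is a polynomial in
    $y$ and $w$, hence entire. *)
Definition newton m a y w : C :=
  let u := - (w / toC a) in u * (m.+1%:R - u ^+ m * y) / m%:R.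

(** The arguments [y] and [w] are the invariants of level [n]: the inverse of [zeta n],
    and [reduced]. Those of level $n - 1$ are not functions of them, but Newton's method
    approximates [zeta n.-1] by [z], and with it both invariants of level $n - 1$. The
    last term cancels, up to a small error, the term by which the sum in [potential]
    grows at this step. *)
Fixpoint correction A n y w t : C :=
  if n isn't n'.+1 then 0 else
  let z := newton (q n') (A n') y w in
  correction A n' (z ^+ (q n').-1 * y) (w + toC (A n') * z) t -
    toC (A n') * z * zeta n' t.

(** Under an element of level [n] the sum changes by the cocycle at $z + t$, as is
    required of the limit. The correction is invariant, so it does not spoil this, and
    it makes the functions converge. *)
Definition potential A n z w t : C :=
  \sum_(j < n) toC (A j) * zeta j z * zeta j t +
    correction A n (zeta n z)^-1 (reduced A n z w) t.

Lemma cocycle_ext A A' n b z : (forall j, (j < n)%N -> A j = A' j) ->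
  cocycle A n b z = cocycle A' n b z.
Proof. by move=> AA; apply: eq_bigr => j _; rewrite AA. Qed.

Lemma reduced_ext A A' n z w : (forall j, (j < n)%N -> A j = A' j) ->
  reduced A n z w = reduced A' n z w.
Proof. by move=> AA; congr (_ - _); apply: eq_bigr => j _; rewrite AA. Qed.

Lemma correction_ext A A' n y w t : (forall j, (j < n)%N -> A j = A' j) ->
  correction A n y w t = correction A' n y w t.
Proof.
elim: n y w => [|n IH] y w AA; first by [].
rewrite /= (AA _ (ltnSn n)); congr (_ - _).
by apply: IH => j jn; apply: AA; exact: ltnW.
Qed.

Lemma potential_ext A A' n z w t : (forall j, (j < n)%N -> A j = A' j) ->
  potential A n z w t = potential A' n z w t.
Proof.
move=> AA; rewrite /potential (correction_ext _ _ _ AA) (reduced_ext _ _ AA).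
by congr (_ + _); apply: eq_bigr => j _; rewrite AA.
Qed.

(** The terms of index at least [m] vanish, since [zeta j] is periodic under [b] for
    these $j$. *)
Lemma cocycle_stable A m n b z : (m <= n)%N -> in_level m b ->
  cocycle A n b z = cocycle A m b z.
Proof.
move=> /subnKC <-; elim: (n - m)%N => [|k IH] bm; first by rewrite addn0.
rewrite addnS /cocycle big_ord_recr /= -/(cocycle _ _ _ _) IH// zetaD.
by rewrite (zeta_in_level _ bm) ?leq_addr// mulr1 subrr mulr0 addr0.
Qed.

Lemma cocycleD A n a b z :
  cocycle A n (a + b) z = cocycle A n a (z + toC b) + cocycle A n b z.
Proof.
rewrite /cocycle -big_split; apply: eq_bigr => j _ /=.
rewrite -mulrDr toCD; congr (_ * _).
rewrite (_ : z + (toC a + toC b) = z + toC b + toC a); first by ring.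
by rewrite -addrA [toC b + _]addrC.
Qed.

Lemma reduced_invariant A n b z w :
  reduced A n (z + toC b) (w + cocycle A n b z) = reduced A n z w.
Proof.
rewrite /reduced /cocycle.
under [in LHS]eq_bigr do rewrite mulrBr.
rewrite sumrB; ring.
Qed.

Lemma potential_equivariant A n b z w t : in_level n b ->
  potential A n (z + toC b) (w + cocycle A n b z) t =
  potential A n z w t + cocycle A n b (z + t).
Proof.
move=> bn; rewrite /potential reduced_invariant zetaD (zeta_in_level (leqnn n) bn) mulr1.
rewrite addrAC; congr (_ + _); rewrite /cocycle -big_split; apply: eq_bigr => j _ /=.
rewrite !zetaD; ring.
Qed.

(** The quotient by $(1 - x)^2$ of the polynomial that gives the error of Newton's
    method. *)
Definition double_quotient m (x : C) : C := \sum_(j < m) \sum_(i < j.+1) x ^+ i.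

Lemma double_root m (x : C) :
  m%:R - m.+1%:R * x + x ^+ m.+1 = (1 - x) ^+ 2 * double_quotient m x.
Proof.
elim: m => [|m IH].
  by rewrite /double_quotient big_ord0 expr1; ring.
rewrite /double_quotient big_ord_recr /= mulrDr -/(double_quotient m x) -IH.
have -> : (1 - x) ^+ 2 * (\sum_(i < m.+1) x ^+ i) = (1 - x) * (1 - x ^+ m.+1).
  by rewrite expr2 -mulrA; congr (_ * _); rewrite -[1 - x ^+ _]opprB subrX1 -mulNr opprB.
rewrite [x ^+ m.+2]exprS !mulrS; ring.
Qed.

Definition newton_error m (eps : R) (zt w : C) : C :=
  w ^+ 2 * zt^-1 * double_quotient m (1 - toC eps * (w * zt^-1)) / m%:R.

(** The error of Newton's method is quadratic, by [double_root]: with $a = 1 /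
    \varepsilon$ it is $\varepsilon^2$ times a function with a limit for $\varepsilon
    \to 0$. *)
Lemma newtonE m (eps : R) (zt w : C) : (0 < m)%N -> 0 < eps -> zt != 0 ->
  newton m eps^-1 (zt ^+ m)^-1 (w - toC eps^-1 * zt) =
  zt - toC eps * (toC eps * newton_error m eps zt w).
Proof.
move=> m0 eps0 zt0.
have Ce0 : toC eps != 0 by rewrite -[0]/(toC 0) /toC (inj_eq (@complexI _)) gt_eqF.
have eV : toC eps^-1 = (toC eps)^-1 by exact: (fmorphV (real_complex R)).
have m0' : m%:R != 0 :> C by rewrite pnatr_eq0 -lt0n.
pose x := 1 - toC eps * (w * zt^-1).
have ux : - ((w - toC eps^-1 * zt) / toC eps^-1) = zt * x.
  by rewrite eV /x; field; rewrite ?zt0 ?Ce0.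
rewrite /newton ux exprMn.
have -> : zt ^+ m * x ^+ m * (zt ^+ m)^-1 = x ^+ m.
  by rewrite mulrAC mulfV ?mul1r// expf_neq0.
have -> : zt * x * (m.+1%:R - x ^+ m) / m%:R =
    zt - zt * (m%:R - m.+1%:R * x + x ^+ m.+1) / m%:R.
  by rewrite exprS; field.
rewrite double_root /newton_error -/x.
have -> : (1 - x) ^+ 2 = toC eps ^+ 2 * w ^+ 2 * zt^-1 ^+ 2 by rewrite /x; ring.
by field; rewrite ?zt0 ?m0'.
Qed.

End construction.

(** * Smallness of a step *)

Section constants.
Context {R : realType}.
Local Notation C := (complex_numbers R).
Context (q : nat -> nat) (q_gt0 : forall n, (0 < q n)%N).
Implicit Types (A : nat -> R) (a b : R).

Definition set_constant A n a : nat -> R := fun j => if j == n then a else A j.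

Section smallness.
Context {W : normedModType C} (zc wc tc : {linear W -> C}).
Hypothesis zc_le : forall x : W, rn (zc x) <= rn x.
Hypothesis wc_le : forall x : W, rn (wc x) <= rn x.
Hypothesis tc_le : forall x : W, rn (tc x) <= rn x.

Lemma jet_bounded_zeta (L : {linear W -> C}) n : (forall x : W, rn (L x) <= rn x) ->
  jet_bounded (fun x => zeta q n (L x)).
Proof.
move=> L1; have := jet_bounded_cexp (itwopi *+ level q n) L1.
rewrite (_ : (fun x => cexp _) = fun x => zeta q n (L x)) //.
by apply/funext => x; rewrite /zeta /e mulrnAl mulrnAr.
Qed.

Lemma jet_bounded_zetaV (L : {linear W -> C}) n : (forall x : W, rn (L x) <= rn x) ->
  jet_bounded (fun x => (zeta q n (L x))^-1).
Proof.
move=> L1; have := jet_bounded_cexp (- (itwopi *+ level q n)) L1.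
rewrite (_ : (fun x => cexp _) = fun x => (zeta q n (L x))^-1) //.
by apply/funext => x; rewrite -zetaN /zeta /e mulrnAr mulrN mulNr mulrnAl mulNrn.
Qed.

Lemma jet_bounded_reduced A n : jet_bounded (fun x => reduced q A n (zc x) (wc x)).
Proof.
apply: jet_boundedB; first exact: jet_bounded_linear.
apply: (@jet_bounded_sum _ _ n (fun j x => toC (A j) * zeta q j (zc x))) => j _.
by apply: jet_boundedM; [exact: jet_bounded_cst|exact: jet_bounded_zeta].
Qed.

(** For a fixed third argument a correction is a polynomial in the other two. *)
Lemma correction_close A n y y0 w w0 : eps_close y y0 -> eps_close w w0 ->
  eps_close (fun eps x => correction q A n (y eps x) (w eps x) (tc x))
            (fun x => correction q A n (y0 x) (w0 x) (tc x)).
Proof.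
elim: n y y0 w w0 => [|n IH] y y0 w w0 cy cw; first exact: eps_close_cst.
have cz : eps_close (fun eps x => newton (q n) (A n) (y eps x) (w eps x))
    (fun x => newton (q n) (A n) (y0 x) (w0 x)).
  have cu : eps_close (fun eps x => - (w eps x / toC (A n))) (fun x => - (w0 x / toC (A n))).
    by apply: eps_close_ext (eps_closeM (eps_closeM (eps_close_cst (-1)) cw)
      (eps_close_cst (toC (A n))^-1)) => [eps _ x|x]; rewrite mulN1r mulNr.
  apply: (@eps_closeM _ _ (fun eps x => - (w eps x / toC (A n)) * _)) (eps_close_cst _).
  apply: eps_closeM; first exact: cu.
  apply: eps_closeB; first exact: eps_close_cst.
  by apply: eps_closeM; [exact: eps_closeX cu|exact: cy].
apply: eps_closeB.
  apply: IH; first by apply: eps_closeM; [exact: eps_closeX cz|exact: cy].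
  apply: eps_closeD; first exact: cw.
  by apply: eps_closeM; [exact: eps_close_cst|exact: cz].
apply: eps_closeM; last exact/eps_close_jet_bounded/jet_bounded_zeta.
by apply: eps_closeM; [exact: eps_close_cst|exact: cz].
Qed.

Lemma eps_close_limit_jet_bounded v (v0 : W -> C) : eps_close v v0 -> jet_bounded v0.
Proof. by move=> cv r r0; have [B jv _] := cv r r0; exists B. Qed.

Lemma jet_bounded_potential A n : jet_bounded (fun x => potential q A n (zc x) (wc x) (tc x)).
Proof.
apply: jet_boundedD.
  apply: (@jet_bounded_sum _ _ n
    (fun j x => toC (A j) * zeta q j (zc x) * zeta q j (tc x))) => j _.
  apply: jet_boundedM; last exact: jet_bounded_zeta.
  by apply: jet_boundedM; [exact: jet_bounded_cst|exact: jet_bounded_zeta].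
apply: (@eps_close_limit_jet_bounded (fun eps x =>
  correction q A n (zeta q n (zc x))^-1 (reduced q A n (zc x) (wc x)) (tc x))).
apply: (@correction_close A n (fun _ x => (zeta q n (zc x))^-1) _
   (fun _ x => reduced q A n (zc x) (wc x))).
  exact/eps_close_jet_bounded/jet_bounded_zetaV.
exact/eps_close_jet_bounded/jet_bounded_reduced.
Qed.

Lemma double_quotient_close m x x0 : eps_close x x0 ->
  @eps_close R W (fun eps p => double_quotient m (x eps p)) (fun p => double_quotient m (x0 p)).
Proof.
move=> cx; apply: (@eps_close_sum _ _ m (fun j eps p => \sum_(i < j.+1) x eps p ^+ i)
  (fun j p => \sum_(i < j.+1) x0 p ^+ i)) => j.
apply: (@eps_close_sum _ _ j.+1 (fun i eps p => x eps p ^+ i) (fun i p => x0 p ^+ i)) => i.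
exact: eps_closeX.
Qed.

(** With $a = 1 / \varepsilon$, let $\varepsilon^2 g$ be the error of the approximation
    of [zeta n]. The new term of the sum and the last term of the correction leave $a
    \varepsilon^2 g = \varepsilon g$ times [zeta n] at the third coordinate, and the
    arguments of the previous correction are off by $O(\varepsilon)$. So the difference
    is $O(\varepsilon)$. *)
Lemma step_small A n : exists a0, 0 < a0 /\ forall a, a0 <= a ->
  jet n%:R (2^-1 ^+ n) (fun x => potential q (set_constant A n a) n.+1 (zc x) (wc x) (tc x) -
    potential q (set_constant A n a) n (zc x) (wc x) (tc x)).
Proof.
pose m := q n; pose zt x : C := zeta q n (zc x); pose w x : C := reduced q A n (zc x) (wc x).
pose tt x : C := zeta q n (tc x).
have nzt : jet_bounded zt by exact: jet_bounded_zeta.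
have nztV : jet_bounded (fun x => (zt x)^-1) by exact: jet_bounded_zetaV.
have nw : jet_bounded w by exact: jet_bounded_reduced.
have ntt : jet_bounded tt by exact: jet_bounded_zeta.
pose g (eps : R) x := newton_error m eps (zt x) (w x).
have [g0 cg] : exists g0, eps_close g g0.
  pose b (eps : R) x := 1 - toC eps * (w x * (zt x)^-1).
  have cb : eps_close b (fun=> 1 - 0).
    apply: eps_closeB; first exact: eps_close_cst.
    apply: (@eps_close_scale _ _ (fun _ x => w x * (zt x)^-1) _).
    by apply: eps_close_jet_bounded; exact: jet_boundedM.
  exists (fun x => w x ^+ 2 * (zt x)^-1 * double_quotient m (1 - 0) / m%:R).
  apply: (@eps_closeM _ _ (fun eps x => w x ^+ 2 * (zt x)^-1 * double_quotient m (b eps x)))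
    (eps_close_cst _).
  apply: eps_closeM; last exact: double_quotient_close.
  apply: eps_closeM; last exact: eps_close_jet_bounded.
  exact: (@eps_closeX _ _ (fun _ x => w x) w 2 (eps_close_jet_bounded nw)).
pose z (eps : R) x := zt x - toC eps * (toC eps * g eps x).
have cz : eps_close z zt.
  apply: eps_close_ext (eps_closeB (eps_close_jet_bounded nzt)
    (eps_close_scale (eps_close_scale cg))) => [//|x]; by rewrite subr0.
pose y (eps : R) x := z eps x ^+ m.-1 * (zt x ^+ m)^-1.
have cy : eps_close y (fun x => (zt x)^-1).
  have nzm : jet_bounded (fun x => (zt x ^+ m)^-1).
    rewrite (_ : (fun x => _) = fun x => (zeta q n.+1 (zc x))^-1).
      exact: jet_bounded_zetaV.
    by apply/funext => x; rewrite zetaS.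
  apply: eps_close_ext (eps_closeM (eps_closeX m.-1 cz) (eps_close_jet_bounded nzm)) => // x.
  have zt0 : zt x != 0 by exact: zeta_neq0.
  have -> : zt x ^+ m = zt x ^+ m.-1 * zt x by rewrite -exprSr prednK// q_gt0.
  by rewrite invfM mulrA mulfV ?mul1r// expf_neq0.
pose w' (eps : R) x := w x - toC eps * g eps x.
have cw : eps_close w' w.
  apply: eps_close_ext (eps_closeB (eps_close_jet_bounded nw) (eps_close_scale cg)) => [//|x].
  by rewrite subr0.
(* The difference of the two potentials, as a function of $\varepsilon$. *)
pose D (eps : R) x := toC eps * g eps x * tt x +
  (correction q A n (y eps x) (w' eps x) (tc x) - correction q A n (zt x)^-1 (w x) (tc x)).
have cD : eps_close D (fun=> 0).
  apply: eps_close_ext (eps_closeD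
    (eps_closeM (eps_close_scale cg) (eps_close_jet_bounded ntt))
    (eps_closeB (correction_close A n cy cw)
      (correction_close A n (eps_close_jet_bounded nztV) (eps_close_jet_bounded nw))))
      => [//|x].
  by rewrite mul0r subrr addr0.
have [d /andP[d0 d1] dD] := @eps_close_small _ _ D n%:R (2^-1 ^+ n) (ler0n _ _)
  (half_pow_gt0 n) cD.
exists d^-1; split=> [|a da]; first by rewrite invr_gt0.
have a0 : 0 < a by apply: lt_le_trans da; rewrite invr_gt0.
have ad : 0 < a^-1 <= d by rewrite invr_gt0 a0 -[d]invrK lef_pV2// posrE invr_gt0.
apply: jet_ext (dD _ ad) => x; rewrite /D.
set A' := set_constant A n a.
have AA j : (j < n)%N -> A j = A' j by rewrite /A' /set_constant; case: ltngtP.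
have A'n : A' n = a by rewrite /A' /set_constant eqxx.
have redS : reduced q A' n.+1 (zc x) (wc x) = w x - toC a * zt x.
  rewrite /reduced big_ord_recr /= A'n opprD addrA; congr (_ - _).
  exact/esym/reduced_ext.
rewrite /potential big_ord_recr /= redS A'n zetaS -/(zt x) -/(tt x) -/m.
have -> : newton m a ((zt x ^+ m)^-1) (w x - toC a * zt x) = z a^-1 x.
  rewrite -{1 2}[a]invrK newtonE ?invr_gt0//; first exact: q_gt0.
  exact: zeta_neq0.
rewrite -/(y a^-1 x).
have aV : toC a * toC a^-1 = 1.
  by rewrite -toCM mulfV ?gt_eqF.
have -> : w x - toC a * zt x + toC a * z a^-1 x = w' a^-1 x.
  rewrite /z /w' -[in RHS](mul1r (toC a^-1 * _)) -aV; ring.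
have -> : toC a^-1 * g a^-1 x = toC a * (zt x - z a^-1 x).
  rewrite /z -[LHS](mul1r) -aV; ring.
rewrite -(@reduced_ext _ q A A' n _ _ AA) -/(w x).
rewrite -!(@correction_ext _ q A A' n _ _ _ AA).
move: (\sum_(i < n) _) (correction _ _ _ (y _ _) _ _) (correction _ _ _ (zt x)^-1 _ _).
move=> s c1 c2.
ring.
Qed.

End smallness.
End constants.

(** * Choice of the constants *)

Section separation.
Context {R : realType}.
Local Notation C := (complex_numbers R).
Context (q : nat -> nat) (q_gt0 : forall n, (0 < q n)%N).
Implicit Types (A : nat -> R) (a b : R) (z w : C).

Lemma root_of_unity_gap m : (0 < m)%N -> exists2 c : R, 0 < c &
  forall k : int, e (toC (k%:~R / m%:R : R)) != 1 -> c <= rn (e (toC (k%:~R / m%:R : R)) - 1).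
Proof.
move=> m0; pose v (k : int) : C := e (toC (k%:~R / m%:R : R)).
have [c c0 cv] : exists2 c : R, 0 < c & forall k, (k < m)%N -> v k != 1 -> c <= rn (v k - 1).
  elim: {1}m => [|p [c c0 IH]]; first by exists 1.
  have [vp|vp] := eqVneq (v p) 1.
    exists c => // k; rewrite ltnS leq_eqVlt => /orP[/eqP-> |]; last exact: IH.
    by rewrite vp eqxx.
  exists (Num.min c (rn (v p - 1))).
    rewrite lt_min c0 /= lt_neqAle rn_ge0 andbT eq_sym.
    apply: contra_neq vp => vp; apply/eqP; rewrite -subr_eq0; apply/eqP.
    by apply: rn_le0; rewrite vp.
  move=> k; rewrite ltnS leq_eqVlt ge_min => /orP[/eqP-> _ |kp vk].
    by rewrite lexx orbT.
  by rewrite IH.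
exists c => // k; rewrite -/(v k).
have m0' : m%:R != 0 :> R by rewrite pnatr_eq0 -lt0n.
have mz : (m%:Z != 0)%R by rewrite eqz_nat -lt0n.
have -> : v k = v (k %% m)%Z.
  rewrite /v {1}(divz_eq k m) rmorphD rmorphM /= mulrDl.
  by rewrite -[(m : int)%:~R]/(m%:R) mulfK// toCD eD e_int mul1r.
have := modz_ge0 k mz; have := ltz_pmod k (m0 : (0 < m%:Z)%R).
by case: (k %% m)%Z => // p pm _; exact: cv.
Qed.

Lemma zeta_bound n z r : rn z <= r -> rn (zeta q n z) <= expR (pi *+ 2 * (r *+ level q n)).
Proof.
move=> zr; rewrite -rn_le; apply: e_bound; rewrite rn_le.
rewrite -[z *+ _]mulr_natl -[r *+ _]mulr_natl rnM.
have -> : rn ((level q n)%:R : C) = (level q n)%:R :> R.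
  by rewrite /rn normr_nat -[_%:R](rmorph_nat (real_complex R)).
by rewrite ler_wpM2l.
Qed.

Lemma rn_zeta_real n b : rn (zeta q n (toC b)) = 1.
Proof. by rewrite /zeta toC_natmul /rn norm_e_real. Qed.

(** Descending from level to level, this shows that an element which returns some point
    of the ball of radius $N$ to that ball has level [N] ([return_level]): such elements
    form a discrete set of translations of the first coordinate. *)
Definition separating A n := forall b z w, in_level q n.+1 b ->
  rn z <= n%:R -> rn w <= n%:R -> rn (w + cocycle q A n.+1 b z) <= n%:R ->
  in_level q n b.

(** If [b] has level $n + 1$ and not level [n], then [zeta n] takes at [b] a value
    different from $1$ among finitely many roots of unity. So the last term of the
    cocycle is at least a positive constant times [a] on the ball, and exceeds the sum
    of all the other terms for large [a]. *)
Lemma step_separating A n : exists a1, forall a, a1 <= a ->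
  separating (set_constant A n a) n.
Proof.
pose B j : R := expR (pi *+ 2 * (n%:R *+ level q j)).
have B0 j : 0 < B j by exact: expR_gt0.
pose s : R := \sum_(j < n) `|A j| * (2 * B j).
have s0 : 0 <= s by apply: sumr_ge0 => j _; rewrite !mulr_ge0// ltW.
have [c c0 gap] := root_of_unity_gap (q_gt0 n).
exists ((n%:R + n%:R + s + 1) * (B n / c)) => a ale b z w bn zn wn wbn.
have a0 : 0 < a.
  apply: lt_le_trans ale; rewrite mulr_gt0 ?divr_gt0//.
  by rewrite ltr_wpDl// !addr_ge0.
pose beta := b *+ level q n.
have [k bk] := bn.
have betaE : beta = k%:~R / (q n)%:R.
  rewrite -bk levelS mulrnA -/beta -[beta *+ q n]mulr_natr mulfK//.
  by rewrite pnatr_eq0 -lt0n.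
have [eb|eb] := eqVneq (e (toC beta)) 1.
  by have [l lE] := e_eq1 eb; exists l; apply: (@complexI R); exact: lE.
exfalso; have gapb : c <= rn (e (toC beta) - 1) by rewrite betaE; apply: gap; rewrite -betaE.
move: wbn; rewrite /cocycle big_ord_recr /= {2}/set_constant eqxx.
set g := \sum_(j < n) _; set h := toC a * _ => wbn.
have gs : rn (g : C) <= s.
  rewrite /g /s; apply: (@big_ind2 _ _ (fun x y => rn x <= y)); first by rewrite rn0.
    by move=> x1 x2 y1 y2 h1 h2; rewrite (le_trans (rnD _ _))// lerD.
  move=> j _; rewrite /set_constant (ltn_eqF (ltn_ord j)) rnM rn_toC ler_wpM2l//.
  rewrite zetaD (le_trans (rnB _ _))// rnM rn_zeta_real mulr1.
  by have := zeta_bound j zn; rewrite -/(B j); lra.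
have hE : h = toC a * (zeta q n z * (e (toC beta) - 1)).
  by rewrite /h zetaD [zeta q n (toC b)]/zeta toC_natmul [in RHS]mulrBr mulr1.
have hle : rn h <= n%:R + n%:R + s.
  have -> : h = (w + (g + h)) - w - g by ring.
  apply: (le_trans (rnB _ _)); apply: lerD; last exact: gs.
  by apply: (le_trans (rnB _ _)); apply: lerD.
have zB : (B n)^-1 <= rn (zeta q n z).
  have zz : rn (zeta q n z) * rn (zeta q n (- z)) = 1.
    by rewrite -rnM zetaN mulfV ?zeta_neq0// /rn normr1.
  have zNB : rn (zeta q n (- z)) <= B n by apply: zeta_bound; rewrite rnN.
  rewrite -[leLHS]mul1r ler_pdivrMr// -zz.
  by apply: ler_wpM2l; [exact: rn_ge0|exact: zNB].
have : (n%:R + n%:R + s + 1) <= rn h.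
  rewrite hE rnM rn_toC gtr0_norm// (rnM (zeta q n z)).
  apply: le_trans (_ : a * ((B n)^-1 * c) <= _).
    rewrite -[leLHS](mulfK (_ : B n / c != 0)); last by rewrite gt_eqF ?divr_gt0.
    by rewrite invf_div -[c / B n]mulrC ler_wpM2r// mulr_ge0 ?invr_ge0 ?ltW.
  apply: ler_wpM2l; first exact: ltW.
  by apply: ler_pM; [rewrite invr_ge0 ltW|exact: ltW|exact: zB|exact: gapb].
by lra.
Qed.

Section choice.
Context {W : normedModType C} (zc wc tc : {linear W -> C}).
Hypothesis zc_le : forall x : W, rn (zc x) <= rn x.
Hypothesis wc_le : forall x : W, rn (wc x) <= rn x.
Hypothesis tc_le : forall x : W, rn (tc x) <= rn x.

(** Both conditions hold for all large values of the constant of index [n], given the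
    previous ones, and they do not involve the later ones; so the constants can be
    chosen one after the other. *)
Lemma constants_exist : exists A, forall n,
  jet n%:R (2^-1 ^+ n) (fun x => potential q A n.+1 (zc x) (wc x) (tc x) -
    potential q A n (zc x) (wc x) (tc x)) /\ separating A n.
Proof.
pose P A n := jet n%:R (2^-1 ^+ n) (fun x => potential q A n.+1 (zc x) (wc x) (tc x) -
    potential q A n (zc x) (wc x) (tc x)) /\ separating A n.
have /choice[next nextP] : forall p : (nat -> R) * nat, exists a,
    P (set_constant p.1 p.2 a) p.2.
  move=> [A n] /=.
  have [a0 [_ h0]] := step_small q_gt0 zc_le wc_le tc_le A n.
  have [a1 h1] := step_separating A n.
  exists (Num.max a0 a1); split; [apply: h0|apply: h1]; rewrite le_max lexx ?orbT//.
pose build := fix build n : nat -> R :=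
  if n is n'.+1 then set_constant (build n') n' (next (build n', n')) else fun=> 0.
pose A j := build j.+1 j.
have AE n j : (j < n)%N -> A j = build n j.
  elim: n => // n IH; rewrite ltnS leq_eqVlt => /orP[/eqP-> //|jn].
  by rewrite IH//= /set_constant ltn_eqF.
exists A => n; have [h1 h2] := nextP (build n, n).
have AA j : (j < n.+1)%N -> build n.+1 j = A j by move=> /AE->.
split.
  apply: jet_ext h1 => x /=; rewrite (potential_ext q _ _ _ AA).
  by rewrite (@potential_ext _ q _ A n)// => j jn; apply: AA; exact: ltnW.
move=> b z w bn zn wn wbn; apply: (h2 b z w) => //.
by rewrite (cocycle_ext q _ _ AA).
Qed.

End choice.
End separation.

(** * Properly discontinuous shears *)

Section level_group.
Context {R : realType} (q : nat -> nat).

Definition level_pred : {pred R} := [pred a : R | `[< exists n, in_level q n a >]].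

Lemma level_pred_zmod_closed : zmod_closed level_pred.
Proof.
split; first by apply/asboolP; exists 0%N; exists 0; rewrite mul0rn.
move=> a b /asboolP[m am] /asboolP[n bn]; apply/asboolP; exists (maxn m n).
apply: in_levelD; first exact: in_level_le (leq_maxl _ _) am.
by apply: in_levelN; exact: in_level_le (leq_maxr _ _) bn.
Qed.

HB.instance Definition _ := GRing.isZmodClosed.Build R level_pred
  level_pred_zmod_closed.

(** $\Gamma = \bigcup_n \frac{1}{N_n} \mathbb{Z}$. *)
Record level_group := LevelGroup { level_val : R; _ : level_val \in level_pred }.

HB.instance Definition _ := [isSub for level_val].
HB.instance Definition _ := [Choice of level_group by <:].
HB.instance Definition _ := [SubChoice_isSubZmodule of level_group by <:].

Lemma level_exists (a : level_group) : exists n, in_level q n (val a).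
Proof. by case: a => a /= /asboolP. Qed.

End level_group.

Section vectors.
Context {R : realType}.
Local Notation C := (complex_numbers R).

Lemma rn_entry m n (x : 'M[C]_(m, n)) i j : rn (x i j) <= rn x.
Proof.
rewrite -rn_le -norm_rn; change (`|x i j| <= mx_norm x).
rewrite mx_normE -[leLHS]nngE num_le.
exact: (le_bigmax _ (fun ij : 'I_m * 'I_n => (`|x ij.1 ij.2|)%:nng) (i, j)).
Qed.

Definition entry n (i : 'I_n) (x : 'rV[C]_n) : C := x ord0 i.

Lemma entry_linear n (i : 'I_n) : linear (entry i).
Proof. by move=> a x y; rewrite /entry !mxE. Qed.

HB.instance Definition _ n (i : 'I_n) :=
  GRing.isLinear.Build C 'rV[C]_n C _ (entry i) (entry_linear i).

Lemma entry_le n (i : 'I_n) (x : 'rV[C]_n) : rn (entry i x) <= rn x.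
Proof. exact: rn_entry. Qed.

Lemma open_rn_ball (W : normedModType C) (x : W) (r : R) : open [set y | rn (y - x) < r].
Proof.
rewrite (_ : [set y | _] = ball x (toC r)); first exact: ball_open.
apply/seteqP; split=> y; by rewrite -ball_normE /= norm_rn toC_ltr rn_sym.
Qed.

End vectors.

Section shear_action.
Context {R : realType} {d : nat} (q : nat -> nat) (q_gt0 : forall n, (0 < q n)%N).
Local Notation C := (complex_numbers R).
Local Notation V := 'rV[C]_d.+2.
Local Notation G := (@level_group R q).
Context (A : nat -> R) (A_separating : forall n, separating q A n).

Definition i0 : 'I_d.+2 := ord0.
Definition i1 : 'I_d.+2 := lift ord0 ord0.

(** The level of [a] that is chosen does not matter, by [cocycle_stable]. *)
Definition shift_of (a : G) (z : C) : C :=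
  cocycle q A (sval (cid (level_exists a))) (val a) z.

Lemma shift_ofE (a : G) n z : in_level q n (val a) ->
  shift_of a z = cocycle q A n (val a) z.
Proof.
move=> an; rewrite /shift_of; case: cid => m am /=.
by rewrite -(cocycle_stable A z (leq_maxl m n) am) (cocycle_stable A z (leq_maxr m n) an).
Qed.

Lemma shift_ofD (a b : G) z :
  shift_of (a + b) z = shift_of a (z + toC (val b)) + shift_of b z.
Proof.
have [m am] := level_exists a; have [n bn] := level_exists b.
have am' := in_level_le (leq_maxl m n) am; have bn' := in_level_le (leq_maxr m n) bn.
rewrite (shift_ofE _ am') (shift_ofE _ bn') -cocycleD.
by apply: shift_ofE; exact: in_levelD.
Qed.

Definition shear (a : G) (x : V) : V :=
  x + toC (val a) *: delta_mx ord0 i0 + shift_of a (entry i0 x) *: delta_mx ord0 i1.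

Lemma shear_i0 a x : entry i0 (shear a x) = entry i0 x + toC (val a).
Proof. by rewrite /entry !mxE !eqxx /= mulr1 mulr0 addr0. Qed.

Lemma shear_i1 a x : entry i1 (shear a x) = entry i1 x + shift_of a (entry i0 x).
Proof. by rewrite /entry !mxE !eqxx /= mulr1 mulr0 addr0. Qed.

Lemma shear_other a x i : i != i0 -> i != i1 -> entry i (shear a x) = entry i x.
Proof.
move=> /negbTE ni0 /negbTE ni1.
by rewrite /entry !mxE !eqxx ni0 ni1 /= !mulr0 !addr0.
Qed.

Lemma shear0 x : shear 0 x = x.
Proof.
rewrite /shear (@shift_ofE 0 0); last by exists 0; rewrite mul0rn.
by rewrite /cocycle big_ord0 scale0r addr0 /= [toC 0](_ : _ = 0)// scale0r addr0.
Qed.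

Lemma shearD a b x : shear (a + b) x = shear a (shear b x).
Proof.
have -> : shear (a + b) x = x + (toC (val a) + toC (val b)) *: delta_mx ord0 i0 +
    (shift_of a (entry i0 x + toC (val b)) + shift_of b (entry i0 x)) *: delta_mx ord0 i1.
  by rewrite -shift_ofD -toCD.
rewrite [RHS]/shear shear_i0 /shear; apply/rowP => i; rewrite !mxE; ring.
Qed.

Lemma jet_bounded_shift a : jet_bounded (fun x : V => shift_of a (entry i0 x)).
Proof.
have [n an] := level_exists a.
rewrite (_ : (fun x => _) = fun x : V =>
    \sum_(j < n) toC (A j) * (zeta q j (entry i0 x) * (zeta q j (toC (val a)) - 1))).
  apply: (@jet_bounded_sum _ _ n (fun j (x : V) =>
    toC (A j) * (zeta q j (entry i0 x) * (zeta q j (toC (val a)) - 1)))) => j _.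
  apply: jet_boundedM; first exact: jet_bounded_cst.
  apply: jet_boundedM; last exact: jet_bounded_cst.
  exact/jet_bounded_zeta/entry_le.
apply/funext => x; rewrite (shift_ofE _ an); apply: eq_bigr => j _.
by rewrite zetaD [in RHS]mulrBr mulr1.
Qed.

Lemma jet_bounded_differentiable (W : normedModType C) (f : W -> C) x :
  jet_bounded f -> differentiable f x.
Proof. by move=> nf; have [M []] := nf 0 (lexx 0). Qed.

Lemma shear_holomorphic a x : differentiable (shear a) x.
Proof.
apply: (@differentiableD _ _ _ (fun x : V => x + toC (val a) *: delta_mx ord0 i0)
  (fun x : V => shift_of a (entry i0 x) *: delta_mx ord0 i1)).
  apply: (@differentiableD _ _ _ id (cst (toC (val a) *: delta_mx ord0 i0))).
    by case: (is_diff_id x).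
  exact: differentiable_cst.
apply: (@differentiableZl _ _ _ (fun x : V => shift_of a (entry i0 x))).
exact/jet_bounded_differentiable/jet_bounded_shift.
Qed.

Lemma shear_continuous a : continuous (shear a).
Proof. by move=> x; exact/differentiable_continuous/shear_holomorphic. Qed.

Lemma return_level N (b : G) z w : rn z <= N%:R -> rn w <= N%:R ->
  rn (w + shift_of b z) <= N%:R -> in_level q N (val b).
Proof.
move=> zN wN wbN; have [m bm] := level_exists b.
have [mN|/ltnW/subnKC mN] := leqP m N; first exact: in_level_le bm.
move: bm; rewrite -mN; elim: (m - N)%N => [|k IH]; first by rewrite addn0.
rewrite addnS => bk; apply: IH.
have kN (x : R) : x <= N%:R -> x <= (N + k)%:R.
  by move=> /le_trans; apply; rewrite ler_nat leq_addr.
apply: (A_separating bk (kN _ zN) (kN _ wN)).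
by rewrite -(shift_ofE _ bk); exact: kN.
Qed.

Lemma shear_return N (a : G) (x : V) : rn x <= N%:R -> rn (shear a x) <= N%:R ->
  in_level q N (val a).
Proof.
move=> xN axN; apply: (@return_level N a (entry i0 x) (entry i1 x)).
- exact: le_trans (entry_le _ _) xN.
- exact: le_trans (entry_le _ _) xN.
- by rewrite -shear_i1; exact: le_trans (entry_le _ _) axN.
Qed.

(** Elements that return a ball around [x] to itself have a bounded level $N$, so they
    translate the first coordinate by a multiple of the inverse of [level q N]; the ball
    is too small for a multiple other than $0$. *)
Lemma shear_wandering (x : V) : exists U : set V,
  [/\ open U, U x & forall a y, U y -> U (shear a y) -> a = 0].
Proof.
pose N := Num.bound (rn x + 1).
have xN : rn x + 1 <= N%:R :> R.
  by apply/ltW/archi_boundP; rewrite addr_ge0 ?rn_ge0.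
pose L : R := (level q N)%:R; have L1 : 1 <= L by rewrite ler1n level_gt0.
pose r := (2 * L)^-1.
have r0 : 0 < r by rewrite invr_gt0; lra.
have r1 : r <= 1 by rewrite invf_le1; lra.
exists [set y | rn (y - x) < r]; split.
- exact: open_rn_ball.
- by rewrite /= subrr rn0.
move=> a y /= yx ayx.
have bd u : rn (u - x) < r -> rn u <= N%:R.
  by move=> ux; have := rnD (u - x) x; rewrite subrK; lra.
have [k ak] := shear_return (bd _ yx) (bd _ ayx).
have aL : val a * L = k%:~R by rewrite mulr_natr.
have a2r : `|val a| < 2 * r.
  have -> : `|val a| = rn (entry i0 (shear a y - y)).
    by rewrite raddfB /= shear_i0 addrC addKr rn_toC.
  apply: le_lt_trans (entry_le _ _) _.
  have -> : shear a y - y = (shear a y - x) - (y - x) by rewrite opprB addrA subrK.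
  by have := rnB (shear a y - x) (y - x); lra.
have k1 : `|k%:~R : R| < 1.
  rewrite -aL normrM (gtr0_norm (_ : 0 < L)); last by lra.
  rewrite -ltr_pdivlMr; last by lra.
  by move: a2r; rewrite /r invfM mulrA divff ?pnatr_eq0// mul1r.
have k0 : k = 0.
  by move: k1; rewrite -intr_norm -[1]/(1%:~R) ltr_int; case: k {ak aL} => [[]|].
apply: val_inj => /=; apply/eqP; move: aL; rewrite k0 => /eqP.
by rewrite mulf_eq0 (gt_eqF (_ : 0 < L)) ?orbF//; lra.
Qed.

(** Only elements of one level $N$ can take a point near [x] to a point near [y], and
    the orbits of the elements of that level are separated by invariants: [zeta q N],
    [reduced] and the coordinates that do not move. *)
Lemma shear_separated (x y : V) : (forall a, shear a x <> y) ->
  exists U W : set V, [/\ open U, U x, open W, W y &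
    forall a z, U z -> ~ W (shear a z)].
Proof.
move=> xy; pose N := Num.bound (rn x + rn y + 1).
have xyN : rn x + rn y + 1 <= N%:R :> R.
  by apply/ltW/archi_boundP; rewrite !addr_ge0 ?rn_ge0.
have [x0 y0] := (rn_ge0 x, rn_ge0 y).
(* A continuous invariant of level [N] with different values at [x] and [y] gives the
   two neighbourhoods. *)
suff [phi [cphi iphi nphi]] : exists phi : V -> C, [/\ continuous phi,
    forall a z, in_level q N (val a) -> phi (shear a z) = phi z & phi x != phi y].
  pose r := rn (phi x - phi y) / 2.
  have r0 : 0 < r.
    rewrite divr_gt0// lt_neqAle rn_ge0 andbT eq_sym.
    apply: contra_neq nphi => e; apply/eqP; rewrite -subr_eq0; apply/eqP.
    by apply: rn_le0; rewrite e.
  have op (u : V) (c : C) : open [set z | rn (z - u) < 1 /\ rn (phi z - c) < r].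
    rewrite (_ : [set z | _] =
      [set z | rn (z - u) < 1] `&` (phi @^-1` [set w | rn (w - c) < r])) //.
    apply: openI; first exact: open_rn_ball.
    by apply: open_comp => [z _|]; [exact: cphi|exact: open_rn_ball].
  exists [set z | rn (z - x) < 1 /\ rn (phi z - phi x) < r],
    [set z | rn (z - y) < 1 /\ rn (phi z - phi y) < r]; split.
  - exact: op.
  - by rewrite /= !subrr !rn0.
  - exact: op.
  - by rewrite /= !subrr !rn0.
  move=> a z [/= zx phx] [azy phy].
  have zN : rn z <= N%:R by have := rnD (z - x) x; rewrite subrK; lra.
  have azN : rn (shear a z) <= N%:R by have := rnD (shear a z - y) y; rewrite subrK; lra.
  move: phy; rewrite iphi; last exact: shear_return zN azN.
  have : rn (phi x - phi y) <= rn (phi z - phi y) + rn (phi z - phi x).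
    have -> : phi x - phi y = (phi z - phi y) - (phi z - phi x) by ring.
    exact: rnB.
  by move: phx; rewrite /r; lra.
apply: contrapT => no_phi; have no (phi : V -> C) : continuous phi ->
    (forall a z, in_level q N (val a) -> phi (shear a z) = phi z) -> phi x = phi y.
  move=> cphi iphi; apply/eqP; apply: contrapT => /negP n; apply: no_phi.
  by exists phi.
have nc (f : V -> C) : jet_bounded f -> continuous f.
  by move=> nf z; exact/differentiable_continuous/jet_bounded_differentiable.
have zxy : zeta q N (entry i0 x) = zeta q N (entry i0 y).
  apply: (no (fun z => zeta q N (entry i0 z))); first exact/nc/jet_bounded_zeta/entry_le.
  by move=> a z aN; rewrite shear_i0 zetaD (zeta_in_level (leqnn N) aN) mulr1.
have rxy : reduced q A N (entry i0 x) (entry i1 x) = reduced q A N (entry i0 y) (entry i1 y).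
  apply: (no (fun z => reduced q A N (entry i0 z) (entry i1 z))).
    by apply: nc; apply: jet_bounded_reduced => z; exact: entry_le.
  by move=> a z aN; rewrite shear_i0 shear_i1 (shift_ofE _ aN) reduced_invariant.
have oxy i : i != i0 -> i != i1 -> entry i x = entry i y.
  move=> ni0 ni1; apply: (no (entry i)); first by move=> z; exact: coord_continuous.
  by move=> a z _; exact: shear_other.
(* All the invariants agree at [x] and [y]; this yields an element of level [N] that
   takes [x] to [y]. *)
have : e ((entry i0 y - entry i0 x) *+ level q N) = 1.
  by rewrite -[LHS]/(zeta q N _) zetaD zetaN -zxy mulfV// zeta_neq0.
move=> /e_eq1[k kE]; pose b : R := k%:~R / (level q N)%:R.
have L0 : (level q N)%:R != 0 :> R by rewrite pnatr_eq0 -lt0n level_gt0.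
have bk : b *+ level q N = k%:~R by rewrite -mulr_natr divfK.
have bN : in_level q N b by exists k.
have bl : b \in level_pred q by apply/asboolP; exists N.
have by0 : entry i0 y = entry i0 x + toC b.
  have : (entry i0 y - entry i0 x - toC b) *+ level q N = 0.
    by rewrite mulrnBl kE toC_natmul bk subrr.
  move/eqP; rewrite mulrn_eq0 gtn_eqF ?level_gt0//= subr_eq0 => /eqP <-.
  by rewrite addrC subrK.
apply: (xy (LevelGroup bl)); apply/rowP => i.
rewrite -[LHS]/(entry i _) -[RHS]/(entry i y).
have [->|ni0] := eqVneq i i0; first by rewrite shear_i0 by0.
have [->|ni1] := eqVneq i i1; last by rewrite shear_other// oxy.
rewrite shear_i1 (@shift_ofE _ N) //=.
have : reduced q A N (entry i0 x + toC b) (entry i1 x + cocycle q A N b (entry i0 x)) =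
       reduced q A N (entry i0 x + toC b) (entry i1 y).
  by rewrite reduced_invariant rxy by0.
by move/addIr.
Qed.

Definition shear_action : deck_action G V :=
  DeckAction shear0 shearD shear_continuous shear_wandering shear_separated.

End shear_action.

(** * Ellipticity of the quotient *)

Lemma diff_shear (K : numFieldType) (V : normedModType K) (phi : V -> K)
    (x y u v : V) (c : K) : differentiable phi y ->
  'd (fun w => x + w + (phi w - c) *: u) y v = v + 'd phi y v *: u.
Proof.
move=> dphi.
pose psi : V -> K := phi - cst c.
have dpsi : differentiable psi y by apply: differentiableB => //; exact: differentiable_cst.
have dpsiE : 'd psi y v = 'd phi y v.
  have := diffB dphi (differentiable_cst c y) => /(congr1 (fun k : V -> K => k v)).
  rewrite diff_cst => ->; exact: subr0.
pose g (w : V) : V := psi w *: u.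
have dg : differentiable g y by exact: differentiableZl.
have dgE : 'd g y v = 'd phi y v *: u.
  have := diffZl u dpsi => /(congr1 (fun k : V -> V => k v)) ->.
  by rewrite dpsiE.
pose h : V -> V := cst x + id.
have dh : is_diff y h (0 + id) by exact: is_diffD.
have [dhd dhE] := dh.
have := diffD dhd dg => /(congr1 (fun k : V -> V => k v)) E.
apply: (etrans E).
rewrite -[LHS]/('d h y v + 'd g y v) dgE; congr (_ + _).
have := dhE => /(congr1 (fun k : V -> V => k v)) ->.
exact: add0r.
Qed.

Section shear_spray.
Context {R : realType} {d : nat} (q : nat -> nat) (q_gt0 : forall n, (0 < q n)%N).
Local Notation C := (complex_numbers R).
Local Notation V := 'rV[C]_d.+2.
Local Notation W := 'rV[C]_(d.+2 + d.+2).
Local Notation G := (@level_group R q).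

Definition zc : {linear W -> C} := entry (lshift d.+2 (i0 (d := d))).
Definition wc : {linear W -> C} := entry (lshift d.+2 (i1 (d := d))).
Definition tc : {linear W -> C} := entry (rshift d.+2 (i0 (d := d))).

Context (A : nat -> R) (A_separating : forall n, separating q A n).
Hypothesis A_small : forall n, jet n%:R (2^-1 ^+ n) (fun x : W =>
  potential q A n.+1 (zc x) (wc x) (tc x) - potential q A n (zc x) (wc x) (tc x)).
Local Notation act := (shear_action (d := d) q_gt0 A_separating).

Lemma limit_potential_exists : exists k : W -> C,
  (forall x, (fun n => potential q A n (zc x) (wc x) (tc x)) @ \oo --> k x) /\
  (forall x, differentiable k x).
Proof.
have nP n : jet_bounded (fun x : W => potential q A n (zc x) (wc x) (tc x)).
  by apply: jet_bounded_potential => x; exact: entry_le.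
have [k kl dk] := jet_limit nP A_small.
by exists k.
Qed.

(** The function $k$ with $k(a \cdot x, v) = k(x, v) + f_a(x_0 + v_0)$, on pairs $(x,
    v)$. *)
Definition limit_potential : W -> C := sval (cid limit_potential_exists).

Lemma limit_potential_cvg x :
  (fun n => potential q A n (zc x) (wc x) (tc x)) @ \oo --> limit_potential x.
Proof. by rewrite /limit_potential; case: cid => k [kl dk] /=; exact: kl. Qed.

Lemma limit_potential_holomorphic x : differentiable limit_potential x.
Proof. by rewrite /limit_potential; case: cid => k [kl dk] /=; exact: dk. Qed.

Lemma zc_row (x v : V) : zc (row_mx x v) = entry i0 x.
Proof. exact: row_mxEl. Qed.

Lemma wc_row (x v : V) : wc (row_mx x v) = entry i1 x.
Proof. exact: row_mxEl. Qed.

Lemma tc_row (x v : V) : tc (row_mx x v) = entry i0 v.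
Proof. exact: row_mxEr. Qed.

Lemma limit_potential_shear (a : G) (x v : V) :
  limit_potential (row_mx (shear A a x) v) =
  limit_potential (row_mx x v) + shift_of A a (entry i0 x + entry i0 v).
Proof.
have [N aN] := level_exists a.
apply/eqP; rewrite -subr_eq0; apply/eqP; apply: rn_le0.
have cl := @limit_potential_cvg (row_mx (shear A a x) v).
have cr := @limit_potential_cvg (row_mx x v).
apply: (@norm_cvg_le _ _ _ _ N (cvgB cl (cvgD cr (cvg_cst _)))) => n Nn.
have an := in_level_le Nn aN.
have e : potential q A n (zc (row_mx (shear A a x) v)) (wc (row_mx (shear A a x) v))
    (tc (row_mx (shear A a x) v)) =
  potential q A n (zc (row_mx x v)) (wc (row_mx x v)) (tc (row_mx x v)) +
    shift_of A a (entry i0 x + entry i0 v).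
  rewrite !zc_row !wc_row !tc_row shear_i0 shear_i1.
  by rewrite !(@shift_ofE _ _ A a n _ an) potential_equivariant.
rewrite (_ : (_ - _) n = 0) ?rn0//; apply/eqP; rewrite subr_eq0; apply/eqP.
exact: e.
Qed.

Lemma limit_potential_first (x v w : V) : entry i0 v = entry i0 w ->
  limit_potential (row_mx x v) = limit_potential (row_mx x w).
Proof.
move=> vw; apply: (@cvg_unique _ (@norm_hausdorff _ C) _ _ _ _
  (@limit_potential_cvg (row_mx x v))).
rewrite (_ : (fun n => _) = (fun n => potential q A n
    (zc (row_mx x w)) (wc (row_mx x w)) (tc (row_mx x w)))).
  exact: limit_potential_cvg.
by apply/funext => n; rewrite !zc_row !wc_row !tc_row vw.
Qed.

(** The first coordinate moves by $v_0$, so the shear by $a$ at the new point and that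
    at [x] differ by $f_a(x_0 + v_0) - f_a(x_0)$; the last term changes by exactly this
    amount. *)
Definition shear_spray (x v : V) : V :=
  x + v + (limit_potential (row_mx x v) - limit_potential (row_mx x 0)) *: delta_mx ord0 i1.

Lemma shear_spray0 x : shear_spray x 0 = x.
Proof. by rewrite /shear_spray subrr scale0r !addr0. Qed.

Lemma shear_spray_equivariant (a : G) x v :
  shear_spray (act a x) v = act a (shear_spray x v).
Proof.
have e0 : entry i0 (shear_spray x v) = entry i0 x + entry i0 v.
  by rewrite /entry !mxE eqxx /= mulr0 addr0.
rewrite [LHS]/shear_spray /= !limit_potential_shear [RHS]/shear e0.
have -> : entry i0 (0 : V) = 0 by rewrite /entry mxE.
rewrite addr0 /shear /shear_spray; apply/rowP => i; rewrite !mxE; ring.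
Qed.

Lemma shear_spray_holomorphic (z : W) :
  differentiable (fun z => shear_spray (lsubmx z) (rsubmx z)) z.
Proof.
rewrite (_ : (fun z : W => _) = (fun z : W => (lsubmx z + rsubmx z) +
    (limit_potential z - limit_potential (row_mx (lsubmx z) 0)) *: delta_mx ord0 i1)).
  apply: (@differentiableD _ _ _ (fun z : W => lsubmx z + rsubmx z) (fun z : W =>
    (limit_potential z - limit_potential (row_mx (lsubmx z) 0)) *: delta_mx ord0 i1)).
    apply: (@differentiableD _ _ _ (lsubmx : W -> V) (rsubmx : W -> V)).
      exact: differentiable_lsubmx.
    exact: differentiable_rsubmx.
  apply: (@differentiableZl _ _ _ (fun z : W =>
    limit_potential z - limit_potential (row_mx (lsubmx z) 0))).
  apply: (@differentiableB _ _ _ limit_potential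
    (fun z : W => limit_potential (row_mx (lsubmx z) 0))).
    exact: limit_potential_holomorphic.
  apply: (@differentiable_comp _ _ _ _
    (fun z : W => row_mx (lsubmx z) (0 : V)) limit_potential).
    apply: differentiable_row_mx; first exact: differentiable_lsubmx.
    exact: differentiable_cst.
  exact: limit_potential_holomorphic.
by apply/funext => y; rewrite /shear_spray hsubmxK.
Qed.

(** The potential depends on the first coordinate of [v] only, so the differential of
    the spray at $0$ is the identity plus a multiple of $e_1$ that vanishes on $e_1$. *)
Lemma shear_spray_dominating (x w : V) : exists v, 'd (shear_spray x) 0 v = w.
Proof.
pose phi v := limit_potential (row_mx x v).
pose P (v : V) : V := entry i0 v *: delta_mx ord0 i0.
have linP : linear P.
  by move=> a u v; rewrite /P linearP scalerDl scalerA.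
pose PL : {linear V -> V} := HB.pack P (GRing.isLinear.Build _ _ _ _ _ linP).
have dphi v : differentiable phi v.
  apply: (@differentiable_comp _ _ _ _ (fun v : V => row_mx x v) limit_potential).
    apply: differentiable_row_mx; first exact: differentiable_cst.
    by case: (is_diff_id v).
  exact: limit_potential_holomorphic.
have phiP : phi = phi \o PL.
  apply/funext => v; apply: limit_potential_first.
  by rewrite /= /P /entry !mxE !eqxx mulr1.
have dphi1 : 'd phi 0 (delta_mx ord0 i1 : V) = 0.
  have dPL : differentiable PL 0 by exact: linear_rV_differentiable.
  have : 'd (phi \o PL) 0 (delta_mx ord0 i1 : V) = 0.
    have dPLE : 'd PL 0 = PL :> (V -> V).
      by apply: diff_lin; exact: linear_rV_continuous.
    rewrite (diff_comp dPL (dphi _)).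
    rewrite -[LHS]/('d phi (PL 0) ('d PL 0 (delta_mx ord0 i1 : V))).
    rewrite (congr1 (fun k : V -> V => k (delta_mx ord0 i1)) dPLE).
    have -> : PL (delta_mx ord0 i1) = 0.
      by rewrite /= /P /entry mxE eqxx /= scale0r.
    exact: linear0.
  by rewrite -phiP.
have dsp v : 'd (shear_spray x) 0 v = v + 'd phi 0 v *: delta_mx ord0 i1.
  exact: diff_shear (dphi 0).
pose c : C := 'd phi 0 w; exists (w - c *: delta_mx ord0 i1).
have -> : 'd (shear_spray x) 0 (w - c *: delta_mx ord0 i1) =
    w - c *: delta_mx ord0 i1 + 'd phi 0 (w - c *: delta_mx ord0 i1) *: delta_mx ord0 i1.
  exact: dsp.
have -> : 'd phi 0 (w - c *: delta_mx ord0 i1) = c.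
  transitivity ('d phi 0 w - c * 'd phi 0 (delta_mx ord0 i1 : V)).
    by rewrite linearB linearZ.
  by rewrite dphi1 mulr0 subr0.
exact: subrK.
Qed.

Definition shear_manifold : complex_manifold R d.+2 :=
  orbit_manifold (act := act) (@shear_holomorphic R d q A).

Lemma shear_manifold_elliptic : elliptic shear_manifold.
Proof.
apply: (@orbit_manifold_elliptic _ _ _ act _ shear_spray).
- exact: shear_spray0.
- exact: shear_spray_equivariant.
- exact: shear_spray_holomorphic.
- exact: shear_spray_dominating.
Qed.

End shear_spray.

(** * Sets of primes *)

Fixpoint nth_prime n : nat :=
  if n is n'.+1 then s2val (prime_above (nth_prime n')) else 2.

Lemma nth_primeP n : prime (nth_prime n).
Proof. by case: n => [//|n] /=; case: (prime_above _). Qed.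

Lemma nth_prime_lt n : (nth_prime n < nth_prime n.+1)%N.
Proof. by rewrite /=; case: (prime_above _). Qed.

Lemma nth_prime_inj : injective nth_prime.
Proof.
have mono : {homo nth_prime : m n / (m < n)%N}.
  by apply: homo_ltn; [exact: ltn_trans|exact: nth_prime_lt].
by move=> m n e; case: (ltngtP m n) => // /mono; rewrite e ltnn.
Qed.

Section prime_sets.
Variable S : set nat.

(** A prime with index in [S] divides all but finitely many of these numbers, hence any
    power of it divides some level. *)
Definition prime_step k : nat := \prod_(i < k.+1 | `[< S i >]) nth_prime i.

Lemma prime_step_gt0 k : (0 < prime_step k)%N.
Proof. by apply: prodn_cond_gt0 => i _; exact/prime_gt0/nth_primeP. Qed.

Lemma prime_dvd_step i k : (nth_prime i %| prime_step k)%N -> S i.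
Proof.
rewrite /prime_step Euclid_dvd_prod ?nth_primeP// big_orE.
move=> /fintype.existsP[j /andP[/asboolP Sj]].
by rewrite dvdn_prime2 ?nth_primeP// => /eqP/nth_prime_inj ->.
Qed.

Lemma prime_dvd_level i n : (nth_prime i %| level prime_step n)%N -> S i.
Proof.
rewrite /level Euclid_dvd_prod ?nth_primeP// big_orE => /fintype.existsP[j /= ij].
exact: prime_dvd_step ij.
Qed.

Lemma level_valMn (R : realType) (a : @level_group R prime_step) n :
  val (a *+ n) = val a *+ n.
Proof. by elim: n => [|n IH]; rewrite ?mulr0n// !mulrS -IH. Qed.

(** If $1 = p b$ with $b = k / N_n$, then $p$ divides $N_n$, so its index lies in [S].
    Conversely $p$ divides the factor between some level of a given element and the next
    one. *)
Lemma level_group_divisible (R : realType) i :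
  divisible (nth_prime i) (@level_group R prime_step) <-> S i.
Proof.
pose p := nth_prime i; have p0 : (0 < p)%N by exact/prime_gt0/nth_primeP.
have p0' : p%:R != 0 :> R by rewrite pnatr_eq0 -lt0n.
split=> [dv|Si a].
  have o1 : (1 : R) \in level_pred prime_step.
    by apply/asboolP; exists 0%N; exists 1; rewrite /level big_ord0.
  have [b /(congr1 val) /=] := dv (LevelGroup o1).
  rewrite level_valMn /= => bp; have [n [k bk]] := level_exists b.
  apply: (@prime_dvd_level i n).
  have : (level prime_step n)%:R = (k * p%:Z)%:~R :> R.
    rewrite rmorphM /= -bk -[(p : int)%:~R]/(p%:R) mulr_natr -mulrnA mulnC mulrnA.
    by rewrite -[nth_prime i]/p in bp; rewrite bp.
  rewrite -[(level _ n)%:R]/((level prime_step n : int)%:~R) => /intr_inj e.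
  have : (p%:Z %| (level prime_step n)%:Z)%Z by rewrite e dvdz_mull.
  by rewrite dvdzE.
have [n an] := level_exists a.
pose m := maxn n i; have [k am] := in_level_le (leq_maxl n i) an.
have [c cE] : exists c, prime_step m = (c * p)%N.
  apply/dvdnP; rewrite /prime_step (bigD1 (Ordinal (leq_maxr n i : (i < m.+1)%N)))/=.
    by rewrite dvdn_mulr.
  exact/asboolP.
have bl : val a / p%:R \in level_pred prime_step.
  apply/asboolP; exists m.+1, (k * c%:Z); rewrite levelS cE mulnA mulrnA -[_ *+ p]mulr_natr.
  rewrite [in LHS]mulrnAl [in LHS]mulfVK//.
  by rewrite mulrnA am rmorphM /= -[(c : int)%:~R]/(c%:R) mulr_natr.
exists (LevelGroup bl); apply: val_inj; rewrite level_valMn /=.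
by rewrite -[LHS]mulr_natr divfK.
Qed.

End prime_sets.

Section elliptic_family.
Variable R : realType.
Local Notation C := (complex_numbers R).

Let constants (S : set nat) : exists A : nat -> R,
  (forall n, separating (prime_step S) A n) /\
  (forall n, jet n%:R (2^-1 ^+ n) (fun x : 'rV[C]_(6 + 6) =>
    potential (prime_step S) A n.+1 (zc (d := 4) x) (wc (d := 4) x) (tc (d := 4) x) -
    potential (prime_step S) A n (zc (d := 4) x) (wc (d := 4) x) (tc (d := 4) x))).
Proof.
have [A AP] := @constants_exist R _ (prime_step_gt0 S) _ (zc (d := 4)) (wc (d := 4))
  (tc (d := 4)) (@entry_le _ _ _) (@entry_le _ _ _) (@entry_le _ _ _).
by exists A; split=> n; have [] := AP n.
Qed.

Definition family_action (S : set nat) : deck_action (@level_group R (prime_step S)) 'rV[C]_6 :=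
  shear_action (d := 4) (prime_step_gt0 S) (svalP (cid (constants S))).1.

Definition family (S : set nat) : complex_manifold R 6 :=
  shear_manifold (d := 4) (prime_step_gt0 S) (svalP (cid (constants S))).1.

Lemma family_elliptic S : elliptic (family S).
Proof. exact: shear_manifold_elliptic (svalP (cid (constants S))).2. Qed.

End elliptic_family.

Local Open Scope card_scope.

Theorem corollary1 (R : realType) :
  exists (I : Type) (S : I -> complex_manifold R 6),
    [/\ [set: I] #= [set: set nat],
        forall i : I, [set: S i] !=set0 /\ connected [set: S i],
        forall i : I, elliptic (S i),
        forall (i : I) (x : S i) (n : nat) (a : homotopy_group R x n.+2),
          a = 1%g &
        forall i j : I, i <> j ->
          (forall (x : S i) (y : S j),
             ~ group_isomorphic (homotopy_group R x 1) (homotopy_group R y 1)) /\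
          ~ homotopy_equivalent R (S i) (S j)].
Proof.
exists (set nat), (@family R); split.
- exact: card_eqxx.
- move=> S; split; first by exists (orbit_proj (family_action R S) 0).
  exact: (orbit_space_connected (act := family_action R S) (@rV_connected R 6)).
- exact: family_elliptic.
- move=> S x n a.
  exact: (higher_homotopy_trivial (act := family_action R S) (@segment_equiconnecting R 6)).
move=> S T ST.
have dv := level_group_divisible.
(* The prime of index [i] then divides only one of the two groups. *)
have [i STi] : exists i, ~ (S i <-> T i).
  apply: contrapT => n; apply: ST; apply/funext => i; apply/propext.
  by apply: contrapT => nST; apply: n; exists i.
have s6 := @segment_equiconnecting R 6.
split=> [x y xy|he]; apply: STi; rewrite -(dv S R) -(dv T R); split.
- exact: (isomorphic_divisible (act1 := family_action R T) (act2 := family_action R S) s6 s6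
    (group_isomorphic_sym xy)).
- exact: (isomorphic_divisible (act1 := family_action R S) (act2 := family_action R T)
    s6 s6 xy).
- exact: (@homotopy_equivalent_divisible R _ _ _ _ (family_action R T) (family_action R S)
    _ _ 0 _ s6 s6 (homotopy_equivalent_sym he)).
- exact: (@homotopy_equivalent_divisible R _ _ _ _ (family_action R S) (family_action R T)
    _ _ 0 _ s6 s6 he).
Qed.
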